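(* Assume (A0) and (A1), and let $T>0$. The unique viscosity solution $u$ of $u_t+H(x,u_x)=0$ on $J_T$ with $u(0,\cdot)=u_0$ satisfying $|u-u_0|\le C_T$ on $J_T$ for some constant $C_T$ is $u=u_{\mathrm{oc}}$, and moreover the Hopf–Lax type formula $$u_{\mathrm{oc}}(t,x)=\inf_{y\in J}\{u_0(y)+\mathcal{D}(0,y;t,x)\}$$ holds for all $(t,x)\in J_T$.
   Context: Junction: fix an integer $N\ge1$ and $N$ distinct unit vectors $e_1,\dots,e_N\in\mathbb{R}^2$. Set $J_i=[0,\infty)e_i$, $J_i^*=J_i\setminus\{0\}$, $J=\bigcup_{i=1}^NJ_i$, $I_N=\{1,\dots,N\}$. Each $x\in J_i$ is written $x=x_ie_i$, $x_i\ge0$. $J$ carries the geodesic distance $d(x,y)=|x-y|$ if $x,y$ lie in a common branch, $d(x,y)=|x|+|y|$ otherwise. $J_T=(0,T)\times J$; balls are taken in $(0,\infty)\times J$. For $u$ on $J_T$, $u^i$ is its restriction to $(0,T)\times J_i$ as a function of $(t,x_i)$; $C^1_*(J_T)$ is the set of continuous $u$ with each $u^i\in C^1((0,T)\times[0,\infty))$; $u^i_x=\partial u^i/\partial x_i$, $u_x=u^i_x$ on $J_i^*$, $u_x(t,0)=(u^1_x(t,0),\dots,u^N_x(t,0))$. (A0): $u_0:J\to\mathbb{R}$ is Lipschitz with respect to $d$. (A1): there is $\gamma>0$ with $L_i\in C^2(\mathbb{R})$, $L_i''\ge\gamma$ for each $i$; $H_i(p)=\sup_{q\in\mathbb{R}}(pq-L_i(q))$,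 $H_i^-(p)=\sup_{q\le0}(pq-L_i(q))$. $H(x,p)=H_i(p)$ for $x\in J_i^*$, $H(0,p)=\max_iH_i^-(p_i)$ for $p\in\mathbb{R}^N$. Viscosity solutions: $u$ is a sub-solution (resp. super-solution) on $J_T$ if it is u.s.c. (resp. l.s.c.) and for every $\phi\in C^1_*(J_T)$ touching $u$ from above (resp. below) at $P=(t,x)\in J_T$ on some ball $B(P,r)$: $\phi_t+H_i(\phi_x)\le0$ (resp. $\ge0$) at $P$ if $x\in J_i^*$, and $\phi_t(t,0)+\max_iH_i^-(\phi^i_x(t,0))\le0$ (resp. $\ge0$) if $x=0$; with the initial condition, additionally $u(0,\cdot)\le u_0$ (resp. $\ge u_0$). A solution is a function whose u.s.c. envelope is a sub-solution and l.s.c. envelope a super-solution. Optimal control: $L_0(p)=\min_{j\in I_N}L_j(p)$. Admissible directions: $A(x)=\mathbb{R}e_i$ if $x\in J_i^*$, $A(0)=\bigcup_i[0,\infty)e_i$. For $P=pe_i\in A(x)$: $L(x,P)=L_i(p)$ if $x\in J_i^*$, $L(0,P)=L_0(p)$. For $s<t$, $\mathcal{A}(s,y;t,x)$ is the set of $X\in W^{1,1}([s,t];\mathbb{R}^2)$ with $X(\tau)\in J$ for all $\tau$, $\dot X(\tau)\in A(X(\tau))$ for a.e. $\tau$, $X(s)=y$, $X(t)=x$. The minimal action is $\mathcal{D}(s,y;t,x)=\inf_{X\in\mathcal{A}(s,y;t,x)}\int_s^tL(X(\tau),\dot X(\tau))\,d\tau$ for $s<t$, and $\mathcal{D}(t,y;t,x)=0$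 if $y=x$, $+\infty$ otherwise. The value function is $u_{\mathrm{oc}}(t,x)=\inf_{y\in J,\,X\in\mathcal{A}(0,y;t,x)}\{u_0(y)+\int_0^tL(X,\dot X)\,d\tau\}$ for $t>0$, and $u_{\mathrm{oc}}(0,\cdot)=u_0$. *)

(* Defs.v *)
From Stdlib Require Import Reals Lra List ClassicalEpsilon.
Open Scope R_scope.

Inductive ERbar : Type := Fin (r : R) | PInf | MInf.

Definition ERle (a b : ERbar) : Prop :=
  match a, b with
  | MInf, _ => True
  | _, PInf => True
  | Fin x, Fin y => x <= y
  | _, _ => False
  end.

Definition ERplusR (x : R) (v : ERbar) : ERbar :=
  match v with Fin y => Fin (x + y) | PInf => PInf | MInf => MInf end.

Definition ERreal (v : ERbar) : R := match v with Fin x => x | _ => 0 end.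

Definition is_inf_ER (S : ERbar -> Prop) (m : ERbar) : Prop :=
  (forall v, S v -> ERle m v) /\
  (forall m', (forall v, S v -> ERle m' v) -> ERle m' m).

Definition is_sup_ER (S : ERbar -> Prop) (m : ERbar) : Prop :=
  (forall v, S v -> ERle v m) /\
  (forall m', (forall v, S v -> ERle v m') -> ERle m m').

(* infimum / supremum in [-oo,+oo] (they always exist; inf of empty = +oo) *)
Definition ERInf (S : ERbar -> Prop) : ERbar :=
  epsilon (inhabits PInf) (is_inf_ER S).
Definition ERSup (S : ERbar -> Prop) : ERbar :=
  epsilon (inhabits MInf) (is_sup_ER S).

Definition pt : Type := (R * R)%type.
Definition origin : pt := (0, 0).
Definition scal (r : R) (v : pt) : pt := (r * fst v, r * snd v).
Definition enorm (v : pt) : R := sqrt (fst v * fst v + snd v * snd v).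
Definition edist (x y : pt) : R := enorm (fst x - fst y, snd x - snd y).

Definition junction (N : nat) (e : nat -> pt) : Prop :=
  (1 <= N)%nat /\
  (forall i, (i < N)%nat -> enorm (e i) = 1) /\
  (forall i j, (i < N)%nat -> (j < N)%nat -> e i = e j -> i = j).

Definition inJi (e : nat -> pt) (i : nat) (x : pt) : Prop :=
  exists r, 0 <= r /\ x = scal r (e i).
Definition inJ (N : nat) (e : nat -> pt) (x : pt) : Prop :=
  exists i, (i < N)%nat /\ inJi e i x.

Definition dJ (N : nat) (e : nat -> pt) (x y : pt) : R :=
  epsilon (inhabits 0)
    (fun d => ((exists i, (i < N)%nat /\ inJi e i x /\ inJi e i y) /\ d = edist x y) \/
              (~ (exists i, (i < N)%nat /\ inJi e i x /\ inJi e i y) /\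
               d = enorm x + enorm y)).

Definition hypA0 (N : nat) (e : nat -> pt) (u0 : pt -> R) : Prop :=
  exists K, forall x y, inJ N e x -> inJ N e y ->
    Rabs (u0 x - u0 y) <= K * dJ N e x y.

Definition hypA1 (N : nat) (L : nat -> R -> R) (gamma : R) : Prop :=
  0 < gamma /\
  forall i, (i < N)%nat ->
    exists L1 L2 : R -> R,
      (forall q, derivable_pt_lim (L i) q (L1 q)) /\
      (forall q, derivable_pt_lim L1 q (L2 q)) /\
      continuity L2 /\
      (forall q, gamma <= L2 q).

Fixpoint maxUpTo (f : nat -> R) (n : nat) : R :=
  match n with O => f O | S m => Rmax (maxUpTo f m) (f (S m)) end.
Fixpoint minUpTo (f : nat -> R) (n : nat) : R :=
  match n with O => f O | S m => Rmin (minUpTo f m) (f (S m)) end.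

Definition Hfun (Li : R -> R) (p : R) : R :=
  ERreal (ERSup (fun v => exists q, v = Fin (p * q - Li q))).
Definition Hminus (Li : R -> R) (p : R) : R :=
  ERreal (ERSup (fun v => exists q, q <= 0 /\ v = Fin (p * q - Li q))).
Definition Hvertex (N : nat) (L : nat -> R -> R) (p : nat -> R) : R :=
  maxUpTo (fun i => Hminus (L i) (p i)) (N - 1).
Definition Lzero (N : nat) (L : nat -> R -> R) (p : R) : R :=
  minUpTo (fun j => L j p) (N - 1).

(* g : (t, x_i) |-> g t x_i is C^1 on (0,T) x [0,oo) with partial
   derivatives gt, gx (one-sided in x at x = 0), continuous on that set. *)
Definition C1_half (T : R) (g gt gx : R -> R -> R) : Prop :=
  (forall t r, 0 < t < T -> 0 <= r ->
     forall eps, 0 < eps -> exists delta, 0 < delta /\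
       forall t' r', 0 < t' < T -> 0 <= r' -> Rabs (t' - t) < delta ->
         Rabs (r' - r) < delta ->
         Rabs (g t' r' - g t r - gt t r * (t' - t) - gx t r * (r' - r))
           <= eps * (Rabs (t' - t) + Rabs (r' - r))) /\
  (forall t r, 0 < t < T -> 0 <= r ->
     forall eps, 0 < eps -> exists delta, 0 < delta /\
       forall t' r', 0 < t' < T -> 0 <= r' -> Rabs (t' - t) < delta ->
         Rabs (r' - r) < delta ->
         Rabs (gt t' r' - gt t r) < eps /\ Rabs (gx t' r' - gx t r) < eps).

Definition C1star (N : nat) (e : nat -> pt) (T : R) (phi : R -> pt -> R)
  (Dt Dx : nat -> R -> R -> R) : Prop :=
  forall i, (i < N)%nat ->
    C1_half T (fun t r => phi t (scal r (e i))) (Dt i) (Dx i).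

Definition dom (N : nat) (e : nat -> pt) (T t : R) (x : pt) : Prop :=
  0 <= t < T /\ inJ N e x.

Definition touch_above (N : nat) (e : nat -> pt) (T : R) (u phi : R -> pt -> R)
  (t : R) (x : pt) : Prop :=
  u t x = phi t x /\ exists r, 0 < r /\
    forall s y, 0 < s < T -> inJ N e y -> Rabs (s - t) < r -> dJ N e y x < r ->
      u s y <= phi s y.
Definition touch_below (N : nat) (e : nat -> pt) (T : R) (u phi : R -> pt -> R)
  (t : R) (x : pt) : Prop :=
  u t x = phi t x /\ exists r, 0 < r /\
    forall s y, 0 < s < T -> inJ N e y -> Rabs (s - t) < r -> dJ N e y x < r ->
      phi s y <= u s y.

Definition usc_on (N : nat) (e : nat -> pt) (T : R) (u : R -> pt -> R) : Prop :=
  forall t x, dom N e T t x -> forall eps, 0 < eps -> exists r, 0 < r /\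
    forall s y, dom N e T s y -> Rabs (s - t) < r -> dJ N e y x < r ->
      u s y < u t x + eps.
Definition lsc_on (N : nat) (e : nat -> pt) (T : R) (u : R -> pt -> R) : Prop :=
  forall t x, dom N e T t x -> forall eps, 0 < eps -> exists r, 0 < r /\
    forall s y, dom N e T s y -> Rabs (s - t) < r -> dJ N e y x < r ->
      u t x - eps < u s y.

Definition subsolution (N : nat) (e : nat -> pt) (L : nat -> R -> R)
  (u0 : pt -> R) (T : R) (u : R -> pt -> R) : Prop :=
  usc_on N e T u /\
  (forall phi Dt Dx t x, C1star N e T phi Dt Dx -> 0 < t < T -> inJ N e x ->
     touch_above N e T u phi t x ->
     (forall i r, (i < N)%nat -> 0 < r -> x = scal r (e i) ->
        Dt i t r + Hfun (L i) (Dx i t r) <= 0) /\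
     (x = origin -> Dt O t 0 + Hvertex N L (fun i => Dx i t 0) <= 0)) /\
  (forall x, inJ N e x -> u 0 x <= u0 x).

Definition supersolution (N : nat) (e : nat -> pt) (L : nat -> R -> R)
  (u0 : pt -> R) (T : R) (u : R -> pt -> R) : Prop :=
  lsc_on N e T u /\
  (forall phi Dt Dx t x, C1star N e T phi Dt Dx -> 0 < t < T -> inJ N e x ->
     touch_below N e T u phi t x ->
     (forall i r, (i < N)%nat -> 0 < r -> x = scal r (e i) ->
        Dt i t r + Hfun (L i) (Dx i t r) >= 0) /\
     (x = origin -> Dt O t 0 + Hvertex N L (fun i => Dx i t 0) >= 0)) /\
  (forall x, inJ N e x -> u 0 x >= u0 x).

Definition ustar (N : nat) (e : nat -> pt) (T : R) (u : R -> pt -> R)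
  (t : R) (x : pt) : ERbar :=
  ERInf (fun v => exists r, 0 < r /\
    v = ERSup (fun w => exists s y, dom N e T s y /\ Rabs (s - t) < r /\
                          dJ N e y x < r /\ w = Fin (u s y))).
Definition lstar (N : nat) (e : nat -> pt) (T : R) (u : R -> pt -> R)
  (t : R) (x : pt) : ERbar :=
  ERSup (fun v => exists r, 0 < r /\
    v = ERInf (fun w => exists s y, dom N e T s y /\ Rabs (s - t) < r /\
                          dJ N e y x < r /\ w = Fin (u s y))).

Definition solution (N : nat) (e : nat -> pt) (L : nat -> R -> R)
  (u0 : pt -> R) (T : R) (u : R -> pt -> R) : Prop :=
  (forall t x, dom N e T t x ->
     (exists a, ustar N e T u t x = Fin a) /\ (exists b, lstar N e T u t x = Fin b)) /\
  subsolution N e L u0 T (fun t x => ERreal (ustar N e T u t x)) /\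
  supersolution N e L u0 T (fun t x => ERreal (lstar N e T u t x)).

Definition null_set (Z : R -> Prop) : Prop :=
  forall eps, 0 < eps -> exists a b : nat -> R,
    (forall n, a n <= b n) /\
    (forall n, sum_f_R0 (fun k => b k - a k) n < eps) /\
    (forall z, Z z -> exists n, a n <= z <= b n).

Definition ae_on (s t : R) (P : R -> Prop) : Prop :=
  exists Z, null_set Z /\ forall tau, s <= tau <= t -> ~ Z tau -> P tau.

Fixpoint nonoverlapping (s t : R) (l : list (R * R)) : Prop :=
  match l with
  | nil => s <= t
  | (a, b) :: l' => s <= a /\ a <= b /\ nonoverlapping b t l'
  end.
Fixpoint sum_len (l : list (R * R)) : R :=
  match l with nil => 0 | (a, b) :: l' => (b - a) + sum_len l' end.
Fixpoint sum_var (f : R -> R) (l : list (R * R)) : R :=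
  match l with nil => 0 | (a, b) :: l' => Rabs (f b - f a) + sum_var f l' end.

Definition abs_cont (f : R -> R) (s t : R) : Prop :=
  forall eps, 0 < eps -> exists delta, 0 < delta /\
    forall l, nonoverlapping s t l -> sum_len l < delta -> sum_var f l < eps.

(* tagged divisions of [a,b]: list of (tag, right endpoint) *)
Fixpoint tagged_div (a b : R) (l : list (R * R)) : Prop :=
  match l with
  | nil => a = b
  | (xi, c) :: l' => a < c /\ a <= xi <= c /\ tagged_div c b l'
  end.
Fixpoint fine (delta : R -> R) (a : R) (l : list (R * R)) : Prop :=
  match l with
  | nil => True
  | (xi, c) :: l' => xi - delta xi < a /\ c < xi + delta xi /\ fine delta c l'
  end.
Fixpoint rsum (f : R -> R) (a : R) (l : list (R * R)) : R :=
  match l with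
  | nil => 0
  | (xi, c) :: l' => f xi * (c - a) + rsum f c l'
  end.

Definition HK_integral (f : R -> R) (a b I : R) : Prop :=
  forall eps, 0 < eps -> exists delta : R -> R, (forall x, 0 < delta x) /\
    forall l, tagged_div a b l -> fine delta a l -> Rabs (rsum f a l - I) < eps.

Definition curve_deriv (X : R -> pt) (tau : R) (V : pt) : Prop :=
  derivable_pt_lim (fun s => fst (X s)) tau (fst V) /\
  derivable_pt_lim (fun s => snd (X s)) tau (snd V).

Definition admissible_dir (N : nat) (e : nat -> pt) (x P : pt) : Prop :=
  (exists i r, (i < N)%nat /\ 0 < r /\ x = scal r (e i) /\ exists p, P = scal p (e i)) \/
  (x = origin /\ exists i p, (i < N)%nat /\ 0 <= p /\ P = scal p (e i)).

Definition Lcost (N : nat) (e : nat -> pt) (L : nat -> R -> R) (x P : pt) (v : R) : Prop :=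
  (exists i r, (i < N)%nat /\ 0 < r /\ x = scal r (e i) /\
     exists p, P = scal p (e i) /\ v = L i p) \/
  (x = origin /\ exists i p, (i < N)%nat /\ 0 <= p /\ P = scal p (e i) /\
     v = Lzero N L p).

(* X in A(s,y;t,x)  (W^{1,1}([s,t];R^2) = absolutely continuous on [s,t]) *)
Definition adm_curve (N : nat) (e : nat -> pt) (s : R) (y : pt) (t : R) (x : pt)
  (X : R -> pt) : Prop :=
  abs_cont (fun tau => fst (X tau)) s t /\ abs_cont (fun tau => snd (X tau)) s t /\
  (forall tau, s <= tau <= t -> inJ N e (X tau)) /\
  X s = y /\ X t = x /\
  ae_on s t (fun tau => exists V, curve_deriv X tau V /\ admissible_dir N e (X tau) V).

Definition action (N : nat) (e : nat -> pt) (L : nat -> R -> R) (X : R -> pt)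
  (s t I : R) : Prop :=
  exists f : R -> R, HK_integral f s t I /\
    ae_on s t (fun tau => exists V, curve_deriv X tau V /\ Lcost N e L (X tau) V (f tau)).

Definition Dact (N : nat) (e : nat -> pt) (L : nat -> R -> R)
  (s : R) (y : pt) (t : R) (x : pt) : ERbar :=
  epsilon (inhabits PInf) (fun v =>
    (s < t /\ v = ERInf (fun w => exists X I, adm_curve N e s y t x X /\
                                   action N e L X s t I /\ w = Fin I)) \/
    (s = t /\ y = x /\ v = Fin 0) \/
    (~ (s < t) /\ ~ (s = t /\ y = x) /\ v = PInf)).

Definition uoc (N : nat) (e : nat -> pt) (L : nat -> R -> R) (u0 : pt -> R)
  (t : R) (x : pt) : ERbar :=
  epsilon (inhabits PInf) (fun v =>
    (0 < t /\ v = ERInf (fun w => exists y X I, inJ N e y /\ adm_curve N e 0 y t x X /\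
                                   action N e L X 0 t I /\ w = Fin (u0 y + I))) \/
    (~ (0 < t) /\ v = Fin (u0 x))).

(* Main.v *)
(** The value function is the infimum of the costs of piecewise affine plans. It is Lipschitz and
    satisfies, along every segment of a branch, the inequality
    W(t+h, x+qh) <= W(t, x) + h L_i(q) (DPP), and everything is read off this inequality.

    - W = u_oc: a plan is an admissible curve; conversely, along an absolutely continuous curve
      X the function W(t, X(t)) is absolutely continuous, and (DPP) bounds its increments on small
      intervals by the Lagrangian, since a.e. the curve is either inside a branch or at rest at
      the vertex. A Henstock-Kurzweil argument integrates this bound.
    - W is a sub-solution by (DPP). If the super-solution inequality failed for a function touching
      W from below, a piecewise affine barrier with the same contact point would also obey (DPP);
      bumping it up contradicts the definition of W.
    - A sub-solution v is below W because v also satisfies (DPP), by penalization around a segment.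
    - A super-solution v is above W: averaging (DPP), which is linear in W, gives C^1 functions on
      each branch close to W which are almost classical sub-solutions up to the vertex, so that a
      minimum of v minus such a function, made strict and coercive, is impossible. *)

Require Import Defs.
From Stdlib Require Import Reals Lra Lia List ClassicalEpsilon Classical FunctionalExtensionality.
From Stdlib Require Import Cantor ZArith.
From Coquelicot Require Hierarchy Continuity RInt.
Open Scope R_scope.

(** Comparison on a junction is usually obstructed by the vertex: doubling the variables leaves two
    test functions whose slopes cannot be matched branch by branch. No doubling takes place here,
    because one of the two functions compared is always W, for which much more is known than
    semicontinuity. Every segment lies in one branch, so the vertex enters through the sign of the
    velocity: a segment that ends there has q <= 0, which is exactly the range seen by H_i^-. The a
    priori bounds come from two facts. With K a Lipschitz constant of u_0, the inequality K|q| - C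
    <= L_i(q) keeps W above u_0 - C t; together with the bound C on L_i(0), L_i(1) and L_i(-1) it
    makes W Lipschitz with constant 2C + K. The density in the action is arbitrary, possibly
    unbounded, on a null set, so the gauges must be able to neglect such a set. A curve is at rest
    at the vertex almost everywhere because a visit with nonzero velocity is isolated in time, and
    isolated times are countable. *)

Ltac Rmin_pose a b :=
  lazymatch goal with
  | _ : Rmin a b <= a |- _ => fail
  | _ => pose proof (Rmin_l a b); pose proof (Rmin_r a b)
  end.

Ltac Rmin_bounds :=
  repeat match goal with
  | |- context [Rmin ?a ?b] => Rmin_pose a b
  | _ : context [Rmin ?a ?b] |- _ => Rmin_pose a b
  end.

(** * Gauge-fine divisions and Cousin's lemma *)

Lemma tagged_div_le (l : list (R * R)) : forall a b, tagged_div a b l -> a <= b.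
Proof.
  induction l as [|[xi c] l IH]; simpl; intros a b H; [lra|].
  destruct H as (H1 & H2 & H3); apply IH in H3; lra.
Qed.

Lemma tagged_div_app (l1 l2 : list (R * R)) : forall a b c,
  tagged_div a b l1 -> tagged_div b c l2 -> tagged_div a c (l1 ++ l2).
Proof.
  induction l1 as [|[xi d] l1 IH]; simpl; intros a b c H1 H2.
  - now subst.
  - destruct H1 as (H & H' & H3); eauto.
Qed.

Lemma fine_app (delta : R -> R) (l1 l2 : list (R * R)) : forall a b,
  tagged_div a b l1 -> fine delta a l1 -> fine delta b l2 -> fine delta a (l1 ++ l2).
Proof.
  induction l1 as [|[xi d] l1 IH]; simpl; intros a b H1 H2 H3.
  - now subst.
  - destruct H1 as (? & ? & ?), H2 as (? & ? & ?); eauto.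
Qed.

(** At the supremum m of the right endpoints that admit a fine division, one more interval tagged m
    passes beyond m, so the construction cannot stop before b. This is the form in which compactness
    of a segment is used below. *)
Lemma cousin (delta : R -> R) (a b : R) :
  a <= b -> (forall x, 0 < delta x) -> exists l, tagged_div a b l /\ fine delta a l.
Proof.
  intros Hab Hd.
  set (E := fun x => a <= x <= b /\ exists l, tagged_div a x l /\ fine delta a l).
  assert (Ea : E a) by (split; [lra|]; exists nil; simpl; auto).
  destruct (completeness E) as [m [Hub Hlub]].
  { exists b; intros x [H _]; lra. }
  { now exists a. }
  assert (Ham : a <= m) by (apply Hub; auto).
  assert (Hmb : m <= b) by (apply Hlub; intros x [H _]; lra).
  assert (Hx : exists x, E x /\ m - delta m < x).
  { apply NNPP; intro H.
    assert (m <= m - delta m); [|specialize (Hd m); lra].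
    apply Hlub; intros x Ex; apply Rnot_lt_le; intro; apply H; eauto. }
  destruct Hx as (x & [Hx1 (l & Hl1 & Hl2)] & Hx2).
  assert (x <= m) by (apply Hub; split; eauto).
  set (y := Rmin b (m + delta m / 2)).
  assert (Hy : m <= y <= b /\ y < m + delta m).
  { unfold y, Rmin; destruct (Rle_dec b (m + delta m / 2)); specialize (Hd m); lra. }
  assert (Ey : E y).
  { destruct (Req_dec x y) as [->|Hne]; [split; [lra|eauto]|].
    split; [lra|]. exists (l ++ (m, y) :: nil); split.
    - eapply tagged_div_app; eauto; simpl; repeat split; lra.
    - eapply fine_app; eauto; simpl; repeat split; lra. }
  assert (y <= m) by (apply Hub; auto).
  destruct Ey as [_ Ey].
  replace b with y; auto.
  unfold y, Rmin in *; destruct (Rle_dec b (m + delta m / 2)); specialize (Hd m); lra.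
Qed.

(** The neighbourhoods may shrink without a uniform lower bound, so no fixed mesh works. Along a
    division fine for their radii, g decreases from each left endpoint to the tag and from the tag
    to the right endpoint. *)
Lemma local_nonincreasing (g : R -> R) (a b : R) :
  a <= b ->
  (forall x, a <= x <= b -> exists d, 0 < d /\ forall y, a <= y <= b -> Rabs (y - x) < d ->
     (x <= y -> g y <= g x) /\ (y <= x -> g x <= g y)) ->
  g b <= g a.
Proof.
  intros Hab H.
  set (P := fun x d => 0 < d /\ (a <= x <= b -> forall y, a <= y <= b -> Rabs (y - x) < d ->
     (x <= y -> g y <= g x) /\ (y <= x -> g x <= g y))).
  assert (HP : forall x, exists d, P x d).
  { intro x; destruct (classic (a <= x <= b)) as [Hx|Hx].
    - destruct (H x Hx) as (d & Hd & Hd'); exists d; split; auto.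
    - exists 1; split; [lra|tauto]. }
  destruct (choice _ HP) as [delta Hdelta].
  destruct (cousin delta a b Hab (fun x => proj1 (Hdelta x))) as (l & Hl & Hf).
  assert (Hgen : forall l c, a <= c -> tagged_div c b l -> fine delta c l -> g b <= g c).
  { clear - Hdelta. induction l as [|[xi d] l IH]; simpl; intros c Hc Hl Hf.
    - subst; lra.
    - destruct Hl as (H1 & H2 & H3), Hf as (H4 & H5 & H6).
      pose proof (tagged_div_le _ _ _ H3).
      assert (g b <= g d) by (apply IH; auto; lra).
      destruct (Hdelta xi) as [_ Hxi].
      assert (Hx : a <= xi <= b) by lra.
      destruct (Hxi Hx c) as [_ Hc']; [lra|apply Rabs_def1; lra|].
      destruct (Hxi Hx d) as [Hd' _]; [lra|apply Rabs_def1; lra|].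
      assert (g xi <= g c) by (apply Hc'; lra).
      assert (g d <= g xi) by (apply Hd'; lra). lra. }
  apply (Hgen l); auto; lra.
Qed.

(** * Maxima of upper semicontinuous functions *)

Definition usc1 (a b : R) (g : R -> R) : Prop :=
  forall x, a <= x <= b -> forall eps, 0 < eps -> exists r, 0 < r /\
    forall y, a <= y <= b -> Rabs (y - x) < r -> g y < g x + eps.

Lemma list_Rmax (A : Type) (h : A -> R) (l : list A) :
  l <> nil -> exists x, In x l /\ forall y, In y l -> h y <= h x.
Proof.
  induction l as [|x l IH]; [tauto|intros _].
  destruct l as [|y l].
  - exists x; split; [now left|]; intros y [->|[]]; lra.
  - destruct IH as (z & Hz & Hm); [discriminate|].
    destruct (Rle_dec (h x) (h z)).
    + exists z; split; [now right|]; intros w [->|Hw]; auto.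
    + exists x; split; [now left|]; intros w [->|Hw]; [lra|].
      specialize (Hm w Hw); lra.
Qed.

Lemma tagged_div_covers (delta : R -> R) (l : list (R * R)) : forall a b,
  tagged_div a b l -> fine delta a l -> a < b -> forall x, a <= x <= b ->
  exists p, In p l /\ a <= fst p <= b /\ Rabs (x - fst p) < delta (fst p).
Proof.
  induction l as [|[xi c] l IH]; simpl; intros a b H1 H2 Hab x Hx; [lra|].
  destruct H1 as (H3 & H4 & H5), H2 as (H6 & H7 & H8).
  pose proof (tagged_div_le _ _ _ H5).
  destruct (Rle_dec x c).
  - exists (xi, c); split; [now left|]; simpl; split; [lra|].
    apply Rabs_def1; lra.
  - destruct (IH c b H5 H8) with (x := x) as (p & Hp & Hp' & Hp2); [lra|lra|].
    exists p; split; [now right|]; split; [lra|auto].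
Qed.

(** If there were no maximum, each x would have an x' that beats a whole neighbourhood of x. A fine
    division leaves finitely many such x'; the best of them lies in one of the neighbourhoods and is
    beaten by another, a contradiction. *)
Lemma usc1_max (a b : R) (g : R -> R) :
  a <= b -> usc1 a b g -> exists x, a <= x <= b /\ forall y, a <= y <= b -> g y <= g x.
Proof.
  intros Hab Hu.
  destruct (Req_dec a b) as [->|Hne].
  { exists b; split; [lra|]; intros y Hy; replace y with b by lra; lra. }
  apply NNPP; intro Hno.
  assert (Hbig : forall x, exists p : R * R, a <= fst p <= b /\ 0 < snd p /\
     (a <= x <= b -> forall y, a <= y <= b -> Rabs (y - x) < snd p -> g y < g (fst p))).
  { intro x; destruct (classic (a <= x <= b)) as [Hx|Hx].
    - assert (exists x', a <= x' <= b /\ g x < g x') as (x' & Hx' & Hg).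
      { apply NNPP; intro H; apply Hno; exists x; split; auto.
        intros y Hy; apply Rnot_lt_le; intro; apply H; eauto. }
      destruct (Hu x Hx (g x' - g x)) as (r & Hr & Hr'); [lra|].
      exists (x', r); simpl; repeat split; try lra.
      intros _ y Hy Hyx; specialize (Hr' y Hy Hyx); lra.
    - exists (a, 1); simpl; repeat split; try lra; tauto. }
  destruct (choice _ Hbig) as [F HF].
  destruct (cousin (fun x => snd (F x)) a b Hab) as (l & Hl & Hf).
  { intro x; apply HF. }
  destruct (list_Rmax _ (fun p => g (fst (F (fst p)))) l) as (p & Hp & Hmax).
  { intro E; subst l; simpl in Hl; lra. }
  set (z := fst (F (fst p))).
  assert (Hz : a <= z <= b) by apply HF.
  destruct (tagged_div_covers _ _ _ _ Hl Hf ltac:(lra) z Hz) as (p' & Hp' & Hb & Hc).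
  destruct (HF (fst p')) as (_ & _ & HH).
  specialize (HH Hb z Hz Hc). specialize (Hmax p' Hp'). fold z in Hmax. lra.
Qed.

Definition usc2 (a b c d : R) (g : R -> R -> R) : Prop :=
  forall t x, a <= t <= b -> c <= x <= d -> forall eps, 0 < eps -> exists r, 0 < r /\
    forall s y, a <= s <= b -> c <= y <= d -> Rabs (s - t) < r -> Rabs (y - x) < r ->
      g s y < g t x + eps.

(** Iterated maximum: the partial maximum over x is upper semicontinuous in t by a tube argument,
    where finitely many tags cover the fibre and the smallest of their radii serves for all of
    it. *)
Lemma usc2_max (a b c d : R) (g : R -> R -> R) :
  a <= b -> c <= d -> usc2 a b c d g ->
  exists t x, a <= t <= b /\ c <= x <= d /\
    forall s y, a <= s <= b -> c <= y <= d -> g s y <= g t x.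
Proof.
  intros Hab Hcd Hu.
  assert (Hm : forall t, exists x, a <= t <= b -> c <= x <= d /\ forall y, c <= y <= d -> g t y <= g t x).
  { intro t; destruct (classic (a <= t <= b)) as [Ht|Ht]; [|exists c; tauto].
    destruct (usc1_max c d (g t) Hcd) as (x & Hx).
    - intros x Hx eps He; destruct (Hu t x Ht Hx eps He) as (r & Hr & Hr').
      exists r; split; auto; intros y Hy Hyx; apply Hr'; auto.
      rewrite Rminus_diag, Rabs_R0; auto.
    - exists x; auto. }
  destruct (choice _ Hm) as [m Hmm].
  destruct (usc1_max a b (fun t => g t (m t)) Hab) as (t & Ht & Hmax).
  - intros t Ht eps He.
    assert (Hr : forall x, exists r, 0 < r /\ (c <= x <= d ->
       forall s y, a <= s <= b -> c <= y <= d -> Rabs (s - t) < r -> Rabs (y - x) < r ->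
         g s y < g t (m t) + eps)).
    { intro x; destruct (classic (c <= x <= d)) as [Hx|Hx]; [|exists 1; split; [lra|tauto]].
      destruct (Hu t x Ht Hx eps He) as (r & Hr & Hr').
      exists r; split; auto; intros _ s y Hs Hy H1 H2; specialize (Hr' s y Hs Hy H1 H2).
      destruct (Hmm t Ht) as [_ Hmt]; specialize (Hmt x Hx); lra. }
    destruct (choice _ Hr) as [rad Hrad].
    (* A degenerate fibre has only the empty division, which covers nothing. *)
    destruct (Req_dec c d) as [Hcd'|Hcd'].
    { exists (rad c); split; [apply Hrad|]. intros s Hs Hst.
      destruct (Hmm s Hs) as [Hms _]. destruct (Hrad c) as [H0 H1].
      apply H1; auto; [lra|]. replace (m s - c) with 0 by lra. rewrite Rabs_R0; auto. }
    destruct (cousin rad c d Hcd) as (l & Hl & Hf); [intro x; apply Hrad|].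
    destruct (list_Rmax _ (fun p => - rad (fst p)) l) as (p & Hp & Hpm).
    { intro E; subst l; simpl in Hl; lra. }
    exists (rad (fst p)); split; [apply Hrad|].
    intros s Hs Hst. destruct (Hmm s Hs) as [Hms _].
    destruct (tagged_div_covers _ _ _ _ Hl Hf ltac:(lra) (m s) Hms) as (p' & Hp' & Hb & Hc).
    destruct (Hrad (fst p')) as (_ & HH). apply HH; auto.
    specialize (Hpm p' Hp'); lra.
  - exists t, (m t). destruct (Hmm t Ht) as [Hmt _]. repeat split; try tauto.
    intros s y Hs Hy. specialize (Hmax s Hs). destruct (Hmm s Hs) as [_ H].
    specialize (H y Hy). lra.
Qed.

Lemma Rabs_le_both (a b : R) : Rabs a <= b -> - b <= a <= b.
Proof. intro H; pose proof (Rle_abs a); pose proof (Rle_abs (- a)); rewrite Rabs_Ropp in *; lra. Qed.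

Lemma Rabs_minus_le (a b : R) : Rabs (a - b) <= Rabs a + Rabs b.
Proof. unfold Rminus. rewrite <- (Rabs_Ropp b). apply Rabs_triang. Qed.

Lemma Rabs_ge_opp (a : R) : - a <= Rabs a.
Proof. rewrite <- Rabs_Ropp. apply Rle_abs. Qed.

Lemma Rinv_nonneg (a : R) : 0 < a -> 0 <= / a.
Proof. intro H. now apply Rlt_le, Rinv_0_lt_compat. Qed.

(** * Null sets and the Henstock-Kurzweil integral *)

Lemma sum_f_R0_geom (w : R) (n : nat) :
  sum_f_R0 (fun k => w * (1 / 2) ^ k) n = w * (2 - (1 / 2) ^ n).
Proof. induction n; simpl in *; [lra|rewrite IHn; lra]. Qed.

Lemma sum_f_R0_geom_lt (w : R) (n : nat) :
  0 < w -> sum_f_R0 (fun k => w * (1 / 2) ^ k) n < 2 * w.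
Proof.
  intro Hw; rewrite sum_f_R0_geom.
  assert (0 < (1 / 2) ^ n) by (apply pow_lt; lra). nra.
Qed.

Lemma null_set_range (g : nat -> R) (Z : R -> Prop) :
  (forall z, Z z -> exists n, z = g n) -> null_set Z.
Proof.
  intros H eps He.
  exists (fun n => g n), (fun n => g n + eps / 4 * (1 / 2) ^ n).
  assert (Hp : forall n, 0 < (1 / 2) ^ n) by (intro; apply pow_lt; lra).
  split; [intro n; specialize (Hp n); nra|split].
  - intro n. rewrite (sum_eq _ (fun k => eps / 4 * (1 / 2) ^ k)); [|intros; lra].
    pose proof (sum_f_R0_geom_lt (eps / 4) n ltac:(lra)); lra.
  - intros z Hz; destruct (H z Hz) as [n ->]; exists n. specialize (Hp n); nra.
Qed.

Lemma sum_interleave (f g : nat -> R) (n : nat) :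
  sum_f_R0 (fun k => if Nat.even k then f (Nat.div2 k) else g (Nat.div2 k)) (S (2 * n))
  = sum_f_R0 f n + sum_f_R0 g n.
Proof.
  induction n; [simpl; lra|].
  replace (S (2 * S n)) with (S (S (S (2 * n)))) by lia.
  rewrite tech5, tech5, IHn.
  replace (S (S (2 * n))) with (2 * S n)%nat by lia.
  rewrite (Nat.even_succ (2 * S n)), <- Nat.negb_even, Nat.even_mul.
  rewrite Nat.div2_double, Nat.div2_succ_double. simpl; lra.
Qed.

Lemma sum_f_R0_incr (f : nat -> R) (n m : nat) :
  (forall k, 0 <= f k) -> (n <= m)%nat -> sum_f_R0 f n <= sum_f_R0 f m.
Proof.
  intros Hf H; induction H; [lra|]. rewrite tech5; specialize (Hf (S m)); lra.
Qed.

Lemma null_set_union (Z1 Z2 : R -> Prop) :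
  null_set Z1 -> null_set Z2 -> null_set (fun z => Z1 z \/ Z2 z).
Proof.
  intros H1 H2 eps He.
  destruct (H1 (eps / 2)) as (a1 & b1 & L1 & S1 & C1); [lra|].
  destruct (H2 (eps / 2)) as (a2 & b2 & L2 & S2 & C2); [lra|].
  exists (fun k => if Nat.even k then a1 (Nat.div2 k) else a2 (Nat.div2 k)),
         (fun k => if Nat.even k then b1 (Nat.div2 k) else b2 (Nat.div2 k)).
  split; [|split].
  - intro n; destruct (Nat.even n); auto.
  - intro n. eapply Rle_lt_trans; [apply sum_f_R0_incr with (m := S (2 * n))|].
    + intro k; destruct (Nat.even k); [specialize (L1 (Nat.div2 k))|specialize (L2 (Nat.div2 k))]; lra.
    + lia.
    + rewrite (sum_eq _ (fun k => if Nat.even k then (b1 (Nat.div2 k) - a1 (Nat.div2 k))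
         else (b2 (Nat.div2 k) - a2 (Nat.div2 k)))).
      * rewrite (sum_interleave (fun k => b1 k - a1 k) (fun k => b2 k - a2 k)).
        specialize (S1 n); specialize (S2 n); lra.
      * intros i _; destruct (Nat.even i); lra.
  - intros z [Hz|Hz].
    + destruct (C1 z Hz) as [n Hn]; exists (2 * n)%nat.
      rewrite Nat.even_mul, Nat.div2_double; auto.
    + destruct (C2 z Hz) as [n Hn]; exists (S (2 * n))%nat.
      rewrite Nat.even_succ, <- Nat.negb_even, Nat.even_mul, Nat.div2_succ_double; auto.
Qed.

Lemma ae_on_impl (s t : R) (P Q : R -> Prop) :
  (forall x, s <= x <= t -> P x -> Q x) -> ae_on s t P -> ae_on s t Q.
Proof. intros H (Z & N & HZ); exists Z; split; auto. Qed.

Lemma ae_on_neq (s t x : R) : ae_on s t (fun y => y <> x).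
Proof.
  exists (fun z => z = x); split; [|tauto].
  apply null_set_range with (fun _ => x); intros z ->; now exists O.
Qed.

(** Widening the n-th interval by a total of eps/4 times 2^-n puts every point of Z in the interior
    of an interval, as a gauge around that point requires. *)
Lemma null_set_open_cover (Z : R -> Prop) (eps : R) :
  null_set Z -> 0 < eps -> exists a b : nat -> R,
    (forall n, a n <= b n) /\
    (forall n, sum_f_R0 (fun k => b k - a k) n < eps) /\
    (forall z, Z z -> exists n, a n < z < b n).
Proof.
  intros H He; destruct (H (eps / 2)) as (a & b & H1 & H2 & H3); [lra|].
  assert (Hp : forall n, 0 < (1 / 2) ^ n) by (intro; apply pow_lt; lra).
  exists (fun n => a n - eps / 8 * (1 / 2) ^ n), (fun n => b n + eps / 8 * (1 / 2) ^ n).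
  split; [intro n; specialize (Hp n); specialize (H1 n); nra|split].
  - intro n. rewrite (sum_eq _ (fun k => (b k - a k) + eps / 4 * (1 / 2) ^ k)); [|intros; lra].
    rewrite sum_plus.
    pose proof (sum_f_R0_geom_lt (eps / 4) n ltac:(lra)). specialize (H2 n); lra.
  - intros z Hz; destruct (H3 z Hz) as [n Hn]; exists n. specialize (Hp n); nra.
Qed.

(** For a <= b, its increment over [x, y] is the length of the part of [x, y] inside [a, b]; sums of
    clamps thus stand in for the measure of a cover. *)
Definition clamp (a b x : R) : R := Rmin (Rmax x a) b.

Lemma clamp_incr (a b x y : R) : a <= b -> x <= y ->
  0 <= clamp a b y - clamp a b x <= b - a.
Proof.
  intros Hab H; unfold clamp, Rmin, Rmax.
  destruct (Rle_dec x a), (Rle_dec y a); repeat destruct (Rle_dec _ b); lra.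
Qed.

Lemma clamp_id (a b x : R) : a < x < b -> clamp a b x = x.
Proof. intros H; unfold clamp, Rmin, Rmax; destruct (Rle_dec x a), (Rle_dec _ b); lra. Qed.

Lemma sum_f_R0_term_le (f : nat -> R) (k n : nat) :
  (forall j, 0 <= f j) -> (k <= n)%nat -> f k <= sum_f_R0 f n.
Proof.
  intros Hf H; induction H.
  - destruct k; simpl; [lra|]. pose proof (cond_pos_sum f k Hf); lra.
  - rewrite tech5; specialize (Hf (S m)); lra.
Qed.

(* The increments of Psi n dominate (m + 1) times the length on intervals around
   the points of [Z] carrying the index [m], while the total increment stays below
   theta: this is what lets a gauge neglect [Z] even where the integrand is unbounded. *)
Lemma null_set_majorant (Z : R -> Prop) (theta : R) :
  null_set Z -> 0 < theta -> exists (Psi : nat -> R -> R) (I : nat -> R -> nat) (d : nat -> R -> R),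
    (forall n x y, x <= y -> 0 <= Psi n y - Psi n x <= theta) /\
    (forall m z, 0 < d m z) /\
    (forall m z n a c, Z z -> (m <= n)%nat -> (I m z <= n)%nat ->
       z - d m z < a -> a <= z -> z <= c -> c < z + d m z ->
       (INR m + 1) * (c - a) <= Psi n c - Psi n a).
Proof.
  intros HZ Ht.
  (* The m-th cover is counted with weight m + 1, and (m + 1) times [eta m] sums to less than
     theta. *)
  set (eta := fun m => theta / 2 * (1 / 2) ^ m / (INR m + 1)).
  assert (Heta : forall m, 0 < eta m).
  { intro m; unfold eta; apply Rdiv_lt_0_compat.
    - assert (0 < (1 / 2) ^ m) by (apply pow_lt; lra). nra.
    - pose proof (pos_INR m); lra. }
  assert (Hc : forall m, exists p : (nat -> R) * (nat -> R),
     (forall n, fst p n <= snd p n) /\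
     (forall n, sum_f_R0 (fun k => snd p k - fst p k) n < eta m) /\
     (forall z, Z z -> exists n, fst p n < z < snd p n)).
  { intro m; destruct (null_set_open_cover Z (eta m) HZ (Heta m)) as (a & b & H).
    exists (a, b); exact H. }
  destruct (choice _ Hc) as [P HP].
  assert (Hi : forall m, exists J : R -> nat * R, forall z, 0 < snd (J z) /\ (Z z ->
     fst (P m) (fst (J z)) <= z - snd (J z) /\ z + snd (J z) <= snd (P m) (fst (J z)))).
  { intro m. apply (choice (fun z p => 0 < snd p /\ (Z z ->
     fst (P m) (fst p) <= z - snd p /\ z + snd p <= snd (P m) (fst p)))).
    intro z; destruct (classic (Z z)) as [Hz|Hz].
    - destruct (HP m) as (_ & _ & H); destruct (H z Hz) as [n Hn].
      exists (n, Rmin (z - fst (P m) n) (snd (P m) n - z)); simpl.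
      Rmin_bounds.
      split; [apply Rmin_glb_lt; lra|]. intros _; lra.
    - exists (O, 1); simpl; split; [lra|tauto]. }
  destruct (choice _ Hi) as [J HJ].
  set (cl := fun m k x => clamp (fst (P m) k) (snd (P m) k) x).
  (* Truncating at n replaces an infinite double series. One division involves finitely many
     indices, so n can be chosen after it. *)
  exists (fun n x => sum_f_R0 (fun m => (INR m + 1) * sum_f_R0 (fun k => cl m k x) n) n),
    (fun m z => fst (J m z)), (fun m z => snd (J m z)).
  assert (Hdiff : forall n x y,
     sum_f_R0 (fun m => (INR m + 1) * sum_f_R0 (fun k => cl m k y) n) n -
     sum_f_R0 (fun m => (INR m + 1) * sum_f_R0 (fun k => cl m k x) n) n =
     sum_f_R0 (fun m => (INR m + 1) * sum_f_R0 (fun k => cl m k y - cl m k x) n) n).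
  { intros n x y; rewrite <- minus_sum; apply sum_eq; intros m _. rewrite minus_sum; ring. }
  assert (Hcl : forall m k x y, x <= y -> 0 <= cl m k y - cl m k x <= snd (P m) k - fst (P m) k).
  { intros; apply clamp_incr; auto; apply HP. }
  assert (Hin : forall m n x y, x <= y -> 0 <= sum_f_R0 (fun k => cl m k y - cl m k x) n <= eta m).
  { intros m n x y Hxy; split; [apply cond_pos_sum; intro; apply Hcl; auto|].
    destruct (HP m) as (_ & H & _). specialize (H n). apply Rlt_le; eapply Rle_lt_trans; [|apply H].
    apply sum_Rle; intros; apply Hcl; auto. }
  split; [|split].
  - intros n x y Hxy; rewrite Hdiff; split.
    + apply cond_pos_sum; intro m. pose proof (Hin m n x y Hxy); pose proof (pos_INR m).
      apply Rmult_le_pos; lra.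
    + apply Rle_trans with (sum_f_R0 (fun m => theta / 2 * (1 / 2) ^ m) n).
      * apply sum_Rle; intros m _. pose proof (Hin m n x y Hxy) as [_ H]. pose proof (pos_INR m).
        replace (theta / 2 * (1 / 2) ^ m) with ((INR m + 1) * eta m)
          by (unfold eta; field; lra).
        apply Rmult_le_compat_l; lra.
      * pose proof (sum_f_R0_geom_lt (theta / 2) n ltac:(lra)); lra.
  - intros m z; apply HJ.
  - intros m z n a c Hz Hm Hk H1 H2 H3 H4. rewrite Hdiff.
    destruct (HJ m z) as [_ HH]; destruct (HH Hz) as [H5 H6]; clear HH.
    assert (Hac : a <= c) by lra.
    apply Rle_trans with ((INR m + 1) * sum_f_R0 (fun k => cl m k c - cl m k a) n).
    + pose proof (pos_INR m); apply Rmult_le_compat_l; [lra|].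
      replace (c - a) with (cl m (fst (J m z)) c - cl m (fst (J m z)) a).
      * apply (sum_f_R0_term_le (fun k => cl m k c - cl m k a)); auto. intro; apply Hcl; auto.
      * unfold cl; rewrite !clamp_id; lra.
    + apply (sum_f_R0_term_le (fun m => (INR m + 1) * sum_f_R0 (fun k => cl m k c - cl m k a) n)); auto.
      intro j; pose proof (pos_INR j). apply Rmult_le_pos; [lra|]. apply Hin; auto.
Qed.

Lemma nonoverlapping_weaken (l : list (R * R)) (s s' t : R) :
  s' <= s -> nonoverlapping s t l -> nonoverlapping s' t l.
Proof. destruct l as [|[a b] l]; simpl; intros; intuition lra. Qed.

Lemma list_nat_bound (A : Type) (h : A -> nat) (l : list A) :
  exists n, forall x, In x l -> (h x <= n)%nat.
Proof.
  induction l as [|x l [n Hn]]; [exists O; simpl; tauto|].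
  exists (Nat.max (h x) n); intros y [<-|Hy]; [lia|]. specialize (Hn y Hy); lia.
Qed.

(** Upper half of the straddle estimate. It follows from F'(xi) = f xi, but applies to the value
    function along a curve, where only increments are bounded from above. *)
Definition straddle_le (F f : R -> R) (s t xi : R) : Prop :=
  forall eps, 0 < eps -> exists d, 0 < d /\ forall a c,
    s <= a -> a <= xi -> xi <= c -> c <= t -> xi - d < a -> c < xi + d ->
    F c - F a <= (f xi + eps) * (c - a).

(** At good tags the straddle estimate applies. Pieces tagged in the null set have small total
    length, so absolute continuity controls the increments of F there, while the majorant [Psi]
    absorbs the terms f xi (c - a), however large f xi is. *)
Lemma straddle_rsum (F f : R -> R) (s t : R) (eps : R) :
  s <= t -> abs_cont F s t -> ae_on s t (straddle_le F f s t) -> 0 < eps ->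
  exists delta : R -> R, (forall x, 0 < delta x) /\
    forall l, tagged_div s t l -> fine delta s l -> F t - F s <= rsum f s l + eps.
Proof.
  intros Hst HF (Z & HZ & Hgood) He.
  destruct (HF (eps / 4)) as (d0 & Hd0 & Hac); [lra|].
  (* Below d0 for the absolute continuity of F, below eps/4 for the Riemann terms on the null set;
     [e1] spends a further eps/4 at the good tags. *)
  set (theta := Rmin d0 (eps / 4) / 2).
  assert (Hth : 0 < theta /\ theta < d0 /\ theta < eps / 4).
  { unfold theta, Rmin; destruct (Rle_dec d0 (eps / 4)); lra. }
  destruct (null_set_majorant Z theta HZ ltac:(lra)) as (Psi & I & d & HPsi & Hd & Hdom).
  assert (Hm : forall z, exists m, Rabs (f z) <= INR m).
  { intro z; destruct (INR_unbounded (Rabs (f z))) as [m Hm]; exists m; lra. }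
  destruct (choice _ Hm) as [M HM].
  set (e1 := eps / (4 * (t - s + 1))).
  assert (He1 : 0 < e1) by (apply Rdiv_lt_0_compat; lra).
  assert (Hdel : forall x, exists r, 0 < r /\ (Z x -> r = d (M x) x) /\
    (~ Z x -> s <= x <= t -> forall a c, s <= a -> a <= x -> x <= c -> c <= t ->
       x - r < a -> c < x + r -> F c - F a <= (f x + e1) * (c - a))).
  { intro x; destruct (classic (Z x)) as [Hz|Hz].
    - exists (d (M x) x); split; [apply Hd|tauto].
    - destruct (classic (s <= x <= t)) as [Hx|Hx].
      + destruct (Hgood x Hx Hz e1 He1) as (r & Hr & Hr'); exists r; repeat split; auto; tauto.
      + exists 1; split; [lra|tauto]. }
  destruct (choice _ Hdel) as [delta Hdelta].
  exists delta; split; [intro; apply Hdelta|].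
  intros l Hl Hf.
  destruct (list_nat_bound _ (fun p : R * R => Nat.max (M (fst p)) (I (M (fst p)) (fst p))) l) as [n Hn].
  (* [bl] collects the pieces whose tag lies in the null set. *)
  assert (Hgen : forall l a, s <= a -> tagged_div a t l -> fine delta a l ->
     (forall p, In p l -> (Nat.max (M (fst p)) (I (M (fst p)) (fst p)) <= n)%nat) ->
     exists bl, nonoverlapping a t bl /\ sum_len bl <= Psi n t - Psi n a /\
       F t - F a <= rsum f a l + e1 * (t - a) + (Psi n t - Psi n a) + sum_var F bl).
  { clear l Hl Hf Hn. induction l as [|[xi c] l IH]; simpl; intros a Ha Hl Hf Hn.
    - subst; exists nil; simpl; repeat split; lra.
    - destruct Hl as (H1 & H2 & H3), Hf as (H4 & H5 & H6).
      pose proof (tagged_div_le _ _ _ H3) as Hct.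
      destruct (IH c ltac:(lra) H3 H6) as (bl & B1 & B2 & B3); [intros; apply Hn; auto|].
      pose proof (Hn (xi, c) (or_introl eq_refl)) as Hnx; simpl in Hnx.
      destruct (Hdelta xi) as (Hp & HZx & HnZ).
      destruct (classic (Z xi)) as [Hz|Hz].
      + exists ((a, c) :: bl); simpl.
        rewrite (HZx Hz) in H4, H5.
        pose proof (Hdom (M xi) xi n a c Hz ltac:(lia) ltac:(lia) H4 (proj1 H2) (proj2 H2) H5) as Hdd.
        pose proof (pos_INR (M xi)).
        assert (c - a <= Psi n c - Psi n a) by nra.
        assert (- (f xi * (c - a)) <= Psi n c - Psi n a).
        { pose proof (HM xi). pose proof (Rabs_ge_opp (f xi)). nra. }
        assert (0 <= e1 * (c - a)) by nra.
        pose proof (Rle_abs (F c - F a)).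
        repeat split; try lra. exact B1.
      + exists bl.
        assert (F c - F a <= (f xi + e1) * (c - a)) by (apply HnZ; auto; lra).
        pose proof (HPsi n a c ltac:(lra)).
        split; [eapply nonoverlapping_weaken; [|eauto]; lra|split; lra]. }
  destruct (Hgen l s ltac:(lra) Hl Hf Hn) as (bl & B1 & B2 & B3).
  pose proof (HPsi n s t Hst).
  assert (sum_var F bl < eps / 4) by (apply Hac; auto; lra).
  assert (e1 * (t - s) <= eps / 4).
  { assert (e1 * (t - s + 1) = eps / 4) by (unfold e1; field; lra). nra. }
  lra.
Qed.

Lemma fine_Rmin (d1 d2 : R -> R) (l : list (R * R)) : forall a,
  fine (fun x => Rmin (d1 x) (d2 x)) a l -> fine d1 a l /\ fine d2 a l.
Proof.
  induction l as [|[xi c] l IH]; simpl; intros a H; auto.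
  destruct H as (H1 & H2 & H3); apply IH in H3.
  Rmin_bounds.
  repeat split; try tauto; lra.
Qed.

Lemma HK_lower_bound (F f : R -> R) (s t I : R) :
  s <= t -> abs_cont F s t -> ae_on s t (straddle_le F f s t) -> HK_integral f s t I ->
  F t - F s <= I.
Proof.
  intros Hst HF Hae HI. apply Rnot_lt_le; intro Hlt.
  set (eps := (F t - F s - I) / 2).
  destruct (straddle_rsum F f s t eps Hst HF Hae ltac:(unfold eps; lra)) as (d1 & Hd1 & H1).
  destruct (HI eps ltac:(unfold eps; lra)) as (d2 & Hd2 & H2).
  destruct (cousin (fun x => Rmin (d1 x) (d2 x)) s t Hst) as (l & Hl & Hf).
  { intro; apply Rmin_glb_lt; auto. }
  apply fine_Rmin in Hf. specialize (H1 l Hl (proj1 Hf)); specialize (H2 l Hl (proj2 Hf)).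
  apply Rabs_def2 in H2. unfold eps in *; lra.
Qed.

Lemma abs_cont_opp (F : R -> R) (s t : R) : abs_cont F s t -> abs_cont (fun x => - F x) s t.
Proof.
  intros H eps He; destruct (H eps He) as (d & Hd & Hd'); exists d; split; auto.
  intros l Hl Hs. replace (sum_var (fun x => - F x) l) with (sum_var F l); auto.
  clear; induction l as [|[a b] l IH]; simpl; auto. rewrite IH.
  replace (- F b - - F a) with (- (F b - F a)) by ring. now rewrite Rabs_Ropp.
Qed.

Lemma rsum_opp (f : R -> R) (l : list (R * R)) : forall a, rsum (fun x => - f x) a l = - rsum f a l.
Proof. induction l as [|[xi c] l IH]; simpl; intros; [lra|rewrite IH; lra]. Qed.

Lemma derivable_straddle (F : R -> R) (x v : R) : derivable_pt_lim F x v ->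
  forall eps, 0 < eps -> exists d, 0 < d /\ forall a c, a <= x -> x <= c -> x - d < a -> c < x + d ->
    Rabs (F c - F a - v * (c - a)) <= eps * (c - a).
Proof.
  intros H eps He; destruct (H eps He) as [d Hd]; exists d; split; [apply cond_pos|].
  assert (Hone : forall y, Rabs (y - x) < d -> Rabs (F y - F x - v * (y - x)) <= eps * Rabs (y - x)).
  { intros y Hy; destruct (Req_dec y x) as [->|Hne].
    - rewrite !Rminus_diag, Rmult_0_r, Rminus_diag, !Rabs_R0; lra.
    - specialize (Hd (y - x) ltac:(lra) Hy). replace (x + (y - x)) with y in Hd by ring.
      replace (F y - F x - v * (y - x)) with (((F y - F x) / (y - x) - v) * (y - x)) by (field; lra).
      rewrite Rabs_mult. apply Rmult_le_compat_r; [apply Rabs_pos|lra]. }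
  intros a c H1 H2 H3 H4.
  pose proof (Hone a ltac:(apply Rabs_def1; lra)) as Ha.
  pose proof (Hone c ltac:(apply Rabs_def1; lra)) as Hc.
  rewrite (Rabs_left1 (a - x)) in Ha by lra. rewrite (Rabs_pos_eq (c - x)) in Hc by lra.
  replace (F c - F a - v * (c - a)) with ((F c - F x - v * (c - x)) - (F a - F x - v * (a - x))) by ring.
  eapply Rle_trans; [apply Rabs_minus_le|].
  eapply Rle_trans; [apply Rplus_le_compat; eassumption|]. lra.
Qed.

(** The straddle estimate for F bounds the Riemann sums from below, the one for -F from above. *)
Lemma HK_of_derivative (F f : R -> R) (s t : R) :
  s <= t -> abs_cont F s t -> ae_on s t (fun x => derivable_pt_lim F x (f x)) ->
  HK_integral f s t (F t - F s).
Proof.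
  intros Hst HF Hae eps He.
  destruct (straddle_rsum F f s t (eps / 2) Hst HF) as (d1 & Hd1 & H1); [|lra|].
  { revert Hae; apply ae_on_impl; intros x Hx H e He'.
    destruct (derivable_straddle F x (f x) H e He') as (d & Hd & Hd').
    exists d; split; auto; intros. specialize (Hd' a c H1 H2 H4 H5).
    apply Rabs_le_both in Hd'; lra. }
  destruct (straddle_rsum (fun x => - F x) (fun x => - f x) s t (eps / 2) Hst) as (d2 & Hd2 & H2).
  { now apply abs_cont_opp. }
  { revert Hae; apply ae_on_impl; intros x Hx H e He'.
    destruct (derivable_straddle F x (f x) H e He') as (d & Hd & Hd').
    exists d; split; auto; intros. specialize (Hd' a c H2 H3 H5 H6).
    apply Rabs_le_both in Hd'; lra. }
  { lra. }
  exists (fun x => Rmin (d1 x) (d2 x)); split; [intro; apply Rmin_glb_lt; auto|].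
  intros l Hl Hf.
  apply fine_Rmin in Hf. specialize (H1 l Hl (proj1 Hf)); specialize (H2 l Hl (proj2 Hf)).
  rewrite rsum_opp in H2. apply Rabs_def1; lra.
Qed.

Lemma lipschitz_abs_cont (F : R -> R) (s t M : R) :
  (forall a b, s <= a -> a <= b -> b <= t -> Rabs (F b - F a) <= M * (b - a)) -> abs_cont F s t.
Proof.
  intros H eps He. set (M' := Rabs M + 1).
  assert (HM : 0 < M') by (unfold M'; pose proof (Rabs_pos M); lra).
  exists (eps / M'); split; [apply Rdiv_lt_0_compat; lra|].
  intros l Hl Hs.
  assert (Hgen : forall l a, s <= a -> nonoverlapping a t l ->
     a <= t /\ 0 <= sum_len l /\ sum_var F l <= M' * sum_len l).
  { clear Hl Hs l. induction l as [|[b c] l IH]; simpl; intros a Ha Hl; [lra|].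
    destruct Hl as (H1 & H2 & H3). destruct (IH c) as (I1 & I2 & I3); auto; [lra|].
    specialize (H b c ltac:(lra) H2 I1). pose proof (Rle_abs M).
    repeat split; try lra. unfold M' in *; nra. }
  destruct (Hgen l s ltac:(lra) Hl) as (_ & _ & H1).
  apply Rle_lt_trans with (1 := H1). apply Rmult_lt_compat_l with (r := M') in Hs; auto.
  replace (M' * (eps / M')) with eps in Hs by (field; lra). auto.
Qed.

(* A discrete subset of the half-line is countable. *)
Lemma null_set_isolated (S : R -> Prop) :
  null_set (fun z => 0 <= z /\ S z /\ exists d, 0 < d /\ forall y, S y -> Rabs (y - z) < d -> y = z).
Proof.
  (* A pair (n, k) names an isolation radius 1/(n+1) and the cell of that width starting at k/(n+1).
     A cell holds at most one point with that radius, so choosing a point in each cell enumerates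
     them all. *)
  set (Q := fun (p : nat * nat) z => 0 <= z /\ S z /\
    (forall y, S y -> Rabs (y - z) < / (INR (fst p) + 1) -> y = z) /\
    INR (snd p) * / (INR (fst p) + 1) <= z < (INR (snd p) + 1) * / (INR (fst p) + 1)).
  apply null_set_range with (fun n => epsilon (inhabits 0) (Q (of_nat n))).
  intros z (Hz & HS & d & Hd & Hiso).
  destruct (archimed_cor1 d Hd) as (n & Hn & Hn').
  set (w := / (INR n + 1)).
  assert (Hn0 : 0 < INR n) by (apply lt_0_INR; auto).
  assert (Hw : 0 < w) by (apply Rinv_0_lt_compat; lra).
  assert (Hwd : w <= d).
  { apply Rle_trans with (/ INR n); [|lra]. apply Rinv_le_contravar; lra. }
  assert (exists k, INR k * w <= z < (INR k + 1) * w) as [k Hk].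
  { assert (Hzw : 0 <= z / w) by (apply Rmult_le_pos; [lra|apply Rlt_le, Rinv_0_lt_compat; lra]).
    destruct (archimed (z / w)) as [A1 A2].
    assert (Hup : (0 < up (z / w))%Z).
    { apply lt_IZR. simpl; lra. }
    exists (Z.to_nat (up (z / w) - 1)).
    rewrite INR_IZR_INZ, Z2Nat.id by lia. rewrite minus_IZR.
    assert (z = z / w * w) by (field; lra).
    split; [|]; nra. }
  exists (to_nat (n, k)). rewrite cancel_of_to.
  assert (HQ : Q (n, k) z).
  { repeat split; simpl; fold w; try tauto. intros y Hy Hyz; apply Hiso; auto; lra. }
  assert (HQ' := epsilon_spec (inhabits 0) (Q (n, k)) (ex_intro _ z HQ)).
  set (z' := epsilon (inhabits 0) (Q (n, k))) in *.
  destruct HQ' as (_ & HS' & _ & Hk'). simpl in Hk'; fold w in Hk'.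
  symmetry. destruct HQ as (_ & _ & H & _). simpl in H; fold w in H. apply H; auto.
  apply Rabs_def1; lra.
Qed.

(** * Geometry of the junction *)

Definition ip (x y : pt) : R := fst x * fst y + snd x * snd y.

Lemma enorm_nonneg (x : pt) : 0 <= enorm x.
Proof. apply sqrt_pos. Qed.

Lemma scal_zero (v : pt) : scal 0 v = origin.
Proof. unfold scal, origin; f_equal; ring. Qed.

Lemma ip_scal_l (r : R) (x y : pt) : ip (scal r x) y = r * ip x y.
Proof. unfold ip, scal; simpl; ring. Qed.

Lemma edist_le_l1 (x y : pt) :
  edist x y <= Rabs (fst x - fst y) + Rabs (snd x - snd y).
Proof.
  unfold edist, enorm; simpl.
  set (a := fst x - fst y); set (b := snd x - snd y).
  pose proof (Rabs_pos a); pose proof (Rabs_pos b).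
  rewrite <- (sqrt_Rsqr (Rabs a + Rabs b)) by lra. apply sqrt_le_1_alt.
  unfold Rsqr. pose proof (Rsqr_abs a); pose proof (Rsqr_abs b); unfold Rsqr in *. nra.
Qed.

Section Junction.
Context (N : nat) (e : nat -> pt) (HJ : junction N e).

Lemma ip_unit (i : nat) : (i < N)%nat -> ip (e i) (e i) = 1.
Proof.
  intro Hi; destruct HJ as (_ & H & _); specialize (H i Hi). unfold enorm in H.
  fold (ip (e i) (e i)) in H.
  assert (0 <= ip (e i) (e i)) by (unfold ip; nra).
  rewrite <- (sqrt_sqrt (ip (e i) (e i))) by auto. rewrite H; ring.
Qed.

Lemma ip_lt_1 (i j : nat) : (i < N)%nat -> (j < N)%nat -> i <> j -> -1 <= ip (e i) (e j) < 1.
Proof.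
  intros Hi Hj Hij. pose proof (ip_unit i Hi) as H1; pose proof (ip_unit j Hj) as H2.
  destruct HJ as (_ & _ & Hinj). specialize (Hinj i j Hi Hj).
  unfold ip in *. destruct (e i) as [a b], (e j) as [c d]; simpl in *.
  split; [pose proof (Rle_0_sqr (a + c)); pose proof (Rle_0_sqr (b + d)); unfold Rsqr in *; lra|]. apply Rnot_le_lt; intro Hge. apply Hij, Hinj.
  assert ((a - c) * (a - c) + (b - d) * (b - d) <= 0) by nra.
  pose proof (Rle_0_sqr (a - c)); pose proof (Rle_0_sqr (b - d)); unfold Rsqr in *.
  f_equal; apply Rminus_diag_uniq, Rsqr_0_uniq; unfold Rsqr; lra.
Qed.

Lemma enorm_scal (i : nat) (r : R) : (i < N)%nat -> 0 <= r -> enorm (scal r (e i)) = r.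
Proof.
  intros Hi Hr; unfold enorm. fold (ip (scal r (e i)) (scal r (e i))).
  replace (ip _ _) with (r * r * ip (e i) (e i)) by (unfold ip, scal; simpl; ring).
  rewrite ip_unit by auto. rewrite Rmult_1_r. now apply sqrt_square.
Qed.

Lemma inJ_scal (i : nat) (r : R) : (i < N)%nat -> 0 <= r -> inJ N e (scal r (e i)).
Proof. intros; exists i; split; auto; exists r; auto. Qed.

Lemma branch0 : (0 < N)%nat.
Proof. destruct HJ; lia. Qed.

Lemma inJ_origin : inJ N e origin.
Proof. rewrite <- (scal_zero (e O)). apply inJ_scal; [apply branch0|lra]. Qed.

Lemma scal_inj (i j : nat) (r s : R) : (i < N)%nat -> (j < N)%nat -> 0 < r -> 0 <= s ->
  scal r (e i) = scal s (e j) -> i = j /\ r = s.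
Proof.
  intros Hi Hj Hr Hs E.
  assert (r = s) as <-.
  { rewrite <- (enorm_scal i r), <- (enorm_scal j s) by (auto; lra). now rewrite E. }
  split; auto. destruct HJ as (_ & _ & H); apply H; auto.
  unfold scal in E; injection E as E1 E2. destruct (e i), (e j); simpl in *.
  f_equal; nra.
Qed.

Lemma edist_scal_same (i : nat) (r s : R) : (i < N)%nat ->
  edist (scal r (e i)) (scal s (e i)) = Rabs (r - s).
Proof.
  intro Hi; unfold edist, enorm; simpl.
  replace (_ + _) with ((r - s) * (r - s) * ip (e i) (e i)) by (unfold ip; ring).
  rewrite ip_unit, Rmult_1_r by auto. apply sqrt_Rsqr_abs.
Qed.

(** With c = [ip (e i) (e j)], the squares of the two sides differ by (1 + c)/2 times (r - s)^2, and
    c >= -1. *)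
Lemma edist_scal_diff (i j : nat) (r s : R) : (i < N)%nat -> (j < N)%nat -> i <> j ->
  0 <= r -> 0 <= s ->
  sqrt ((1 - ip (e i) (e j)) / 2) * (r + s) <= edist (scal r (e i)) (scal s (e j)).
Proof.
  intros Hi Hj Hij Hr Hs. pose proof (ip_lt_1 i j Hi Hj Hij) as Hc.
  unfold edist, enorm; simpl.
  match goal with |- _ <= sqrt ?X => replace X with
    (r * r * ip (e i) (e i) + s * s * ip (e j) (e j) - 2 * r * s * ip (e i) (e j))
    by (unfold ip; ring) end.
  rewrite !ip_unit by auto. set (c := ip (e i) (e j)) in *.
  rewrite <- (sqrt_Rsqr (r + s)) by lra. rewrite <- sqrt_mult_alt by lra.
  apply sqrt_le_1_alt. unfold Rsqr.
  assert (0 <= (1 + c) / 2 * ((r - s) * (r - s))) by (apply Rmult_le_pos; [lra|apply Rle_0_sqr]). lra.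
Qed.

Lemma dJ_spec (x y : pt) :
  ((exists i, (i < N)%nat /\ inJi e i x /\ inJi e i y) /\ dJ N e x y = edist x y) \/
  (~ (exists i, (i < N)%nat /\ inJi e i x /\ inJi e i y) /\ dJ N e x y = enorm x + enorm y).
Proof.
  unfold dJ. apply epsilon_spec.
  destruct (classic (exists i, (i < N)%nat /\ inJi e i x /\ inJi e i y)); eauto.
Qed.

Lemma dJ_same (i : nat) (r s : R) : (i < N)%nat -> 0 <= r -> 0 <= s ->
  dJ N e (scal r (e i)) (scal s (e i)) = Rabs (r - s).
Proof.
  intros Hi Hr Hs. destruct (dJ_spec (scal r (e i)) (scal s (e i))) as [[_ ->]|[H _]].
  - now apply edist_scal_same.
  - exfalso; apply H; exists i; repeat split; auto; eexists; eauto.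
Qed.

Lemma edist_origin_r (x : pt) : edist x origin = enorm x.
Proof. unfold edist, origin; simpl. now rewrite !Rminus_0_r; destruct x. Qed.

Lemma edist_origin_l (x : pt) : edist origin x = enorm x.
Proof. unfold edist, enorm, origin; simpl. f_equal; ring. Qed.

(** If one of the points is the vertex, the two share a branch although i and j differ; the
    Euclidean distance then gives the same sum. *)
Lemma dJ_diff (i j : nat) (r s : R) : (i < N)%nat -> (j < N)%nat -> i <> j ->
  0 <= r -> 0 <= s -> dJ N e (scal r (e i)) (scal s (e j)) = r + s.
Proof.
  intros Hi Hj Hij Hr Hs.
  destruct (dJ_spec (scal r (e i)) (scal s (e j))) as [[(k & Hk & (a & Ha & Ea) & (b & Hb & Eb)) ->]|[_ ->]].
  - destruct (Req_dec r 0) as [->|Hr0].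
    { rewrite scal_zero, edist_origin_l, enorm_scal; auto; ring. }
    destruct (Req_dec s 0) as [->|Hs0].
    { rewrite scal_zero, edist_origin_r, enorm_scal; auto; ring. }
    exfalso. apply scal_inj in Ea; auto; [|lra]. apply scal_inj in Eb; auto; [|lra].
    destruct Ea as [-> _], Eb as [-> _]; auto.
  - rewrite !enorm_scal; auto.
Qed.

Lemma dJ_nonneg (x y : pt) : 0 <= dJ N e x y.
Proof.
  destruct (dJ_spec x y) as [[_ ->]|[_ ->]]; [apply enorm_nonneg|].
  pose proof (enorm_nonneg x); pose proof (enorm_nonneg y); lra.
Qed.

Lemma inJ_elim (x : pt) : inJ N e x -> exists i r, (i < N)%nat /\ 0 <= r /\ x = scal r (e i).
Proof. intros (i & Hi & r & Hr & E); eauto. Qed.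

Lemma dJ_cases (x y : pt) : inJ N e x -> inJ N e y ->
  (exists i r s, (i < N)%nat /\ 0 <= r /\ 0 <= s /\ x = scal r (e i) /\ y = scal s (e i) /\ dJ N e x y = Rabs (r - s)) \/
  (exists i j r s, (i < N)%nat /\ (j < N)%nat /\ i <> j /\ 0 <= r /\ 0 <= s /\
     x = scal r (e i) /\ y = scal s (e j) /\ dJ N e x y = r + s).
Proof.
  intros Hx Hy; apply inJ_elim in Hx, Hy.
  destruct Hx as (i & r & Hi & Hr & ->), Hy as (j & s & Hj & Hs & ->).
  destruct (Nat.eq_dec i j) as [<-|Hij].
  - left; exists i, r, s; repeat split; auto. now apply dJ_same.
  - right; exists i, j, r, s; repeat split; auto. now apply dJ_diff.
Qed.

Lemma dJ_sym (x y : pt) : inJ N e x -> inJ N e y -> dJ N e x y = dJ N e y x.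
Proof.
  intros Hx Hy; destruct (dJ_cases x y Hx Hy) as
   [(i & r & s & Hi & Hr & Hs & -> & -> & ->)|(i & j & r & s & Hi & Hj & Hij & Hr & Hs & -> & -> & ->)].
  - rewrite dJ_same by auto. apply Rabs_minus_sym.
  - rewrite dJ_diff; auto. ring.
Qed.

Lemma dJ_refl (x : pt) : inJ N e x -> dJ N e x x = 0.
Proof.
  intro H; apply inJ_elim in H; destruct H as (i & r & Hi & Hr & ->).
  rewrite dJ_same, Rminus_diag by auto. apply Rabs_R0.
Qed.

Lemma dJ_origin (i : nat) (r : R) : (i < N)%nat -> 0 <= r -> dJ N e (scal r (e i)) origin = r.
Proof.
  intros Hi Hr; rewrite <- (scal_zero (e i)), dJ_same by (auto; lra).
  rewrite Rminus_0_r; now apply Rabs_pos_eq.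
Qed.

Lemma finite_pos_bound (P : nat -> R -> Prop) (n : nat) :
  (forall i, (i < n)%nat -> exists c, 0 < c /\ P i c) ->
  (forall i c c', 0 < c' -> c' <= c -> P i c -> P i c') ->
  exists c, 0 < c /\ forall i, (i < n)%nat -> P i c.
Proof.
  intros H Hm; induction n as [|n IH].
  - exists 1; split; [lra|]; intros; lia.
  - destruct IH as (c & Hc & Hc'); [auto|]. destruct (H n) as (d & Hd & Hd'); [lia|].
    exists (Rmin c d); assert (0 < Rmin c d) by now apply Rmin_glb_lt.
    split; auto. intros i Hi. destruct (Nat.eq_dec i n) as [->|Hne].
    + apply Hm with d; auto; apply Rmin_r.
    + apply Hm with c; auto; [apply Rmin_l|]. apply Hc'; lia.
Qed.

Lemma finite_upper_bound (P : nat -> R -> Prop) (n : nat) :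
  (forall i, (i < n)%nat -> exists c, P i c) ->
  (forall i c c', c <= c' -> P i c -> P i c') ->
  exists c, 0 < c /\ forall i, (i < n)%nat -> P i c.
Proof.
  intros H Hm; induction n as [|n IH].
  - exists 1; split; [lra|]; intros; lia.
  - destruct IH as (c & Hc & Hc'); [auto|]. destruct (H n) as (d & Hd); [lia|].
    exists (Rmax c d). pose proof (Rmax_l c d). split; [lra|]. intros i Hi.
    destruct (Nat.eq_dec i n) as [->|Hne].
    + apply Hm with d; auto; apply Rmax_r.
    + apply Hm with c; auto. apply Hc'; lia.
Qed.

(** Two branches meet at a positive angle, so chordal and geodesic distances are equivalent. This
    turns regularity of the coordinates of a curve in the plane into regularity for [dJ]. *)
Lemma dJ_le_edist : exists kappa, 0 < kappa /\ forall x y, inJ N e x -> inJ N e y ->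
  kappa * dJ N e x y <= edist x y.
Proof.
  destruct (finite_pos_bound (fun i c => c <= 1 /\ forall j, (j < N)%nat -> (i < N)%nat -> i <> j ->
     forall r s, 0 <= r -> 0 <= s -> c * (r + s) <= edist (scal r (e i)) (scal s (e j))) N)
    as (c & Hc & H).
  - intros i Hi.
    destruct (finite_pos_bound (fun j c => c <= 1 /\ ((j < N)%nat -> i <> j ->
     forall r s, 0 <= r -> 0 <= s -> c * (r + s) <= edist (scal r (e i)) (scal s (e j)))) N)
    as (c & Hc & H).
    + intros j Hj. destruct (Nat.eq_dec i j) as [<-|Hij].
      * exists 1; repeat split; try lra; tauto.
      * set (k := sqrt ((1 - ip (e i) (e j)) / 2)).
        assert (0 < k).
        { apply sqrt_lt_R0. pose proof (ip_lt_1 i j Hi Hj Hij); lra. }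
        exists (Rmin 1 k). Rmin_bounds.
        assert (0 < Rmin 1 k) by (apply Rmin_glb_lt; lra). repeat split; auto.
        intros _ _ r s Hr Hs. pose proof (edist_scal_diff i j r s Hi Hj Hij Hr Hs) as Hd.
        fold k in Hd. assert (Rmin 1 k * (r + s) <= k * (r + s)) by (apply Rmult_le_compat_r; lra). lra.
    + intros j c c' Hc' Hle (H1 & H2); split; [lra|]. intros Hj Hij r s Hr Hs.
      specialize (H2 Hj Hij r s Hr Hs). assert (c' * (r + s) <= c * (r + s)) by (apply Rmult_le_compat_r; lra). lra.
    + exists c; split; auto. split; [apply (H O branch0)|]. intros j Hj _ Hij. now apply H.
  - intros i c c' Hc' Hle (H1 & H2); split; [lra|]. intros j Hj Hi Hij r s Hr Hs.
    specialize (H2 j Hj Hi Hij r s Hr Hs). assert (c' * (r + s) <= c * (r + s)) by (apply Rmult_le_compat_r; lra). lra.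
  - exists c; split; auto. intros x y Hx Hy. destruct (dJ_cases x y Hx Hy) as
     [(i & r & s & Hi & Hr & Hs & -> & -> & ->)|(i & j & r & s & Hi & Hj & Hij & Hr & Hs & -> & -> & ->)].
    + rewrite edist_scal_same by auto. destruct (H i Hi) as [H1 _]. pose proof (Rabs_pos (r - s)). nra.
    + apply H; auto.
Qed.

End Junction.

(** * Lagrangians and Hamiltonians *)

Section Lagrangian.
Context (N : nat) (L : nat -> R -> R) (gamma : R) (HA1 : hypA1 N L gamma).

Lemma L_continuous (i : nat) (q : R) : (i < N)%nat -> continuity_pt (L i) q.
Proof.
  intro Hi; destruct HA1 as [_ H]; destruct (H i Hi) as (L1 & L2 & H1 & _).
  apply derivable_continuous_pt. exists (L1 q); apply H1.
Qed.

(** d is L_i'(0). The difference of the two sides vanishes at 0 and, since L_i'' >= gamma, its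
    derivative has the sign of q. *)
Lemma L_quadratic_lower_bound (i : nat) : (i < N)%nat -> exists d, forall q,
  L i 0 + d * q + gamma / 2 * (q * q) <= L i q.
Proof.
  intro Hi; destruct HA1 as [Hg H]; destruct (H i Hi) as (L1 & L2 & H1 & H2 & _ & H3).
  exists (L1 0); intro q.
  assert (HL1 : forall a b, a < b -> gamma * (b - a) <= L1 b - L1 a).
  { intros a b Hab. destruct (MVT_cor2 L1 L2 a b Hab) as (c & Hc & _).
    - intros; apply H2.
    - rewrite Hc. specialize (H3 c). apply Rmult_le_compat_r; lra. }
  set (g := fun q => L i q - (L i 0 + L1 0 * q + gamma / 2 * (q * q))).
  set (g' := fun q => L1 q - (L1 0 + gamma * q)).
  assert (Hd : forall c, derivable_pt_lim g c (g' c)).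
  { intro c; unfold g, g'. apply derivable_pt_lim_minus; [apply H1|].
    replace (L1 0 + gamma * c) with (0 + L1 0 * 1 + gamma / 2 * (1 * c + c * 1)) by field.
    apply derivable_pt_lim_plus; [apply derivable_pt_lim_plus|].
    - apply derivable_pt_lim_const.
    - apply derivable_pt_lim_scal, derivable_pt_lim_id.
    - apply (derivable_pt_lim_scal (fun q => q * q)).
      apply (derivable_pt_lim_mult id id); apply derivable_pt_lim_id. }
  assert (Hg0 : g 0 = 0) by (unfold g; ring).
  assert (0 <= g q); [|unfold g in *; lra].
  destruct (Rtotal_order q 0) as [Hq|[->|Hq]]; [| lra |].
  - destruct (MVT_cor2 g g' q 0 Hq) as (c & Hc & Hc'); [intros; apply Hd|].
    specialize (HL1 c 0 ltac:(lra)).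
    assert (g' c <= 0) by (unfold g'; lra). clearbody g g'. nra.
  - destruct (MVT_cor2 g g' 0 q Hq) as (c & Hc & Hc'); [intros; apply Hd|].
    specialize (HL1 0 c ltac:(lra)).
    assert (0 <= g' c) by (unfold g'; lra). clearbody g g'. nra.
Qed.

Lemma L_tangent_at_0 (i : nat) : (i < N)%nat -> exists d, forall q, L i 0 + d * q <= L i q.
Proof.
  intro Hi; destruct (L_quadratic_lower_bound i Hi) as [d Hd]; exists d; intro q.
  specialize (Hd q). destruct HA1 as [Hg _]. nra.
Qed.

(** Completing the square: gamma/2 z^2 - k z >= - k^2/(2 gamma), with k = |K| + |d| and z = |q|. *)
Lemma L_superlinear (K : R) : exists C, 0 < C /\ forall i, (i < N)%nat -> forall q,
  K * Rabs q - C <= L i q.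
Proof.
  apply (finite_upper_bound (fun i C => forall q, K * Rabs q - C <= L i q)).
  - intros i Hi; destruct (L_quadratic_lower_bound i Hi) as [d Hd].
    destruct HA1 as [Hg _].
    set (k := Rabs K + Rabs d).
    exists (k * k / (2 * gamma) - L i 0); intro q. specialize (Hd q).
    assert (- (Rabs d * Rabs q) <= d * q).
    { rewrite <- Rabs_mult. pose proof (Rabs_ge_opp (d * q)). lra. }
    assert (K * Rabs q <= Rabs K * Rabs q).
    { apply Rmult_le_compat_r; [apply Rabs_pos|apply Rle_abs]. }
    assert (q * q = Rabs q * Rabs q) by (rewrite <- Rabs_mult, Rabs_pos_eq; nra).
    set (z := Rabs q) in *.
    assert (k * z <= gamma / 2 * (z * z) + k * k / (2 * gamma)).
    { assert (gamma / 2 * (z * z) + k * k / (2 * gamma) - k * z = gamma / 2 * ((z - k / gamma) * (z - k / gamma))) by (field; lra).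
      assert (0 <= gamma / 2 * ((z - k / gamma) * (z - k / gamma))); [|lra].
      apply Rmult_le_pos; [lra|]. apply Rle_0_sqr. }
    assert (k * z = Rabs K * z + Rabs d * z) by (unfold k; ring).
    clearbody k z. rewrite H1 in Hd. lra.
  - intros i c c' Hc H q; specialize (H q); lra.
Qed.

End Lagrangian.

(** * Infima and suprema in the extended reals, and the Hamiltonians *)

Lemma is_sup_ER_unique (S : ERbar -> Prop) (m m' : ERbar) : is_sup_ER S m -> is_sup_ER S m' -> m = m'.
Proof.
  intros [H1 H2] [H3 H4]. specialize (H2 m' H3); specialize (H4 m H1).
  destruct m, m'; simpl in *; try tauto; f_equal; lra.
Qed.

Lemma is_inf_ER_unique (S : ERbar -> Prop) (m m' : ERbar) : is_inf_ER S m -> is_inf_ER S m' -> m = m'.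
Proof.
  intros [H1 H2] [H3 H4]. specialize (H2 m' H3); specialize (H4 m H1).
  destruct m, m'; simpl in *; try tauto; f_equal; lra.
Qed.

Lemma ERSup_eq (S : ERbar -> Prop) (m : ERbar) : is_sup_ER S m -> ERSup S = m.
Proof.
  intro H; apply (is_sup_ER_unique S); auto. unfold ERSup; apply epsilon_spec; eauto.
Qed.

Lemma ERInf_eq (S : ERbar -> Prop) (m : ERbar) : is_inf_ER S m -> ERInf S = m.
Proof.
  intro H; apply (is_inf_ER_unique S); auto. unfold ERInf; apply epsilon_spec; eauto.
Qed.

Lemma is_sup_ER_ex (S : ERbar -> Prop) : exists m, is_sup_ER S m.
Proof.
  destruct (classic (exists r, (forall v, S v -> ERle v (Fin r)))) as [[r Hr]|Hn].
  - destruct (classic (exists x, S (Fin x))) as [[x Hx]|Hn].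
    + destruct (completeness (fun x => S (Fin x))) as [m [H1 H2]].
      * exists r; intros y Hy; apply (Hr (Fin y) Hy).
      * eauto.
      * exists (Fin m); split.
        -- intros [y| |] Hy; simpl; try exact I; [now apply H1|exact (Hr PInf Hy)].
        -- intros [y| |] Hy; simpl; try exact I; [|exact (Hy (Fin x) Hx)].
           apply H2; intros z Hz; apply (Hy (Fin z) Hz).
    + exists MInf; split.
      * intros [y| |] Hy; simpl; try exact I; [exact (Hn (ex_intro _ y Hy))|exact (Hr PInf Hy)].
      * intros [y| |] _; simpl; exact I.
  - exists PInf; split; [intros [] _; simpl; exact I|].
    intros [r| |] Hr; simpl; try exact I; apply Hn; [now exists r|].
    exists 0. intros v Hv; specialize (Hr v Hv); destruct v; simpl in *; tauto.
Qed.

Definition ERopp (v : ERbar) : ERbar := match v with Fin r => Fin (- r) | PInf => MInf | MInf => PInf end.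

Lemma ERopp_le (a b : ERbar) : ERle a b -> ERle (ERopp b) (ERopp a).
Proof. destruct a, b; simpl; auto; lra. Qed.

Lemma ERopp_opp (a : ERbar) : ERopp (ERopp a) = a.
Proof. destruct a; simpl; auto; f_equal; ring. Qed.

Lemma is_inf_ER_ex (S : ERbar -> Prop) : exists m, is_inf_ER S m.
Proof.
  destruct (is_sup_ER_ex (fun v => S (ERopp v))) as [m [H1 H2]].
  exists (ERopp m); split.
  - intros v Hv. rewrite <- (ERopp_opp v). apply ERopp_le, H1. now rewrite ERopp_opp.
  - intros m' Hm'. rewrite <- (ERopp_opp m'). apply ERopp_le, H2.
    intros v Hv. rewrite <- (ERopp_opp v). now apply ERopp_le, Hm'.
Qed.

Lemma ERInf_spec (S : ERbar -> Prop) : is_inf_ER S (ERInf S).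
Proof. unfold ERInf; apply epsilon_spec, is_inf_ER_ex. Qed.

Lemma ERSup_spec (S : ERbar -> Prop) : is_sup_ER S (ERSup S).
Proof. unfold ERSup; apply epsilon_spec, is_sup_ER_ex. Qed.

Lemma ERle_trans (a b c : ERbar) : ERle a b -> ERle b c -> ERle a c.
Proof. destruct a, b, c; simpl; try tauto; lra. Qed.

Lemma ERSup_Fin_image (Q : R -> Prop) (f : R -> R) (B : R) :
  (exists q, Q q) -> (forall q, Q q -> f q <= B) ->
  exists m, ERSup (fun v => exists q, Q q /\ v = Fin (f q)) = Fin m /\
    (forall q, Q q -> f q <= m) /\ (forall c, (forall q, Q q -> f q <= c) -> m <= c).
Proof.
  intros [q0 Hq0] HB.
  destruct (ERSup_spec (fun v => exists q, Q q /\ v = Fin (f q))) as [H1 H2].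
  set (S := ERSup _) in *.
  destruct S as [m| |].
  - exists m; split; auto; split.
    + intros q Hq; apply (H1 (Fin (f q))); eauto.
    + intros c Hc; apply (H2 (Fin c)). intros v (q & Hq & ->); simpl; auto.
  - exfalso; apply (H2 (Fin B)). intros v (q & Hq & ->); simpl; auto.
  - exfalso; apply (H1 (Fin (f q0))); eauto.
Qed.

Section Hamiltonian.
Context (N : nat) (L : nat -> R -> R) (gamma : R) (HA1 : hypA1 N L gamma).

Lemma L_linear_bound (i : nat) (p : R) : (i < N)%nat -> exists B, forall q, p * q - L i q <= B.
Proof.
  intro Hi. destruct (L_superlinear N L gamma HA1 (Rabs p)) as (C & _ & HC).
  exists C; intro q; specialize (HC i Hi q). rewrite <- Rabs_mult in HC.
  pose proof (Rle_abs (p * q)); lra.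
Qed.

(** Superlinearity makes the supremum finite, so [ERreal] returns it and not its default 0. *)
Lemma Hfun_lub (i : nat) (p : R) : (i < N)%nat ->
  (forall q, p * q - L i q <= Hfun (L i) p) /\
  (forall c, (forall q, p * q - L i q <= c) -> Hfun (L i) p <= c).
Proof.
  intro Hi. destruct (L_linear_bound i p Hi) as [B HB].
  destruct (ERSup_Fin_image (fun _ => True) (fun q => p * q - L i q) B) as (m & Em & H1 & H2); auto.
  { exists 0; auto. }
  unfold Hfun. replace (ERSup _) with (Fin m); simpl.
  - split; intros; [apply H1|apply H2]; auto.
  - rewrite <- Em; symmetry; apply ERSup_eq.
    destruct (ERSup_spec (fun v => exists q, True /\ v = Fin (p * q - L i q))) as [H3 H4].
    split.
    + intros v (q & ->); apply H3; eauto.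
    + intros m' Hm'; apply H4. intros v (q & _ & ->); apply Hm'; eauto.
Qed.

Lemma Hminus_lub (i : nat) (p : R) : (i < N)%nat ->
  (forall q, q <= 0 -> p * q - L i q <= Hminus (L i) p) /\
  (forall c, (forall q, q <= 0 -> p * q - L i q <= c) -> Hminus (L i) p <= c).
Proof.
  intro Hi. destruct (L_linear_bound i p Hi) as [B HB].
  destruct (ERSup_Fin_image (fun q => q <= 0) (fun q => p * q - L i q) B) as (m & Em & H1 & H2); auto.
  { exists 0; lra. }
  unfold Hminus. rewrite Em; simpl; auto.
Qed.

Lemma maxUpTo_ge (f : nat -> R) (n i : nat) : (i <= n)%nat -> f i <= maxUpTo f n.
Proof.
  intro H; induction H; simpl.
  - destruct i; simpl; [lra|apply Rmax_r].
  - eapply Rle_trans; [apply IHle|apply Rmax_l].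
Qed.

Lemma maxUpTo_lub (f : nat -> R) (n : nat) (c : R) :
  (forall i, (i <= n)%nat -> f i <= c) -> maxUpTo f n <= c.
Proof. intro H; induction n; simpl; [apply H; lia|]. apply Rmax_lub; [apply IHn|apply H]; auto. Qed.

Lemma maxUpTo_attained (f : nat -> R) (n : nat) : exists i, (i <= n)%nat /\ maxUpTo f n = f i.
Proof.
  induction n; simpl; [exists O; auto|]. destruct IHn as (i & Hi & E).
  unfold Rmax; destruct (Rle_dec _ _); [exists (S n)|exists i]; auto.
Qed.

Lemma minUpTo_le (f : nat -> R) (n i : nat) : (i <= n)%nat -> minUpTo f n <= f i.
Proof.
  intro H; induction H; simpl.
  - destruct i; simpl; [lra|apply Rmin_r].
  - eapply Rle_trans; [apply Rmin_l|apply IHle].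
Qed.

Lemma minUpTo_attained (f : nat -> R) (n : nat) : exists i, (i <= n)%nat /\ minUpTo f n = f i.
Proof.
  induction n; simpl; [exists O; auto|]. destruct IHn as (i & Hi & E).
  unfold Rmin; destruct (Rle_dec _ _); [exists i|exists (S n)]; auto.
Qed.

End Hamiltonian.

(** * Piecewise affine plans and their value *)

(** A step stays in one branch, so crossing the vertex takes two steps. Resting at the vertex along
    branch i is charged L_i(0) instead of L_0(0); since i is free, the infimum is the same. *)
Inductive reach (N : nat) (e : nat -> pt) (L : nat -> R -> R) (u0 : pt -> R) : R -> pt -> R -> Prop :=
| reach_start (x : pt) : inJ N e x -> reach N e L u0 0 x (u0 x)
| reach_step (t c : R) (i : nat) (r1 r2 h : R) :
    (i < N)%nat -> 0 <= r1 -> 0 <= r2 -> 0 < h ->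
    reach N e L u0 t (scal r1 (e i)) c ->
    reach N e L u0 (t + h) (scal r2 (e i)) (c + h * L i ((r2 - r1) / h)).

Definition value (N : nat) (e : nat -> pt) (L : nat -> R -> R) (u0 : pt -> R) (t : R) (x : pt) : R :=
  epsilon (inhabits 0) (fun w => (forall c, reach N e L u0 t x c -> w <= c) /\
    forall m, (forall c, reach N e L u0 t x c -> m <= c) -> m <= w).

(* The constant [C] absorbs every a priori bound used on the running costs. *)
Definition plan_bounds (N : nat) (e : nat -> pt) (L : nat -> R -> R) (u0 : pt -> R) (K C : R) : Prop :=
  0 <= K /\ 0 <= C /\
  (forall x y, inJ N e x -> inJ N e y -> Rabs (u0 x - u0 y) <= K * dJ N e x y) /\
  (forall i q, (i < N)%nat -> K * Rabs q - C <= L i q) /\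
  (forall i, (i < N)%nat -> L i 0 <= C /\ L i 1 <= C /\ L i (-1) <= C).

Lemma plan_bounds_ex (N : nat) (e : nat -> pt) (L : nat -> R -> R) (gamma : R) (u0 : pt -> R) :
  junction N e -> hypA0 N e u0 -> hypA1 N L gamma -> exists K C, plan_bounds N e L u0 K C.
Proof.
  intros HJ [K0 HK] HA1.
  destruct (L_superlinear N L gamma HA1 (Rabs K0)) as (C1 & HC1 & H1).
  destruct (finite_upper_bound (fun i c => L i 0 <= c /\ L i 1 <= c /\ L i (-1) <= c) N) as (C2 & HC2 & H2).
  - intros i _; exists (Rmax (L i 0) (Rmax (L i 1) (L i (-1)))).
    pose proof (Rmax_l (L i 0) (Rmax (L i 1) (L i (-1)))). pose proof (Rmax_r (L i 0) (Rmax (L i 1) (L i (-1)))).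
    pose proof (Rmax_l (L i 1) (L i (-1))). pose proof (Rmax_r (L i 1) (L i (-1))). lra.
  - intros i c c' Hc H; lra.
  - exists (Rabs K0), (C1 + C2). repeat split; try lra.
    + apply Rabs_pos.
    + intros x y Hx Hy. eapply Rle_trans; [apply HK; auto|].
      apply Rmult_le_compat_r; [apply (dJ_nonneg N e)|apply Rle_abs].
    + intros i q Hi; specialize (H1 i Hi q); lra.
    + specialize (H2 i H); lra.
    + specialize (H2 i H); lra.
    + specialize (H2 i H); lra.
Qed.

Section Value.
Context (N : nat) (e : nat -> pt) (L : nat -> R -> R) (u0 : pt -> R) (K C : R).
Context (HJ : junction N e) (HB : plan_bounds N e L u0 K C).

Local Notation reach := (reach N e L u0).
Local Notation W := (value N e L u0).
Local Notation d := (dJ N e).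

Lemma reach_dom (t : R) (x : pt) (c : R) : reach t x c -> 0 <= t /\ inJ N e x.
Proof. intro H; induction H; [split; auto; lra|]. split; [lra|]. now apply (inJ_scal N e). Qed.

Lemma reach_zero (t : R) (x : pt) (c : R) : reach t x c -> t = 0 -> c = u0 x.
Proof. intros [|t' c' i r1 r2 h Hi H1 H2 Hh H] E; auto. apply reach_dom in H; lra. Qed.

Lemma cost_lower_bound (i : nat) (r1 r2 h : R) : (i < N)%nat -> 0 < h ->
  K * Rabs (r2 - r1) - C * h <= h * L i ((r2 - r1) / h).
Proof.
  intros Hi Hh. destruct HB as (_ & _ & _ & H & _). specialize (H i ((r2 - r1) / h) Hi).
  apply Rmult_le_compat_l with (r := h) in H; [|lra].
  unfold Rdiv in H at 1. rewrite Rabs_mult, (Rabs_pos_eq (/ h)) in H by now apply Rinv_nonneg.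
  replace (h * (K * (Rabs (r2 - r1) * / h) - C)) with (K * Rabs (r2 - r1) - C * h) in H by (field; lra). auto.
Qed.

Lemma u0_branch (i : nat) (r1 r2 : R) : (i < N)%nat -> 0 <= r1 -> 0 <= r2 ->
  Rabs (u0 (scal r2 (e i)) - u0 (scal r1 (e i))) <= K * Rabs (r2 - r1).
Proof.
  intros Hi H1 H2. destruct HB as (_ & _ & H & _).
  rewrite <- (dJ_same N e HJ i r2 r1) by auto. apply H; apply (inJ_scal N e); auto.
Qed.

(** A displacement changes [u0] by at most K times its length, and by [cost_lower_bound] that much
    is paid in running cost, up to C per unit of time. *)
Lemma reach_lower (t : R) (x : pt) (c : R) : reach t x c -> u0 x - C * t <= c.
Proof.
  intro H; induction H as [x Hx|t c i r1 r2 h Hi H1 H2 Hh H IH]; [lra|].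
  pose proof (cost_lower_bound i r1 r2 h Hi Hh).
  pose proof (Rabs_le_both _ _ (u0_branch i r1 r2 Hi H1 H2)). lra.
Qed.

Lemma reach_stay (t : R) (x : pt) (c h : R) : reach t x c -> 0 <= h ->
  exists c', reach (t + h) x c' /\ c' <= c + C * h.
Proof.
  intros H Hh. destruct (Req_dec h 0) as [->|Hne].
  { exists c; rewrite Rplus_0_r; split; auto; lra. }
  destruct (reach_dom _ _ _ H) as [Ht Hx]. apply inJ_elim in Hx.
  destruct Hx as (i & r & Hi & Hr & ->).
  eexists; split; [apply (reach_step N e L u0 t c i r r h); auto; lra|].
  unfold Rdiv; rewrite Rminus_diag, Rmult_0_l. destruct HB as (_ & _ & _ & _ & HL).
  destruct (HL i Hi) as [H0 _]. apply Rmult_le_compat_l with (r := h) in H0; lra.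
Qed.

(** Deletes the first h units of time of the plan and restarts from the point reached then, cutting
    a segment if necessary. By the estimate behind [reach_lower], [u0] at that point exceeds the
    cost deleted by at most C h. *)
Lemma reach_shift (t : R) (x : pt) (c : R) : reach t x c -> forall h, 0 <= h <= t ->
  exists c', reach (t - h) x c' /\ c' <= c + C * h.
Proof.
  intro H; induction H as [x Hx|t c i r1 r2 k Hi H1 H2 Hk H IH]; intros h Hh.
  { exists (u0 x); replace h with 0 by lra. rewrite Rminus_0_r; split; [now constructor|lra]. }
  destruct (Rle_dec h t) as [Hht|Hht].
  - destruct (IH h ltac:(lra)) as (c' & Hc' & Hle). eexists; split.
    + replace (t + k - h) with ((t - h) + k) by ring. apply (reach_step N e L u0 (t - h) c' i r1 r2 k); auto.
    + lra.
  - apply Rnot_le_lt in Hht. destruct (reach_dom _ _ _ H) as [Ht _].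
    pose proof (reach_lower _ _ _ H) as Hlow.
    destruct (Req_dec h (t + k)) as [->|Hne].
    { exists (u0 (scal r2 (e i))); rewrite Rminus_diag; split; [constructor; now apply (inJ_scal N e)|].
      assert (Hr : reach (t + k) (scal r2 (e i)) (c + k * L i ((r2 - r1) / k))) by (constructor; auto).
      apply reach_lower in Hr. lra. }
    set (h' := h - t). set (q := (r2 - r1) / k).
    assert (Hq : r2 = r1 + q * k) by (unfold q; field; lra).
    assert (Hh' : 0 < h' < k) by (unfold h'; lra).
    set (z := r1 + q * h').
    assert (Hz : 0 <= z).
    { unfold z. assert (0 <= (k - h') * r1 + h' * r2).
      { apply Rplus_le_le_0_compat; apply Rmult_le_pos; lra. }
      apply Rmult_le_reg_l with k; auto. rewrite Rmult_0_r. rewrite Hq in H0. lra. }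
    exists (u0 (scal z (e i)) + (k - h') * L i ((r2 - z) / (k - h'))); split.
    + replace (t + k - h) with (0 + (k - h')) by (unfold h'; ring).
      apply reach_step; auto; [lra|]. constructor; now apply (inJ_scal N e).
    + replace ((r2 - z) / (k - h')) with q by (unfold z; rewrite Hq; field; lra).
      pose proof (cost_lower_bound i r1 z h' Hi ltac:(lra)) as Hc.
      replace ((z - r1) / h') with q in Hc by (unfold z; field; lra).
      pose proof (Rabs_le_both _ _ (u0_branch i r1 z Hi H1 Hz)) as Hu.
      replace h with (t + h') by (unfold h'; ring). lra.
Qed.

Lemma value_spec (t : R) (x : pt) : 0 <= t -> inJ N e x ->
  (forall c, reach t x c -> W t x <= c) /\
  (forall m, (forall c, reach t x c -> m <= c) -> m <= W t x).
Proof.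
  intros Ht Hx. unfold value. apply epsilon_spec.
  destruct (completeness (fun m => reach t x (- m))) as [m [H1 H2]].
  - exists (- (u0 x - C * t)); intros y Hy. apply reach_lower in Hy; lra.
  - destruct (reach_stay 0 x (u0 x) t) as (c & Hc & _); [now constructor|auto|].
    rewrite Rplus_0_l in Hc. exists (- c); now rewrite Ropp_involutive.
  - exists (- m); split.
    + intros c Hc; assert (- c <= m); [|lra]. apply H1; now rewrite Ropp_involutive.
    + intros b Hb; assert (m <= - b); [|lra]. apply H2; intros y Hy; specialize (Hb _ Hy); lra.
Qed.

Lemma value_le (t : R) (x : pt) (c : R) : reach t x c -> W t x <= c.
Proof. intro H; destruct (reach_dom _ _ _ H). now apply value_spec. Qed.

Lemma value_approx (t : R) (x : pt) (eps : R) : 0 <= t -> inJ N e x -> 0 < eps ->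
  exists c, reach t x c /\ c < W t x + eps.
Proof.
  intros Ht Hx He. apply NNPP; intro Hn.
  assert (W t x + eps <= W t x); [|lra].
  apply value_spec; auto. intros c Hc; apply Rnot_lt_le; intro; apply Hn; eauto.
Qed.

Lemma value_zero (x : pt) : inJ N e x -> W 0 x = u0 x.
Proof.
  intro Hx; apply Rle_antisym.
  - apply value_le; now constructor.
  - apply value_spec; auto; [lra|]. intros c Hc; apply reach_zero in Hc; lra.
Qed.

Lemma value_dpp (t : R) (i : nat) (r1 r2 h : R) : 0 <= t -> (i < N)%nat -> 0 <= r1 -> 0 <= r2 -> 0 < h ->
  W (t + h) (scal r2 (e i)) <= W t (scal r1 (e i)) + h * L i ((r2 - r1) / h).
Proof.
  intros Ht Hi H1 H2 Hh.
  assert (W (t + h) (scal r2 (e i)) - h * L i ((r2 - r1) / h) <= W t (scal r1 (e i))); [|lra].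
  apply value_spec; auto; [now apply (inJ_scal N e)|]. intros c Hc.
  assert (W (t + h) (scal r2 (e i)) <= c + h * L i ((r2 - r1) / h)); [|lra].
  apply value_le. now constructor.
Qed.

Lemma value_dpp' (s t : R) (i : nat) (r1 r2 q : R) : 0 <= s -> s < t -> (i < N)%nat -> 0 <= r1 -> 0 <= r2 ->
  r2 - r1 = q * (t - s) ->
  W t (scal r2 (e i)) <= W s (scal r1 (e i)) + (t - s) * L i q.
Proof.
  intros Hs Hst Hi H1 H2 Hq.
  pose proof (value_dpp s i r1 r2 (t - s) Hs Hi H1 H2 ltac:(lra)) as H.
  replace (s + (t - s)) with t in H by ring.
  replace ((r2 - r1) / (t - s)) with q in H by (rewrite Hq; field; lra). auto.
Qed.

Lemma value_bounds (t : R) (x : pt) : 0 <= t -> inJ N e x -> Rabs (W t x - u0 x) <= C * t.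
Proof.
  intros Ht Hx. apply Rabs_le; split.
  - assert (u0 x - C * t <= W t x); [|lra]. apply value_spec; auto. apply reach_lower.
  - destruct (reach_stay 0 x (u0 x) t) as (c & Hc & Hle); [now constructor|auto|].
    rewrite Rplus_0_l in Hc. apply value_le in Hc. lra.
Qed.

Lemma value_time (s t : R) (x : pt) : 0 <= s -> s <= t -> inJ N e x -> Rabs (W t x - W s x) <= C * (t - s).
Proof.
  intros Hs Hst Hx. apply Rabs_le; split.
  - assert (W s x - C * (t - s) <= W t x); [|lra]. apply value_spec; auto; [lra|]. intros c Hc.
    destruct (reach_shift _ _ _ Hc (t - s) ltac:(lra)) as (c' & Hc' & Hle).
    replace (t - (t - s)) with s in Hc' by ring. apply value_le in Hc'; lra.
  - assert (W t x - C * (t - s) <= W s x); [|lra]. apply value_spec; auto. intros c Hc.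
    destruct (reach_stay _ _ _ (t - s) Hc ltac:(lra)) as (c' & Hc' & Hle).
    replace (s + (t - s)) with t in Hc' by ring. apply value_le in Hc'; lra.
Qed.

(** With h = |r2 - r1|, go back to time t - h at r1 and move at unit speed to r2: time regularity
    and the move cost C h each. If t < h this is impossible, but W is then within C h of [u0], which
    is K-Lipschitz. *)
Lemma value_space_le (t : R) (i : nat) (r1 r2 : R) : 0 <= t -> (i < N)%nat -> 0 <= r1 -> 0 <= r2 ->
  W t (scal r2 (e i)) <= W t (scal r1 (e i)) + (2 * C + K) * Rabs (r2 - r1).
Proof.
  intros Ht Hi H1 H2. destruct (Req_dec r1 r2) as [->|Hne].
  { rewrite Rminus_diag, Rabs_R0; lra. }
  set (h := Rabs (r2 - r1)). assert (Hh : 0 < h) by (apply Rabs_pos_lt; lra).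
  destruct HB as (HK & HC & _ & _ & HL). destruct (HL i Hi) as (_ & HL1 & HL2).
  pose proof (inJ_scal N e i r1 Hi H1) as I1. pose proof (inJ_scal N e i r2 Hi H2) as I2.
  destruct (Rle_dec h t) as [Hht|Hht].
  - pose proof (value_time (t - h) t (scal r1 (e i)) ltac:(lra) ltac:(lra) I1) as Ht'.
    apply Rabs_le_both in Ht'.
    pose proof (value_dpp (t - h) i r1 r2 h ltac:(lra) Hi H1 H2 Hh) as Hd.
    replace (t - h + h) with t in Hd by ring.
    assert (L i ((r2 - r1) / h) <= C).
    { unfold h, Rabs in *; destruct (Rcase_abs (r2 - r1)).
      - replace ((r2 - r1) / - (r2 - r1)) with (-1) by (field; lra). auto.
      - replace ((r2 - r1) / (r2 - r1)) with 1 by (field; lra). auto. }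
    assert (h * L i ((r2 - r1) / h) <= h * C) by (apply Rmult_le_compat_l; lra).
    assert (0 <= K * h) by (apply Rmult_le_pos; lra). lra.
  - apply Rnot_le_lt in Hht.
    pose proof (Rabs_le_both _ _ (value_bounds t _ Ht I1)).
    pose proof (Rabs_le_both _ _ (value_bounds t _ Ht I2)).
    pose proof (Rabs_le_both _ _ (u0_branch i r1 r2 Hi H1 H2)) as Hu. fold h in Hu.
    assert (C * t <= C * h) by (apply Rmult_le_compat_l; lra). lra.
Qed.

Lemma value_space (t : R) (x y : pt) : 0 <= t -> inJ N e x -> inJ N e y ->
  W t y <= W t x + (2 * C + K) * d y x.
Proof.
  intros Ht Hx Hy. destruct (dJ_cases N e HJ y x Hy Hx) as
     [(i & r & s & Hi & Hr & Hs & -> & -> & ->)|(i & j & r & s & Hi & Hj & Hij & Hr & Hs & -> & -> & ->)].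
  - now apply value_space_le.
  - pose proof (value_space_le t i 0 r Ht Hi ltac:(lra) Hr) as H1.
    pose proof (value_space_le t j s 0 Ht Hj Hs ltac:(lra)) as H2.
    rewrite scal_zero in *. rewrite Rminus_0_r, Rabs_pos_eq in H1 by auto.
    rewrite Rminus_0_l, Rabs_Ropp, Rabs_pos_eq in H2 by auto. lra.
Qed.

Lemma value_lipschitz (s t : R) (x y : pt) : 0 <= s -> 0 <= t -> inJ N e x -> inJ N e y ->
  Rabs (W s y - W t x) <= (2 * C + K) * (Rabs (s - t) + d y x).
Proof.
  intros Hs Ht Hx Hy.
  pose proof (value_space t x y Ht Hx Hy) as H1. pose proof (value_space t y x Ht Hy Hx) as H2.
  rewrite (dJ_sym N e HJ x y Hx Hy) in H2.
  assert (H3 : Rabs (W s y - W t y) <= C * Rabs (s - t)).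
  { destruct (Rle_dec s t).
    - rewrite (Rabs_minus_sym s t), (Rabs_minus_sym (W s y)), (Rabs_pos_eq (t - s)) by lra. apply value_time; auto.
    - rewrite (Rabs_pos_eq (s - t)) by lra. apply value_time; auto; lra. }
  apply Rabs_le_both in H3. destruct HB as (HK & HC & _).
  assert (0 <= (C + K) * Rabs (s - t)) by (apply Rmult_le_pos; [lra|apply Rabs_pos]).
  apply Rabs_le; lra.
Qed.

End Value.

(** * The value function is the infimum over plans *)

Lemma derivable_pt_lim_near (f g : R -> R) (x l d : R) : 0 < d ->
  (forall y, Rabs (y - x) < d -> f y = g y) -> derivable_pt_lim f x l -> derivable_pt_lim g x l.
Proof.
  intros Hd Hfg H eps He. destruct (H eps He) as [d' Hd'].
  assert (Hm : 0 < Rmin d d') by (apply Rmin_glb_lt; [auto|apply cond_pos]).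
  exists (mkposreal _ Hm); simpl; intros h Hh Hh'.
  rewrite <- !Hfg.
  - apply Hd'; auto. eapply Rlt_le_trans; [eassumption|apply Rmin_r].
  - rewrite Rminus_diag, Rabs_R0; auto.
  - replace (x + h - x) with h by ring. eapply Rlt_le_trans; [eassumption|apply Rmin_l].
Qed.

Lemma derivable_pt_lim_affine (a b c x : R) : derivable_pt_lim (fun y => a + b * (y - c)) x b.
Proof.
  intros eps He; exists (mkposreal _ Rlt_0_1); intros h Hh _.
  replace ((a + b * (x + h - c) - (a + b * (x - c))) / h - b) with 0 by (field; auto).
  now rewrite Rabs_R0.
Qed.

Definition lip_on (s t M : R) (f : R -> R) : Prop :=
  forall a b, s <= a -> a <= b -> b <= t -> Rabs (f b - f a) <= M * (b - a).

Lemma lip_on_le (s t M M' : R) (f : R -> R) : M <= M' -> lip_on s t M f -> lip_on s t M' f.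
Proof.
  intros HM H a b Ha Hab Hb. specialize (H a b Ha Hab Hb).
  assert (M * (b - a) <= M' * (b - a)) by (apply Rmult_le_compat_r; lra). lra.
Qed.

Definition glue (A : Type) (t : R) (f g : R -> A) (x : R) : A := if Rle_dec x t then f x else g x.

Lemma glue_l (A : Type) (t : R) (f g : R -> A) (x : R) : x <= t -> glue A t f g x = f x.
Proof. intro H; unfold glue; destruct (Rle_dec x t); tauto. Qed.

Lemma glue_r (A : Type) (t : R) (f g : R -> A) (x : R) : t < x -> glue A t f g x = g x.
Proof. intro H; unfold glue; destruct (Rle_dec x t); [lra|auto]. Qed.

Lemma lip_on_glue (s t u M : R) (f g : R -> R) : s <= t -> t <= u -> f t = g t ->
  lip_on s t M f -> lip_on t u M g -> lip_on s u M (glue R t f g).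
Proof.
  intros Hst Htu E Hf Hg a b Ha Hab Hb.
  destruct (Rle_dec b t); [|destruct (Rle_dec a t)].
  - rewrite !glue_l by lra. apply Hf; lra.
  - rewrite (glue_l _ t f g a), (glue_r _ t f g b) by lra.
    pose proof (Hf a t Ha ltac:(lra) ltac:(lra)) as H1. pose proof (Hg t b ltac:(lra) ltac:(lra) ltac:(lra)) as H2.
    replace (g b - f a) with ((g b - g t) + (f t - f a)) by (rewrite E; ring).
    eapply Rle_trans; [apply Rabs_triang|]. lra.
  - rewrite !glue_r by lra. apply Hg; lra.
Qed.

Lemma lip_on_affine (s t a b c M : R) : Rabs b <= M -> lip_on s t M (fun x => a + b * (x - c)).
Proof.
  intros H x y _ Hxy _. replace (_ - _) with (b * (y - x)) by ring.
  rewrite Rabs_mult, (Rabs_pos_eq (y - x)) by lra. apply Rmult_le_compat_r; lra.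
Qed.

Lemma derivable_isolated (g : R -> R) (x v : R) : derivable_pt_lim g x v -> v <> 0 ->
  exists d, 0 < d /\ forall y, Rabs (y - x) < d -> g y = g x -> y = x.
Proof.
  intros H Hv. destruct (H (Rabs v)) as [d Hd]; [now apply Rabs_pos_lt|].
  exists d; split; [apply cond_pos|]. intros y Hy E.
  apply NNPP; intro Hne. specialize (Hd (y - x) ltac:(lra) Hy).
  replace (x + (y - x)) with y in Hd by ring. rewrite E, Rminus_diag in Hd.
  unfold Rdiv in Hd; rewrite Rmult_0_l, Rminus_0_l, Rabs_Ropp in Hd. lra.
Qed.

Section Representation.
Context (N : nat) (e : nat -> pt) (L : nat -> R -> R) (gamma : R) (u0 : pt -> R) (K C : R).
Context (HJ : junction N e) (HA1 : hypA1 N L gamma) (HB : plan_bounds N e L u0 K C).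

Local Notation reach := (reach N e L u0).
Local Notation W := (value N e L u0).
Local Notation d := (dJ N e).

(** [F] is the accumulated cost and [f] its density. Keeping F Lipschitz lets [HK_of_derivative]
    identify F t with the action. *)
Definition plan_curve (y : pt) (t : R) (x : pt) (X : R -> pt) (F f : R -> R) (M : R) : Prop :=
  inJ N e y /\ X 0 = y /\ X t = x /\ F 0 = 0 /\
  lip_on 0 t M (fun s => fst (X s)) /\ lip_on 0 t M (fun s => snd (X s)) /\ lip_on 0 t M F /\
  (forall s, 0 <= s <= t -> inJ N e (X s)) /\
  ae_on 0 t (fun s => exists V, curve_deriv X s V /\ admissible_dir N e (X s) V /\
    Lcost N e L (X s) V (f s) /\ derivable_pt_lim F s (f s)).

Lemma curve_deriv_near (X Y : R -> pt) (s : R) (V : pt) (r : R) : 0 < r ->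
  (forall y, Rabs (y - s) < r -> X y = Y y) -> curve_deriv X s V -> curve_deriv Y s V.
Proof.
  intros Hr H [H1 H2]; split.
  - eapply derivable_pt_lim_near with (d := r); [auto| |exact H1]. intros y Hy; simpl; now rewrite H.
  - eapply derivable_pt_lim_near with (d := r); [auto| |exact H2]. intros y Hy; simpl; now rewrite H.
Qed.

(** The density k is L_i(q), except on a segment at rest at the vertex, where the Lagrangian is the
    possibly smaller L_0(0). Any other segment can meet the vertex only at its endpoints, hence the
    open time interval. *)
Lemma segment_velocity (i : nat) (r1 q t h : R) : (i < N)%nat -> 0 <= r1 -> 0 <= r1 + q * h -> 0 < h ->
  exists k, h * k <= h * L i q /\ forall s, t < s < t + h ->
  admissible_dir N e (scal (r1 + q * (s - t)) (e i)) (scal q (e i)) /\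
    Lcost N e L (scal (r1 + q * (s - t)) (e i)) (scal q (e i)) k.
Proof.
  intros Hi H1 H2 Hh.
  destruct (classic (r1 = 0 /\ q = 0)) as [[-> ->]|Hn].
  - exists (Lzero N L 0); split.
    + apply Rmult_le_compat_l; [lra|]. unfold Lzero. apply (minUpTo_le (fun j => L j 0)). lia.
    + intros s Hs. rewrite Rmult_0_l, Rplus_0_l, scal_zero; split.
      * right; split; auto; exists i, 0; rewrite scal_zero; repeat split; auto; lra.
      * right; split; auto; exists i, 0; rewrite scal_zero; repeat split; auto; lra.
  - exists (L i q); split; [lra|]. intros s Hs.
    assert (0 < r1 + q * (s - t)).
    { destruct (Req_dec q 0) as [->|Hq]; [assert (r1 <> 0) by (intro; apply Hn; auto); lra|].
      assert (H0 : h * (r1 + q * (s - t)) = (t + h - s) * r1 + (s - t) * (r1 + q * h)) by ring.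
      assert (0 < h * (r1 + q * (s - t))); [|apply Rmult_lt_reg_l with h; lra].
      rewrite H0. destruct (Req_dec r1 0) as [->|Hr].
      - assert (0 < q * h).
        { destruct (Req_dec (q * h) 0) as [E|]; [|lra].
          apply Rmult_integral in E; destruct E; lra. }
        assert (0 < (s - t) * (0 + q * h)) by (apply Rmult_lt_0_compat; lra). lra.
      - assert (0 < (t + h - s) * r1) by (apply Rmult_lt_0_compat; lra).
        assert (0 <= (s - t) * (r1 + q * h)) by (apply Rmult_le_pos; lra). lra. }
    split; left; exists i, (r1 + q * (s - t)); repeat split; auto; exists q; auto.
Qed.

Lemma plan_curve_ex (t : R) (x : pt) (c : R) : reach t x c ->
  exists y X F f M, 0 <= M /\ plan_curve y t x X F f M /\ u0 y + F t <= c.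
Proof.
  intro H; induction H as [x Hx|t c i r1 r2 h Hi H1 H2 Hh H IH].
  - exists x, (fun _ => x), (fun _ => 0), (fun _ => 0), 0. split; [lra|split; [|lra]].
    unfold plan_curve. repeat split; auto.
    1-3: intros a b _ _ _; rewrite Rminus_diag, Rabs_R0; lra.
    exists (fun z => z = 0); split; [|intros; lra].
    apply null_set_range with (fun _ => 0); intros z ->; now exists O.
  - destruct IH as (y & X & F & f & M & HM & (P1 & P2 & P3 & P4 & P5 & P6 & P7 & P8 & P9) & Hc).
    destruct (reach_dom N e L u0 _ _ _ H) as [Ht _].
    set (q := (r2 - r1) / h). assert (Hq : r1 + q * h = r2) by (unfold q; field; lra).
    destruct (segment_velocity i r1 q t h Hi H1 ltac:(lra) Hh) as (k & Hk & Hseg).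
    set (M' := M + Rabs (q * fst (e i)) + Rabs (q * snd (e i)) + Rabs k).
    pose proof (Rabs_pos (q * fst (e i))). pose proof (Rabs_pos (q * snd (e i))). pose proof (Rabs_pos k).
    set (Y := fun s => scal (r1 + q * (s - t)) (e i)).
    exists y, (glue pt t X Y), (glue R t F (fun s => F t + k * (s - t))), (glue R t f (fun _ => k)), M'.
    split; [unfold M'; lra|]. split.
    + assert (Hlip : forall (p : pt -> R) (z : R), (forall s, p (Y s) = p (X t) + z * (s - t)) -> Rabs z <= M' ->
        lip_on 0 t M (fun s => p (X s)) -> lip_on 0 (t + h) M' (fun s => p (glue pt t X Y s))).
      { intros p z Hp Hz HX a b Ha Hab Hb.
        assert (Hg : forall s, p (glue pt t X Y s) = glue R t (fun s => p (X s)) (fun s => p (X t) + z * (s - t)) s).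
        { intro s; unfold glue; destruct (Rle_dec s t); auto. }
        rewrite !Hg. revert a b Ha Hab Hb. apply lip_on_glue; try lra.
        - apply lip_on_le with (2 := HX); unfold M'; lra.
        - apply lip_on_affine; auto. }
      unfold plan_curve. repeat split; auto.
      * rewrite glue_l; auto.
      * rewrite glue_r by lra. unfold Y. f_equal. replace (t + h - t) with h by ring; auto.
      * rewrite glue_l; auto.
      * apply (Hlip fst (q * fst (e i))); auto; [|unfold M'; lra].
        intro s; rewrite P3; unfold Y; simpl; ring.
      * apply (Hlip snd (q * snd (e i))); auto; [|unfold M'; lra].
        intro s; rewrite P3; unfold Y; simpl; ring.
      * apply lip_on_glue; try lra.
        -- apply lip_on_le with (2 := P7); unfold M'; lra.
        -- apply lip_on_affine; unfold M'; lra.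
      * intros s Hs. destruct (Rle_dec s t).
        -- rewrite glue_l by auto; apply P8; lra.
        -- rewrite glue_r by lra. apply (inJ_scal N e); auto.
           apply Rmult_le_reg_l with h; auto. rewrite Rmult_0_r.
           replace (h * (r1 + q * (s - t))) with ((t + h - s) * r1 + (s - t) * (r1 + q * h)) by ring.
           rewrite Hq. apply Rplus_le_le_0_compat; apply Rmult_le_pos; lra.
      (* Two times are discarded: t, where the glued curve may have a corner, and t + h, where the
         segment may arrive at the vertex with q < 0, a velocity that is not admissible there. *)
      * destruct P9 as (Z & HZ & HP). destruct (ae_on_neq 0 (t + h) t) as (Z1 & HZ1 & HP1).
        destruct (ae_on_neq 0 (t + h) (t + h)) as (Z2 & HZ2 & HP2).
        exists (fun z => Z z \/ (Z1 z \/ Z2 z)). split; [repeat apply null_set_union; auto|].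
        intros s Hs Hn. assert (s <> t) by (apply HP1; tauto). assert (s <> t + h) by (apply HP2; tauto).
        destruct (Rlt_dec s t).
        -- destruct (HP s) as (V & V1 & V2 & V3 & V4); [lra|tauto|].
           assert (Hnear : forall A (f g : R -> A) y, Rabs (y - s) < t - s -> f y = glue A t f g y).
           { intros A f' g y' Hy. apply Rabs_def2 in Hy. rewrite glue_l by lra. auto. }
           exists V. rewrite !glue_l by lra. repeat split; auto.
           ++ apply (curve_deriv_near X _ s V (t - s)); auto; lra.
           ++ apply (curve_deriv_near X _ s V (t - s)); auto; lra.
           ++ apply (derivable_pt_lim_near F _ s (f s) (t - s)); auto; lra.
        -- assert (Hnear : forall A (f g : R -> A) y, Rabs (y - s) < s - t -> g y = glue A t f g y).
           { intros A f' g y' Hy. apply Rabs_def2 in Hy. rewrite glue_r by lra. auto. }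
           assert (HV : curve_deriv Y s (scal q (e i))).
           { split; simpl.
             - apply (derivable_pt_lim_near (fun s => r1 * fst (e i) + q * fst (e i) * (s - t)) _ s _ 1); [lra| |apply derivable_pt_lim_affine].
               intros; ring.
             - apply (derivable_pt_lim_near (fun s => r1 * snd (e i) + q * snd (e i) * (s - t)) _ s _ 1); [lra| |apply derivable_pt_lim_affine].
               intros; ring. }
           destruct (Hseg s ltac:(lra)) as [S1 S2].
           exists (scal q (e i)). rewrite !glue_r by lra. repeat split; auto.
           ++ apply (curve_deriv_near Y _ s (scal q (e i)) (s - t)); auto; lra.
           ++ apply (curve_deriv_near Y _ s (scal q (e i)) (s - t)); auto; lra.
           ++ apply (derivable_pt_lim_near (fun s => F t + k * (s - t)) _ s k (s - t)); [lra|now apply Hnear|].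
              apply derivable_pt_lim_affine.
    + rewrite glue_r by lra. fold q. replace (t + h - t) with h by ring. lra.
Qed.

Lemma plan_curve_action (t : R) (x : pt) (c : R) : reach t x c ->
  exists y X I, inJ N e y /\ adm_curve N e 0 y t x X /\ action N e L X 0 t I /\ u0 y + I <= c.
Proof.
  intro H. destruct (reach_dom N e L u0 _ _ _ H) as [Ht _].
  destruct (plan_curve_ex t x c H) as (y & X & F & f & M & HM & (P1 & P2 & P3 & P4 & P5 & P6 & P7 & P8 & P9) & Hc).
  exists y, X, (F t). repeat split; auto.
  - now apply lipschitz_abs_cont with M.
  - now apply lipschitz_abs_cont with M.
  - revert P9; apply ae_on_impl. intros s _ (V & V1 & V2 & V3 & V4); eauto.
  - exists f; split.
    + replace (F t) with (F t - F 0) by (rewrite P4; ring). apply HK_of_derivative; auto.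
      * now apply lipschitz_abs_cont with M.
      * revert P9; apply ae_on_impl. intros s _ (V & V1 & V2 & V3 & V4); auto.
    + revert P9; apply ae_on_impl. intros s _ (V & V1 & V2 & V3 & V4); eauto.
Qed.

(** W is Lipschitz for time and [dJ], and [dJ] is at most 1/kappa times the Euclidean distance; so
    its increments along X are controlled by those of time and of the two coordinates. *)
Lemma abs_cont_value_along (X : R -> pt) (t : R) : 0 <= t ->
  abs_cont (fun s => fst (X s)) 0 t -> abs_cont (fun s => snd (X s)) 0 t ->
  (forall s, 0 <= s <= t -> inJ N e (X s)) -> abs_cont (fun s => W s (X s)) 0 t.
Proof.
  intros Ht H1 H2 HX eps He.
  destruct (dJ_le_edist N e HJ) as (kappa & Hk & Hed).
  destruct HB as (HK & HC & _).
  set (M := (2 * C + K + 1) * (1 + / kappa)).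
  assert (Hik : 0 < / kappa) by now apply Rinv_0_lt_compat.
  assert (HM : 0 < M) by (apply Rmult_lt_0_compat; lra).
  assert (He' : 0 < eps / (3 * M)) by (apply Rdiv_lt_0_compat; lra).
  destruct (H1 _ He') as (d1 & Hd1 & H1'). destruct (H2 _ He') as (d2 & Hd2 & H2').
  exists (Rmin (eps / (3 * M)) (Rmin d1 d2)); split; [repeat apply Rmin_glb_lt; auto|].
  intros l Hl Hs.
  Rmin_bounds.
  specialize (H1' l Hl ltac:(lra)). specialize (H2' l Hl ltac:(lra)).
  assert (Hgen : forall l a, 0 <= a -> nonoverlapping a t l -> a <= t /\
    sum_var (fun s => W s (X s)) l <= M * (sum_len l + sum_var (fun s => fst (X s)) l + sum_var (fun s => snd (X s)) l)).
  { clear - HJ HB HX Hed Hk Hik HK HC HM. induction l as [|[b c] l IH]; simpl; intros a Ha Hl; [split; lra|].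
    destruct Hl as (L1 & L2 & L3). destruct (IH c ltac:(lra) L3) as [I1 I2]. split; [lra|].
    assert (Hb : inJ N e (X b)) by (apply HX; lra). assert (Hc : inJ N e (X c)) by (apply HX; lra).
    pose proof (value_lipschitz N e L u0 K C HJ HB c b (X b) (X c) ltac:(lra) ltac:(lra) Hb Hc) as Hl.
    rewrite (Rabs_pos_eq (c - b)) in Hl by lra.
    pose proof (Hed _ _ Hc Hb) as He. pose proof (edist_le_l1 (X c) (X b)) as He2.
    set (D := Rabs (fst (X c) - fst (X b)) + Rabs (snd (X c) - snd (X b))) in *.
    assert (HD : 0 <= D) by (unfold D; pose proof (Rabs_pos (fst (X c) - fst (X b)));
      pose proof (Rabs_pos (snd (X c) - snd (X b))); lra).
    assert (d (X c) (X b) <= / kappa * D).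
    { apply Rmult_le_reg_l with kappa; auto. rewrite <- Rmult_assoc, Rinv_r, Rmult_1_l by lra. lra. }
    assert (Rabs (W c (X c) - W b (X b)) <= M * ((c - b) + D)); [|unfold D in *; lra].
    eapply Rle_trans; [apply Hl|]. unfold M. rewrite Rmult_assoc.
    apply Rle_trans with ((2 * C + K) * ((1 + / kappa) * (c - b + D))).
    - apply Rmult_le_compat_l; [lra|].
      assert (0 <= / kappa * (c - b)) by (apply Rmult_le_pos; lra). lra.
    - apply Rmult_le_compat_r; [|lra]. apply Rmult_le_pos; lra. }
  destruct (Hgen l 0 ltac:(lra) Hl) as [_ Hle].
  apply Rle_lt_trans with (1 := Hle). 
  replace eps with (M * (eps / (3 * M) + eps / (3 * M) + eps / (3 * M))) by (field; lra).
  apply Rmult_lt_compat_l; lra.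
Qed.

(** X is continuous at xi, and every point of another branch is at geodesic distance at least r from
    X xi. The inner product with e_i then recovers the coordinate on the branch. *)
Lemma curve_branch_near (X : R -> pt) (t xi : R) (V : pt) (i : nat) (r : R) :
  (forall s, 0 <= s <= t -> inJ N e (X s)) -> curve_deriv X xi V ->
  (i < N)%nat -> 0 < r -> X xi = scal r (e i) ->
  exists d0, 0 < d0 /\ forall s, 0 <= s <= t -> Rabs (s - xi) < d0 ->
    0 <= ip (X s) (e i) /\ X s = scal (ip (X s) (e i)) (e i).
Proof.
  intros HX [HV1 HV2] Hi Hr E.
  destruct (dJ_le_edist N e HJ) as (kappa & Hk & Hed).
  assert (Hkr : 0 < kappa * r / 2) by (apply Rmult_lt_0_compat; [apply Rmult_lt_0_compat|]; lra).
  assert (Hcont : forall g v, derivable_pt_lim g xi v -> exists d0, 0 < d0 /\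
     forall s, Rabs (s - xi) < d0 -> Rabs (g s - g xi) < kappa * r / 2).
  { intros g v Hg. assert (Hc : continuity_pt g xi) by (apply derivable_continuous_pt; exists v; auto).
    destruct (Hc _ Hkr) as (d0 & Hd0 & H). exists d0; split; auto. intros s Hs.
    destruct (Req_dec xi s) as [<-|Hne]; [now rewrite Rminus_diag, Rabs_R0|].
    apply H; split; [split; simpl; auto|exact Hs]. exact I. }
  destruct (Hcont _ _ HV1) as (d1 & Hd1 & H1). destruct (Hcont _ _ HV2) as (d2 & Hd2 & H2).
  exists (Rmin d1 d2); split; [now apply Rmin_glb_lt|]. intros s Hs Hsx.
  Rmin_bounds.
  specialize (H1 s ltac:(lra)). specialize (H2 s ltac:(lra)). simpl in H1, H2.
  pose proof (edist_le_l1 (X s) (X xi)) as He.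
  pose proof (HX s Hs) as HXs.
  pose proof (Hed _ _ HXs (eq_ind_r (inJ N e) (inJ_scal N e i r Hi ltac:(lra)) E)) as Hd.
  assert (Hdr : d (X s) (X xi) < r) by (apply Rmult_lt_reg_l with kappa; lra).
  apply inJ_elim in HXs. destruct HXs as (j & r' & Hj & Hr' & E').
  destruct (Nat.eq_dec j i) as [->|Hne].
  - rewrite E', ip_scal_l, (ip_unit N e HJ), Rmult_1_r by auto. auto.
  - rewrite E, E', (dJ_diff N e HJ) in Hdr by (auto; lra). lra.
Qed.

(** On [a, c] the curve may be replaced by the segment with its mean velocity q, at cost (c - a)
    L_i(q); q is close to p by differentiability, and L_i is continuous. *)
Lemma straddle_value_branch (X : R -> pt) (t xi : R) (i : nat) (r p : R) (f : R -> R) :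
  (forall s, 0 <= s <= t -> inJ N e (X s)) -> curve_deriv X xi (scal p (e i)) ->
  (i < N)%nat -> 0 < r -> X xi = scal r (e i) -> f xi = L i p ->
  straddle_le (fun s => W s (X s)) f 0 t xi.
Proof.
  intros HX HV Hi Hr E Ef eps He.
  destruct (curve_branch_near X t xi _ i r HX HV Hi Hr E) as (d1 & Hd1 & Hnear).
  destruct (L_continuous N L gamma HA1 i p Hi eps He) as (dL & HdL & HL).
  assert (Hrho : derivable_pt_lim (fun s => ip (X s) (e i)) xi p).
  { destruct HV as [HV1 HV2]. unfold ip.
    replace p with (fst (e i) * (p * fst (e i)) + snd (e i) * (p * snd (e i))).
    - apply (derivable_pt_lim_near (fun s => fst (e i) * fst (X s) + snd (e i) * snd (X s)) _ xi _ 1); [lra|intros; ring|].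
      apply derivable_pt_lim_plus.
      + apply (derivable_pt_lim_scal (fun s => fst (X s))); auto.
      + apply (derivable_pt_lim_scal (fun s => snd (X s))); auto.
    - replace p with (p * ip (e i) (e i)) at 3 by (rewrite (ip_unit N e HJ) by auto; ring). unfold ip; ring. }
  destruct (derivable_straddle _ _ _ Hrho (dL / 2) ltac:(lra)) as (d2 & Hd2 & Hst).
  exists (Rmin d1 d2); split; [now apply Rmin_glb_lt|].
  Rmin_bounds.
  intros a c Ha Hax Hxc Hc Ha' Hc'.
  destruct (Req_dec a c) as [->|Hac]; [rewrite !Rminus_diag; lra|].
  specialize (Hst a c Hax Hxc ltac:(lra) ltac:(lra)).
  destruct (Hnear a ltac:(lra) ltac:(apply Rabs_def1; lra)) as [Na Ea].
  destruct (Hnear c ltac:(lra) ltac:(apply Rabs_def1; lra)) as [Nc Ec].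
  set (ra := ip (X a) (e i)) in *. set (rc := ip (X c) (e i)) in *.
  pose proof (value_dpp N e L u0 K C HJ HB a i ra rc (c - a) ltac:(lra) Hi Na Nc ltac:(lra)) as Hdpp.
  rewrite <- Ea, <- Ec in Hdpp. replace (a + (c - a)) with c in Hdpp by ring.
  assert (HLq : L i ((rc - ra) / (c - a)) <= L i p + eps).
  { set (q := (rc - ra) / (c - a)). destruct (Req_dec p q) as [->|Hpq]; [lra|].
    assert (Rabs (q - p) < dL).
    { replace (q - p) with ((rc - ra - p * (c - a)) * / (c - a)) by (unfold q; field; lra).
      rewrite Rabs_mult, (Rabs_pos_eq (/ (c - a))) by (apply Rlt_le, Rinv_0_lt_compat; lra).
      apply Rle_lt_trans with (dL / 2 * (c - a) * / (c - a)).
      - apply Rmult_le_compat_r; auto. apply Rlt_le, Rinv_0_lt_compat; lra.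
      - rewrite Rmult_assoc, Rinv_r by lra. lra. }
    assert (Hd : Rabs (L i q - L i p) < eps) by (apply HL; split; [split; simpl; auto; exact I|auto]).
    apply Rabs_def2 in Hd; lra. }
  rewrite Ef. apply Rmult_le_compat_l with (r := c - a) in HLq; lra.
Qed.

Lemma value_rest_origin (s t : R) : 0 <= s -> s <= t -> W t origin <= W s origin + (t - s) * Lzero N L 0.
Proof.
  intros Hs Hst. destruct (Req_dec s t) as [->|Hne]; [lra|].
  destruct (minUpTo_attained (fun j => L j 0) (N - 1)) as (j & Hj & E). unfold Lzero; rewrite E.
  rewrite <- (scal_zero (e j)). apply (value_dpp' N e L u0 K C HJ HB); try lra.
  pose proof (branch0 N e HJ); lia.
Qed.

(** With zero velocity X stays within o(c - a) of the vertex, so the Lipschitz bound replaces both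
    endpoint values of W by values at the vertex, where resting costs L_0(0) per unit of time. *)
Lemma straddle_value_origin (X : R -> pt) (t xi : R) (f : R -> R) :
  (forall s, 0 <= s <= t -> inJ N e (X s)) -> curve_deriv X xi origin ->
  X xi = origin -> f xi = Lzero N L 0 ->
  straddle_le (fun s => W s (X s)) f 0 t xi.
Proof.
  intros HX [HV1 HV2] E Ef eps He. simpl in HV1, HV2.
  destruct (dJ_le_edist N e HJ) as (kappa & Hk & Hed). pose proof HB as (HK & HC & _).
  set (M := 2 * C + K + 1). assert (HM : 0 < M) by (unfold M; lra).
  (* Two coordinates of size e' w give a geodesic distance of at most 2 e' w / kappa, hence a change
     of W of at most eps w. *)
  set (e' := eps * kappa / (2 * M)).
  assert (He' : 0 < e') by (apply Rdiv_lt_0_compat; [apply Rmult_lt_0_compat|]; lra).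
  destruct (derivable_straddle _ _ _ HV1 e' He') as (d1 & Hd1 & H1).
  destruct (derivable_straddle _ _ _ HV2 e' He') as (d2 & Hd2 & H2).
  exists (Rmin d1 d2); split; [now apply Rmin_glb_lt|].
  Rmin_bounds.
  intros a c Ha Hax Hxc Hc Ha' Hc'.
  assert (Hor : forall s w, 0 <= s <= t -> 0 <= w ->
    Rabs (fst (X s)) <= e' * w -> Rabs (snd (X s)) <= e' * w -> Rabs (W s (X s) - W s origin) <= eps * w).
  { intros s w Hs Hw Hf Hs'. pose proof (HX s Hs) as HXs.
    pose proof (value_lipschitz N e L u0 K C HJ HB s s origin (X s) ltac:(lra) ltac:(lra) (inJ_origin N e HJ) HXs) as Hl.
    rewrite Rminus_diag, Rabs_R0, Rplus_0_l in Hl.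
    pose proof (Hed _ _ HXs (inJ_origin N e HJ)) as He2. pose proof (edist_le_l1 (X s) origin) as He3.
    simpl in He3. rewrite !Rminus_0_r in He3.
    assert (d (X s) origin <= eps / M * w).
    { apply Rmult_le_reg_l with kappa; auto.
      replace (kappa * (eps / M * w)) with (2 * (e' * w)) by (unfold e'; field; lra). lra. }
    eapply Rle_trans; [apply Hl|]. apply Rle_trans with (M * (eps / M * w)).
    - apply Rmult_le_compat; [lra|apply (dJ_nonneg N e)|unfold M; lra|auto].
    - right; field; lra. }
  assert (Zero : fst (X xi) = 0 /\ snd (X xi) = 0) by (rewrite E; auto). destruct Zero as [Z1 Z2].
  pose proof (H1 a xi ltac:(lra) ltac:(lra) ltac:(lra) ltac:(lra)) as A1.
  pose proof (H2 a xi ltac:(lra) ltac:(lra) ltac:(lra) ltac:(lra)) as A2.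
  pose proof (H1 xi c ltac:(lra) ltac:(lra) ltac:(lra) ltac:(lra)) as C1.
  pose proof (H2 xi c ltac:(lra) ltac:(lra) ltac:(lra) ltac:(lra)) as C2.
  rewrite Z1, Rmult_0_l, Rminus_0_r, Rminus_0_l, Rabs_Ropp in A1.
  rewrite Z2, Rmult_0_l, Rminus_0_r, Rminus_0_l, Rabs_Ropp in A2.
  rewrite Z1, Rmult_0_l, !Rminus_0_r in C1. rewrite Z2, Rmult_0_l, !Rminus_0_r in C2.
  pose proof (Rabs_le_both _ _ (Hor a (xi - a) ltac:(lra) ltac:(lra) A1 A2)).
  pose proof (Rabs_le_both _ _ (Hor c (c - xi) ltac:(lra) ltac:(lra) C1 C2)).
  pose proof (value_rest_origin a c Ha ltac:(lra)). rewrite Ef. lra.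
Qed.

Lemma action_lower_bound (y : pt) (t : R) (x : pt) (X : R -> pt) (I : R) : 0 <= t -> inJ N e y ->
  adm_curve N e 0 y t x X -> action N e L X 0 t I -> W t x <= u0 y + I.
Proof.
  intros Ht Hy (A1 & A2 & HX & E0 & Et & _) (f & HI & Hae).
  assert (W t (X t) - W 0 (X 0) <= I).
  - apply HK_lower_bound with (F := fun s => W s (X s)) (f := f) (s := 0) (t := t); auto.
    + now apply abs_cont_value_along.
    + destruct Hae as (Z & HZ & Hae).
      (* Besides the given null set, isolated visits to the vertex are discarded. A visit with p <>
         0 is isolated by [derivable_isolated], so only p = 0 remains at the vertex. *)
      exists (fun z => Z z \/ (0 <= z /\ X z = origin /\
         exists r, 0 < r /\ forall s, X s = origin -> Rabs (s - z) < r -> s = z)).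
      split; [apply null_set_union; auto; apply null_set_isolated|].
      intros xi Hxi Hn. destruct (Hae xi Hxi) as (V & HV & Hcost); [tauto|].
      destruct Hcost as [(i & r & Hi & Hr & E & p & -> & Ef)|(E & i & p & Hi & Hp & -> & Ef)].
      * now apply straddle_value_branch with i r p.
      * assert (p = 0) as ->.
        { apply NNPP; intro Hp0. apply Hn; right. split; [lra|]. split; [auto|].
          assert (Hne : fst (scal p (e i)) <> 0 \/ snd (scal p (e i)) <> 0).
          { apply NNPP; intro Hc. apply Hp0. rewrite <- (enorm_scal N e HJ i p Hi Hp).
            unfold enorm. assert (fst (scal p (e i)) = 0) as -> by tauto.
            assert (snd (scal p (e i)) = 0) as -> by tauto. rewrite Rmult_0_l, Rplus_0_l. apply sqrt_0. }
          destruct HV as [V1 V2]. destruct Hne as [Hne|Hne].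
          - destruct (derivable_isolated _ _ _ V1 Hne) as (r & Hr & Hr'). exists r; split; auto.
            intros s Hs Hsx; apply Hr'; auto. now rewrite Hs, E.
          - destruct (derivable_isolated _ _ _ V2 Hne) as (r & Hr & Hr'). exists r; split; auto.
            intros s Hs Hsx; apply Hr'; auto. now rewrite Hs, E. }
        rewrite scal_zero in HV. now apply straddle_value_origin.
  - rewrite Et, E0, (value_zero N e L u0 K C HJ HB y Hy) in H. lra.
Qed.

Lemma uoc_eq_value (t : R) (x : pt) : 0 <= t -> inJ N e x -> uoc N e L u0 t x = Fin (W t x).
Proof.
  intros Ht Hx.
  destruct (Req_dec t 0) as [->|Hne].
  - assert (H := epsilon_spec (inhabits PInf) (fun v =>
    (0 < 0 /\ v = ERInf (fun w => exists y X I, inJ N e y /\ adm_curve N e 0 y 0 x X /\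
                                   action N e L X 0 0 I /\ w = Fin (u0 y + I))) \/
    (~ (0 < 0) /\ v = Fin (u0 x)))).
    unfold uoc. destruct H as [[H _]|[_ ->]]; [|lra|].
    + exists (Fin (u0 x)); right; split; auto; lra.
    + now rewrite (value_zero N e L u0 K C HJ HB).
  - assert (H := epsilon_spec (inhabits PInf) (fun v =>
    (0 < t /\ v = ERInf (fun w => exists y X I, inJ N e y /\ adm_curve N e 0 y t x X /\
                                   action N e L X 0 t I /\ w = Fin (u0 y + I))) \/
    (~ (0 < t) /\ v = Fin (u0 x)))).
    unfold uoc. destruct H as [[_ ->]|[H _]]; [|  |lra].
    + eexists; left; split; [lra|reflexivity].
    + apply ERInf_eq; split.
      * intros v (y & X & I & Hy & HX & HI & ->); simpl. now apply (action_lower_bound y t x X I).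
      * intros m' Hm'.
        assert (Hc : forall c, reach t x c -> ERle m' (Fin c)).
        { intros c Hc. destruct (plan_curve_action t x c Hc) as (y & X & I & Hy & HX & HI & Hle).
          apply ERle_trans with (Fin (u0 y + I)); [|exact Hle]. apply Hm'. exists y, X, I; auto. }
        destruct (value_approx N e L u0 K C HJ HB t x 1 Ht Hx ltac:(lra)) as (c0 & Hc0 & _).
        destruct m' as [m| |]; simpl; auto.
        -- apply (value_spec N e L u0 K C HJ HB); auto.
        -- exact (Hc c0 Hc0).
Qed.

Lemma Dact_pos (y : pt) (t : R) (x : pt) : 0 < t ->
  Dact N e L 0 y t x = ERInf (fun w => exists X I, adm_curve N e 0 y t x X /\
                                   action N e L X 0 t I /\ w = Fin I).
Proof.
  intro Ht. unfold Dact.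
  match goal with |- epsilon ?i ?P = _ => assert (H := epsilon_spec i P) end.
  destruct H as [[_ H]|[(H & _)|(H & _)]]; auto; [|lra|lra].
  eexists; left; split; [auto|reflexivity].
Qed.

Lemma hopf_lax (t : R) (x : pt) : 0 < t -> inJ N e x ->
  ERInf (fun w => exists y, inJ N e y /\ w = ERplusR (u0 y) (Dact N e L 0 y t x)) = Fin (W t x).
Proof.
  intros Ht Hx. apply ERInf_eq; split.
  - intros v (y & Hy & ->). rewrite Dact_pos by auto.
    match goal with |- context [ERInf ?S] => destruct (ERInf_spec S) as [_ H]; specialize (H (Fin (W t x - u0 y))); set (D := ERInf S) in * end.
    assert (ERle (Fin (W t x - u0 y)) D).
    { apply H. intros v (X & I & HX & HI & ->); simpl.
      pose proof (action_lower_bound y t x X I ltac:(lra) Hy HX HI). lra. }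
    destruct D; simpl in *; auto; lra.
  - intros m' Hm'.
    assert (Hc : forall c, reach t x c -> ERle m' (Fin c)).
    { intros c Hc. destruct (plan_curve_action t x c Hc) as (y & X & I & Hy & HX & HI & Hle).
      apply ERle_trans with (Fin (u0 y + I)); [|exact Hle].
      eapply ERle_trans; [apply Hm'; exists y; split; [auto|reflexivity]|].
      rewrite Dact_pos by auto.
      match goal with |- context [ERInf ?S] => destruct (ERInf_spec S) as [H _]; specialize (H (Fin I)); set (D := ERInf S) in * end.
      assert (ERle D (Fin I)) by (apply H; exists X, I; auto).
      destruct D; simpl in *; auto; lra. }
    destruct (value_approx N e L u0 K C HJ HB t x 1 ltac:(lra) Hx ltac:(lra)) as (c0 & Hc0 & _).
    destruct m' as [m| |]; simpl; auto.
    + apply (value_spec N e L u0 K C HJ HB); auto; lra.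
    + exact (Hc c0 Hc0).
Qed.

End Representation.

(** * The value function is a viscosity solution *)

(** At the vertex [epsilon] may return any branch, so the lift has the expected values only if all g
    i 0 agree; [enorm] is the coordinate on the branch. *)
Definition lift (N : nat) (e : nat -> pt) (g : nat -> R -> R) (y : pt) : R :=
  g (epsilon (inhabits O) (fun i => (i < N)%nat /\ inJi e i y)) (enorm y).

Lemma lift_scal (N : nat) (e : nat -> pt) (g : nat -> R -> R) (i : nat) (r : R) :
  junction N e -> (forall i j, (i < N)%nat -> (j < N)%nat -> g i 0 = g j 0) ->
  (i < N)%nat -> 0 <= r -> lift N e g (scal r (e i)) = g i r.
Proof.
  intros HJ Hg Hi Hr. unfold lift. rewrite (enorm_scal N e HJ) by auto.
  assert (H := epsilon_spec (inhabits O) (fun j => (j < N)%nat /\ inJi e j (scal r (e i)))).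
  destruct H as [Hj (s & Hs & E)].
  { exists i; split; auto; exists r; auto. }
  set (j := epsilon _ _) in *.
  destruct (Req_dec r 0) as [->|Hr0]; [now apply Hg|].
  apply (scal_inj N e HJ) in E; auto; [|lra]. now destruct E as [<- _].
Qed.

(** * Semicontinuous envelopes of a continuous function *)

Section Envelopes.
Context (N : nat) (e : nat -> pt) (T : R) (u : R -> pt -> R).

Lemma ustar_of_continuous (t : R) (x : pt) : dom N e T t x -> dJ N e x x = 0 ->
  (forall eps, 0 < eps -> exists r, 0 < r /\ forall s y, dom N e T s y -> Rabs (s - t) < r ->
     dJ N e y x < r -> Rabs (u s y - u t x) < eps) ->
  ustar N e T u t x = Fin (u t x).
Proof.
  intros Hd H0 Hc. apply ERInf_eq; split.
  - intros v (r & Hr & ->).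
    match goal with |- context [ERSup ?S] => destruct (ERSup_spec S) as [H _] end.
    apply H. exists t, x. rewrite Rminus_diag, Rabs_R0, H0. auto.
  - intros m' Hm'.
    assert (Hle : forall eps, 0 < eps -> ERle m' (Fin (u t x + eps))).
    { intros eps He. destruct (Hc eps He) as (r & Hr & Hr').
      eapply ERle_trans; [apply Hm'; exists r; split; [auto|reflexivity]|].
      match goal with |- context [ERSup ?S] => destruct (ERSup_spec S) as [_ H] end.
      apply H. intros v (s & y & H1 & H2 & H3 & ->); simpl.
      specialize (Hr' s y H1 H2 H3). apply Rabs_def2 in Hr'; lra. }
    destruct m' as [m| |]; simpl; auto.
    + apply le_epsilon. intros eps He. exact (Hle eps He).
    + exact (Hle 1 Rlt_0_1).
Qed.

Lemma lstar_of_continuous (t : R) (x : pt) : dom N e T t x -> dJ N e x x = 0 ->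
  (forall eps, 0 < eps -> exists r, 0 < r /\ forall s y, dom N e T s y -> Rabs (s - t) < r ->
     dJ N e y x < r -> Rabs (u s y - u t x) < eps) ->
  lstar N e T u t x = Fin (u t x).
Proof.
  intros Hd H0 Hc. apply ERSup_eq; split.
  - intros v (r & Hr & ->).
    match goal with |- context [ERInf ?S] => destruct (ERInf_spec S) as [H _] end.
    apply H. exists t, x. rewrite Rminus_diag, Rabs_R0, H0. auto.
  - intros m' Hm'.
    assert (Hle : forall eps, 0 < eps -> ERle (Fin (u t x - eps)) m').
    { intros eps He. destruct (Hc eps He) as (r & Hr & Hr').
      eapply ERle_trans; [|apply Hm'; exists r; split; [auto|reflexivity]].
      match goal with |- context [ERInf ?S] => destruct (ERInf_spec S) as [_ H] end.
      apply H. intros v (s & y & H1 & H2 & H3 & ->); simpl.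
      specialize (Hr' s y H1 H2 H3). apply Rabs_def2 in Hr'; lra. }
    destruct m' as [m| |]; simpl; auto.
    + apply le_epsilon. intros eps He. specialize (Hle eps He); simpl in Hle; lra.
    + exact (Hle 1 Rlt_0_1).
Qed.

End Envelopes.

(** Going backwards in time with velocity q stays in the branch when q <= 0 or r > 0. At r = 0 only
    q <= 0 remains, which is where H_i^- comes from. *)
Lemma small_step (q r d : R) : 0 < d -> 0 <= r -> (q <= 0 \/ 0 < r) ->
  exists h, 0 < h < d /\ Rabs q * h < d /\ 0 <= r - q * h.
Proof.
  intros Hd Hr H. pose proof (Rabs_pos q) as Hq. pose proof (Rle_abs q) as Hq'.
  assert (Hgen : forall d', 0 < d' -> 0 < d' / (2 * (1 + Rabs q)) < d' /\ Rabs q * (d' / (2 * (1 + Rabs q))) < d').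
  { intros d' Hd'. set (z := d' / (2 * (1 + Rabs q))).
    assert (Hz : 2 * (1 + Rabs q) * z = d') by (unfold z; field; lra).
    assert (0 < z) by (apply Rdiv_lt_0_compat; lra).
    assert (0 <= Rabs q * z) by (apply Rmult_le_pos; lra). lra. }
  destruct H as [H|H].
  - exists (d / (2 * (1 + Rabs q))). destruct (Hgen d Hd) as [H1 H2]. repeat split; try lra.
    assert (0 <= - q * (d / (2 * (1 + Rabs q)))) by (apply Rmult_le_pos; lra). lra.
  - assert (Hm : 0 < Rmin d r) by now apply Rmin_glb_lt.
    Rmin_bounds.
    exists (Rmin d r / (2 * (1 + Rabs q))). destruct (Hgen _ Hm) as [G1 G2]. repeat split; try lra.
    set (z := Rmin d r / (2 * (1 + Rabs q))) in *.
    assert (q * z <= Rabs q * z) by (apply Rmult_le_compat_r; lra). lra.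
Qed.

(** phi(t, 0) is the same function of t on all branches. This reconciles the time derivative on
    branch 0, used in the vertex condition, with those on the others. *)
Lemma C1_vertex_time_derivative (N : nat) (e : nat -> pt) (T : R) (phi : R -> pt -> R)
  (Dt Dx : nat -> R -> R -> R) (t : R) (i j : nat) :
  C1star N e T phi Dt Dx -> (i < N)%nat -> (j < N)%nat -> 0 < t < T -> Dt i t 0 = Dt j t 0.
Proof.
  intros H Hi Hj Ht. apply cond_eq. intros eps He.
  destruct (proj1 (H i Hi) t 0 Ht ltac:(lra) (eps / 4) ltac:(lra)) as (d1 & Hd1 & H1).
  destruct (proj1 (H j Hj) t 0 Ht ltac:(lra) (eps / 4) ltac:(lra)) as (d2 & Hd2 & H2).
  set (m := Rmin (Rmin d1 d2) (T - t)).
  assert (Hm : 0 < m) by (repeat apply Rmin_glb_lt; lra).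
  assert (m <= d1 /\ m <= d2 /\ m <= T - t) as (M1 & M2 & M3).
  { unfold m. Rmin_bounds. lra. }
  specialize (H1 (t + m / 2) 0 ltac:(lra) ltac:(lra)). specialize (H2 (t + m / 2) 0 ltac:(lra) ltac:(lra)).
  replace (t + m / 2 - t) with (m / 2) in H1, H2 by ring.
  rewrite Rminus_diag, Rabs_R0, (Rabs_pos_eq (m / 2)) in H1 by lra.
  rewrite Rminus_diag, Rabs_R0, (Rabs_pos_eq (m / 2)) in H2 by lra.
  rewrite !scal_zero in H1, H2.
  specialize (H1 ltac:(lra) ltac:(lra)). specialize (H2 ltac:(lra) ltac:(lra)).
  apply Rabs_le_both in H1, H2.
  set (w := phi (t + m / 2) origin - phi t origin) in *.
  assert (0 < eps * m) by (apply Rmult_lt_0_compat; lra).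
  apply Rabs_def1; apply Rmult_lt_reg_l with (m / 2); try lra.
Qed.

Section Viscosity.
Context (N : nat) (e : nat -> pt) (L : nat -> R -> R) (gamma : R) (u0 : pt -> R) (K C T : R).
Context (HJ : junction N e) (HA1 : hypA1 N L gamma) (HB : plan_bounds N e L u0 K C).

Local Notation reach := (reach N e L u0).
Local Notation W := (value N e L u0).
Local Notation d := (dJ N e).

Lemma Hvertex_le (p : nat -> R) (c : R) :
  (forall i, (i < N)%nat -> Hminus (L i) (p i) <= c) -> Hvertex N L p <= c.
Proof. intro H. apply maxUpTo_lub. intros i Hi. apply H. pose proof (branch0 N e HJ); lia. Qed.

Lemma Hvertex_ge (p : nat -> R) (i : nat) : (i < N)%nat -> Hminus (L i) (p i) <= Hvertex N L p.
Proof. intro Hi. apply (maxUpTo_ge (fun i => Hminus (L i) (p i))). lia. Qed.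

Lemma value_continuous (t : R) (x : pt) (eps : R) : 0 <= t -> inJ N e x -> 0 < eps ->
  exists r, 0 < r /\ forall s y, 0 <= s -> inJ N e y -> Rabs (s - t) < r -> d y x < r ->
    Rabs (W s y - W t x) < eps.
Proof.
  intros Ht Hx He. pose proof HB as (HK & HC & _). set (M := 2 * C + K + 1).
  assert (HM : 0 < M) by (unfold M; lra).
  exists (eps / (2 * M)); split; [apply Rdiv_lt_0_compat; lra|]. intros s y Hs Hy H1 H2.
  eapply Rle_lt_trans; [apply (value_lipschitz N e L u0 K C HJ HB); auto|].
  pose proof (Rabs_pos (s - t)). pose proof (dJ_nonneg N e y x).
  apply Rle_lt_trans with (M * (Rabs (s - t) + d y x)).
  - apply Rmult_le_compat_r; unfold M; lra.
  - replace eps with (M * (eps / (2 * M) + eps / (2 * M))) by (field; lra).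
    apply Rmult_lt_compat_l; lra.
Qed.

(** Compare the contact point with the point from which velocity q reaches it in time h, then divide
    by h. Taking the supremum over the allowed q gives H_i inside a branch and H_i^- at the
    vertex. *)
Lemma value_test_above (phi : R -> pt -> R) (Dt Dx : nat -> R -> R -> R) (t r q : R) (i : nat) :
  C1star N e T phi Dt Dx -> 0 < t < T -> (i < N)%nat -> 0 <= r -> (q <= 0 \/ 0 < r) ->
  touch_above N e T W phi t (scal r (e i)) -> Dt i t r + q * Dx i t r <= L i q.
Proof.
  intros HC1 Ht Hi Hr Hq [E (rad & Hrad & Htouch)].
  apply le_epsilon. intros eps0 He0.
  set (eps := eps0 / (1 + Rabs q)). pose proof (Rabs_pos q).
  assert (He : 0 < eps) by (apply Rdiv_lt_0_compat; lra).
  destruct (proj1 (HC1 i Hi) t r Ht Hr eps He) as (d1 & Hd1 & H1).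
  destruct (small_step q r (Rmin (Rmin rad d1) t)) as (h & Hh & Hqh & Hrh); auto.
  { repeat apply Rmin_glb_lt; lra. }
  Rmin_bounds.
  assert (A1 : Rabs (t - h - t) = h) by (rewrite Rabs_left1; lra).
  assert (A2 : Rabs (r - q * h - r) = Rabs q * h).
  { replace (r - q * h - r) with (- (q * h)) by ring. rewrite Rabs_Ropp, Rabs_mult, (Rabs_pos_eq h); lra. }
  specialize (H1 (t - h) (r - q * h) ltac:(lra) Hrh ltac:(lra) ltac:(lra)).
  specialize (Htouch (t - h) (scal (r - q * h) (e i)) ltac:(lra) (inJ_scal N e i _ Hi Hrh) ltac:(lra)).
  rewrite (dJ_same N e HJ) in Htouch by auto. specialize (Htouch ltac:(lra)).
  pose proof (value_dpp' N e L u0 K C HJ HB (t - h) t i (r - q * h) r q ltac:(lra) ltac:(lra) Hi Hrh Hr ltac:(ring)) as Hd.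
  replace (t - (t - h)) with h in Hd by ring.
  rewrite A1, A2 in H1. apply Rabs_le_both in H1.
  replace (t - h - t) with (- h) in H1 by ring. replace (r - q * h - r) with (- (q * h)) in H1 by ring.
  assert (eps * (h + Rabs q * h) = h * eps0) by (unfold eps; field; lra).
  apply Rmult_le_reg_l with h; [lra|]. lra.
Qed.

Lemma touch_above_ext (g : R -> pt -> R) (phi : R -> pt -> R) (t : R) (x : pt) :
  (forall s y, dom N e T s y -> g s y = W s y) -> 0 < t < T -> inJ N e x ->
  touch_above N e T g phi t x -> touch_above N e T W phi t x.
Proof.
  intros Hg Ht Hx [E (r & Hr & H)]; split; [rewrite <- Hg; auto; split; auto; lra|].
  exists r; split; auto. intros s y Hs Hy H1 H2. rewrite <- Hg; auto. split; auto; lra.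
Qed.

Lemma touch_below_ext (g : R -> pt -> R) (phi : R -> pt -> R) (t : R) (x : pt) :
  (forall s y, dom N e T s y -> g s y = W s y) -> 0 < t < T -> inJ N e x ->
  touch_below N e T g phi t x -> touch_below N e T W phi t x.
Proof.
  intros Hg Ht Hx [E (r & Hr & H)]; split; [rewrite <- Hg; auto; split; auto; lra|].
  exists r; split; auto. intros s y Hs Hy H1 H2. rewrite <- Hg; auto. split; auto; lra.
Qed.

Lemma value_subsolution (g : R -> pt -> R) : 0 < T ->
  (forall t x, dom N e T t x -> g t x = W t x) -> subsolution N e L u0 T g.
Proof.
  intros HT Hg. split; [|split].
  - intros t x [Ht Hx] eps He.
    destruct (value_continuous t x eps ltac:(lra) Hx He) as (r & Hr & H). exists r; split; auto.
    intros s y Hsy H1 H2. rewrite !Hg by (auto; split; auto). destruct Hsy as [Hs Hy].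
    specialize (H s y ltac:(lra) Hy H1 H2). apply Rabs_def2 in H; lra.
  - intros phi Dt Dx t x HC1 Ht Hx Htouch. apply touch_above_ext in Htouch; auto. split.
    + intros i r Hi Hr ->.
      assert (Hfun (L i) (Dx i t r) <= - Dt i t r); [|lra].
      apply (Hfun_lub N L gamma HA1 i); auto. intro q.
      pose proof (value_test_above phi Dt Dx t r q i HC1 Ht Hi ltac:(lra) (or_intror Hr) Htouch). lra.
    + intros ->.
      assert (Hvertex N L (fun i => Dx i t 0) <= - Dt O t 0); [|lra].
      apply Hvertex_le. intros i Hi. apply (Hminus_lub N L gamma HA1 i); auto. intros q Hq.
      rewrite <- (scal_zero (e i)) in Htouch.
      pose proof (value_test_above phi Dt Dx t 0 q i HC1 Ht Hi ltac:(lra) (or_introl Hq) Htouch).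
      rewrite (C1_vertex_time_derivative N e T phi Dt Dx t O i); auto; [lra|apply (branch0 N e HJ)].
  - intros x Hx. rewrite Hg, (value_zero N e L u0 K C HJ HB) by (auto; split; auto; lra). lra.
Qed.

Lemma dJ_branch_lipschitz (i : nat) (r s : R) (x : pt) : (i < N)%nat -> 0 <= r -> 0 <= s -> inJ N e x ->
  Rabs (d (scal r (e i)) x - d (scal s (e i)) x) <= Rabs (r - s).
Proof.
  intros Hi Hr Hs Hx. apply inJ_elim in Hx. destruct Hx as (k & z & Hk & Hz & ->).
  destruct (Nat.eq_dec i k) as [<-|Hne].
  - rewrite !(dJ_same N e HJ) by auto.
    replace (r - s) with ((r - z) - (s - z)) by ring. apply Rabs_triang_inv2.
  - rewrite !(dJ_diff N e HJ) by auto. right; f_equal; ring.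
Qed.

Lemma segment_nonneg (r1 r2 q t h s : R) : 0 <= r1 -> 0 <= r2 -> 0 < h -> r2 - r1 = q * h ->
  t <= s <= t + h -> 0 <= r1 + q * (s - t).
Proof.
  intros H1 H2 Hh E Hs. apply Rmult_le_reg_l with h; auto. rewrite Rmult_0_r.
  replace (h * (r1 + q * (s - t))) with ((t + h - s) * r1 + (s - t) * (r1 + q * h)) by ring.
  replace (r1 + q * h) with r2 by lra. apply Rplus_le_le_0_compat; apply Rmult_le_pos; lra.
Qed.

(* The maximum of the value function and of a bumped barrier is still below the cost of
   every plan, because it satisfies the same inequality along segments; since the bump
   raises it at the contact point, contact is impossible. *)
Lemma barrier_strict (t : R) (x : pt) (rad eps : R) (Phi : R -> pt -> R) :
  inJ N e x -> 0 < rad <= t -> 0 < eps ->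
  (forall s y, t - rad < s <= t -> inJ N e y -> d y x < rad ->
     Phi s y + eps * ((t - s) + d y x) <= W s y) ->
  (forall i r1 r2 s1 s2 q, (i < N)%nat -> 0 <= r1 -> 0 <= r2 -> t - rad < s1 -> s1 < s2 <= t ->
     d (scal r1 (e i)) x < rad -> d (scal r2 (e i)) x < rad -> r2 - r1 = q * (s2 - s1) ->
     Phi s2 (scal r2 (e i)) <= Phi s1 (scal r1 (e i)) + (s2 - s1) * L i q) ->
  Phi t x < W t x.
Proof.
  intros Hx Hrad He Hbelow Hsub.
  (* With this height the bump is inactive as soon as (t - s) + d > rad/2, so G agrees with W well
     before the boundary of the region. *)
  set (del := eps * rad / 2).
  assert (Hdel : 0 < del) by (apply Rdiv_lt_0_compat; [apply Rmult_lt_0_compat|]; lra).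
  set (G := fun s y => if Rlt_dec ((t - s) + d y x) rad then Rmax (W s y) (Phi s y + del) else W s y).
  assert (GW : forall s y, W s y <= G s y).
  { intros s y; unfold G; destruct (Rlt_dec _ _); [apply Rmax_l|lra]. }
  assert (Gin : forall s y, (t - s) + d y x < rad -> G s y = Rmax (W s y) (Phi s y + del)).
  { intros s y H; unfold G; destruct (Rlt_dec _ _); [auto|tauto]. }
  assert (Gout : forall s y, s <= t -> inJ N e y -> rad / 2 < (t - s) + d y x -> G s y = W s y).
  { intros s y Hs Hy H; unfold G; destruct (Rlt_dec _ _); auto. apply Rmax_left.
    pose proof (dJ_nonneg N e y x).
    specialize (Hbelow s y ltac:(lra) Hy ltac:(lra)).
    assert (eps * (rad / 2) <= eps * (t - s + d y x)) by (apply Rmult_le_compat_l; lra).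
    unfold del; lra. }
  assert (Hseg : forall i r1 r2 s h q, (i < N)%nat -> 0 <= r1 -> 0 <= r2 -> 0 < h -> 0 <= s -> s + h <= t ->
     r2 - r1 = q * h -> G (s + h) (scal r2 (e i)) <= G s (scal r1 (e i)) + h * L i q).
  { intros i r1 r2 s h q Hi H1 H2 Hh Hs Hsh Hq.
    set (y := fun z => scal (r1 + q * (z - s)) (e i)).
    assert (Hy0 : forall z, s <= z <= s + h -> 0 <= r1 + q * (z - s)).
    { intros z Hz; apply (segment_nonneg r1 r2 q s h z); auto. }
    assert (Hy : forall z, s <= z <= s + h -> inJ N e (y z)).
    { intros z Hz; apply (inJ_scal N e); auto. }
    (* A long segment may leave the region and enter it again, so the inequality for G is proved
       near each time only and then globalized. *)
    assert (Hloc := local_nonincreasing (fun z => G z (y z) - (z - s) * L i q) s (s + h) ltac:(lra)).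
    assert (Hend : G (s + h) (y (s + h)) - (s + h - s) * L i q <= G s (y s) - (s - s) * L i q).
    { apply Hloc. intros z Hz.
      set (m := fun z => (t - z) + d (y z) x).
      assert (Hm : forall z', s <= z' <= s + h -> Rabs (m z' - m z) <= (1 + Rabs q) * Rabs (z' - z)).
      { intros z' Hz'. unfold m.
        replace (t - z' + d (y z') x - (t - z + d (y z) x)) with ((z - z') + (d (y z') x - d (y z) x)) by ring.
        eapply Rle_trans; [apply Rabs_triang|]. rewrite (Rabs_minus_sym z).
        assert (Rabs (d (y z') x - d (y z) x) <= Rabs q * Rabs (z' - z)); [|lra].
        eapply Rle_trans; [apply dJ_branch_lipschitz; auto|].
        rewrite <- Rabs_mult. right; f_equal; ring. }
      pose proof (Rabs_pos q) as Hqp.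
      assert (HWle : forall z1 z2, s <= z1 -> z1 < z2 -> z2 <= s + h -> W z2 (y z2) <= W z1 (y z1) + (z2 - z1) * L i q).
      { intros z1 z2 A1 A2 A3. apply (value_dpp' N e L u0 K C HJ HB); auto; try lra.
        - apply Hy0; lra.
        - apply Hy0; lra. }
      assert (Hcl : exists d0, 0 < d0 /\ forall z1 z2, s <= z1 -> z1 < z2 -> z2 <= s + h ->
         Rabs (z1 - z) < d0 -> Rabs (z2 - z) < d0 -> G z2 (y z2) <= G z1 (y z1) + (z2 - z1) * L i q).
      (* Where m < rad, G is a maximum of two functions with the inequality; where m > rad/2, G is
         W. The two open regimes overlap. *)
      { destruct (Rlt_dec (m z) rad) as [Hin|Hout].
        - exists ((rad - m z) / (1 + Rabs q)); split; [apply Rdiv_lt_0_compat; lra|].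
          intros z1 z2 A1 A2 A3 B1 B2.
          assert (Hmz : forall z', s <= z' <= s + h -> Rabs (z' - z) < (rad - m z) / (1 + Rabs q) -> m z' < rad).
          { intros z' Hz' Hzz. pose proof (Rabs_le_both _ _ (Hm z' Hz')).
            assert ((1 + Rabs q) * Rabs (z' - z) < rad - m z); [|lra].
            replace (rad - m z) with ((1 + Rabs q) * ((rad - m z) / (1 + Rabs q))) by (field; lra).
            apply Rmult_lt_compat_l; lra. }
          pose proof (Hmz z1 ltac:(lra) B1) as M1. pose proof (Hmz z2 ltac:(lra) B2) as M2.
          unfold m in M1, M2. rewrite !Gin by auto.
          pose proof (HWle z1 z2 A1 A2 A3) as HW1.
          pose proof (dJ_nonneg N e (y z1) x). pose proof (dJ_nonneg N e (y z2) x).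
          assert (HP : Phi z2 (y z2) <= Phi z1 (y z1) + (z2 - z1) * L i q).
          { refine (Hsub i _ _ z1 z2 q Hi (Hy0 z1 _) (Hy0 z2 _) _ _ _ _ _); try lra.
            - change (d (y z1) x < rad); lra.
            - change (d (y z2) x < rad); lra. }
          pose proof (Rmax_l (W z1 (y z1)) (Phi z1 (y z1) + del)).
          pose proof (Rmax_r (W z1 (y z1)) (Phi z1 (y z1) + del)).
          apply Rmax_lub; lra.
        - exists (rad / 2 / (1 + Rabs q)); split; [apply Rdiv_lt_0_compat; lra|].
          intros z1 z2 A1 A2 A3 B1 B2.
          assert (Hmz : forall z', s <= z' <= s + h -> Rabs (z' - z) < rad / 2 / (1 + Rabs q) -> rad / 2 < m z').
          { intros z' Hz' Hzz. pose proof (Rabs_le_both _ _ (Hm z' Hz')).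
            assert ((1 + Rabs q) * Rabs (z' - z) < rad / 2); [|lra].
            replace (rad / 2) with ((1 + Rabs q) * (rad / 2 / (1 + Rabs q))) by (field; lra).
            apply Rmult_lt_compat_l; lra. }
          pose proof (Hmz z1 ltac:(lra) B1) as M1. pose proof (Hmz z2 ltac:(lra) B2) as M2.
          unfold m in M1, M2. rewrite !Gout; try lra; try (apply Hy; lra).
          apply HWle; auto. }
      destruct Hcl as (d0 & Hd0 & Hcl). exists d0; split; auto. intros z' Hz' Hzz.
      assert (R0 : Rabs (z - z) < d0) by (rewrite Rminus_diag, Rabs_R0; auto).
      split; intro Hle; (destruct (Req_dec z z') as [<-|Hne]; [lra|]).
      - specialize (Hcl z z' ltac:(lra) ltac:(lra) ltac:(lra) R0 Hzz). lra.
      - specialize (Hcl z' z ltac:(lra) ltac:(lra) ltac:(lra) Hzz R0). lra. }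
    unfold y in Hend. rewrite Rminus_diag, Rmult_0_r, Rplus_0_r in Hend.
    replace (s + h - s) with h in Hend by ring. replace (r1 + q * h) with r2 in Hend by lra. lra. }
  assert (Hplan : forall s y c, reach s y c -> s <= t -> G s y <= c).
  { intros s y c H; induction H as [y Hy|s c i r1 r2 h Hi H1 H2 Hh H IH]; intro Hs.
    (* At time 0 the bump is off because rad <= t. *)
    - pose proof (dJ_nonneg N e y x). rewrite Gout by (auto; lra).
      rewrite (value_zero N e L u0 K C HJ HB) by auto; lra.
    - destruct (reach_dom N e L u0 _ _ _ H) as [Hs0 _].
      pose proof (Hseg i r1 r2 s h ((r2 - r1) / h) Hi H1 H2 Hh Hs0 Hs ltac:(field; lra)).
      specialize (IH ltac:(lra)). lra. }
  assert (HG : G t x <= W t x).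
  { apply (value_spec N e L u0 K C HJ HB); auto; [lra|]. intros c Hc. apply (Hplan t x c); auto; lra. }
  rewrite Gin in HG by (rewrite (dJ_refl N e HJ) by auto; lra).
  pose proof (Rmax_r (W t x) (Phi t x + del)). lra.
Qed.

(** The margin eta is traded for a term eps (1 + |q|): a convex combination, with small weight
    [lam], of the hypothesis and of the superlinear bound, the latter supplying the growth in
    |q|. *)
Lemma strict_margin (i : nat) (A p eta : R) : (i < N)%nat -> 0 < eta ->
  (forall q, A + p * q <= L i q - eta) ->
  exists eps0, 0 < eps0 /\ forall eps, 0 < eps -> eps <= eps0 -> forall q, A + eps + p * q + eps * Rabs q <= L i q.
Proof.
  intros Hi Heta H.
  destruct (L_superlinear N L gamma HA1 (Rabs p + 1)) as (C1 & HC1 & HL).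
  set (D := Rabs A + eta + C1). pose proof (Rabs_pos A).
  assert (HD : 0 < D) by (unfold D; lra).
  set (lam := Rmin 1 (eta / (2 * D))).
  assert (Hlam : 0 < lam) by (apply Rmin_glb_lt; [lra|apply Rdiv_lt_0_compat; lra]).
  assert (Hl1 : lam <= 1) by apply Rmin_l.
  assert (Hl2 : lam * D <= eta / 2).
  { apply Rle_trans with (eta / (2 * D) * D); [apply Rmult_le_compat_r; [lra|apply Rmin_r]|right; field; lra]. }
  exists (Rmin lam (eta / 2)); split; [apply Rmin_glb_lt; lra|]. intros eps He He' q.
  Rmin_bounds.
  specialize (H q). specialize (HL i Hi q).
  assert (A1 : (1 - lam) * (A + p * q) <= (1 - lam) * (L i q - eta)) by (apply Rmult_le_compat_l; lra).
  assert (A2 : lam * ((Rabs p + 1) * Rabs q - C1) <= lam * L i q) by (apply Rmult_le_compat_l; lra).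
  assert (A3 : lam * (p * q) <= lam * (Rabs p * Rabs q)).
  { apply Rmult_le_compat_l; [lra|]. rewrite <- Rabs_mult. apply Rle_abs. }
  assert (A4 : lam * A <= lam * Rabs A) by (apply Rmult_le_compat_l; [lra|apply Rle_abs]).
  assert (A5 : eps * Rabs q <= lam * Rabs q) by (apply Rmult_le_compat_r; [apply Rabs_pos|lra]).
  unfold D in Hl2. lra.
Qed.

Lemma value_super_interior (phi : R -> pt -> R) (Dt Dx : nat -> R -> R -> R) (t r : R) (i : nat) :
  C1star N e T phi Dt Dx -> 0 < t < T -> (i < N)%nat -> 0 < r ->
  touch_below N e T W phi t (scal r (e i)) -> Dt i t r + Hfun (L i) (Dx i t r) >= 0.
Proof.
  intros HC1 Ht Hi Hr [E (rad & Hrad & Htouch)].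
  apply Rnot_lt_ge; intro Hneg.
  set (A := Dt i t r) in *. set (p := Dx i t r) in *. set (eta := - (A + Hfun (L i) p)).
  destruct (strict_margin i A p eta Hi ltac:(unfold eta; lra)) as (eps & He & Hmarg).
  { intro q. pose proof (proj1 (Hfun_lub N L gamma HA1 i p Hi) q). unfold eta; lra. }
  specialize (Hmarg eps He (Rle_refl _)).
  destruct (proj1 (HC1 i Hi) t r Ht ltac:(lra) (eps / 2) ltac:(lra)) as (d1 & Hd1 & H1).
  fold A p in H1. set (x := scal r (e i)) in *.
  set (rho := fun y => ip y (e i)).
  assert (Hrho : forall z, rho (scal z (e i)) = z).
  { intro z. unfold rho. rewrite ip_scal_l, (ip_unit N e HJ) by auto; ring. }
  (* Before time t and away from x this falls below the first-order expansion of phi by eps times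
     the displacement; the expansion error takes half of it and leaves the eps/2 required by
     [barrier_strict]. *)
  set (Phi := fun s y => phi t x + (A + eps) * (s - t) + p * (rho y - r) - eps * Rabs (rho y - r)).
  set (m := Rmin (Rmin rad d1) (Rmin (t / 2) r)).
  assert (Hm : 0 < m) by (repeat apply Rmin_glb_lt; lra).
  assert (m <= rad /\ m <= d1 /\ m <= t / 2 /\ m <= r) as (M1 & M2 & M3 & M4).
  { unfold m. Rmin_bounds. lra. }
  assert (Hbr : forall j z, (j < N)%nat -> 0 <= z -> d (scal z (e j)) x < m -> j = i).
  { intros j z Hj Hz Hd. destruct (Nat.eq_dec j i) as [->|Hne]; auto.
    unfold x in Hd. rewrite (dJ_diff N e HJ) in Hd by (auto; lra). lra. }
  assert (Hx : inJ N e x) by (apply (inJ_scal N e); auto; lra).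
  assert (Hlt : Phi t x < W t x).
  { apply (barrier_strict t x m (eps / 2)); auto; try lra.
    - intros s y Hs Hy Hd. destruct (inJ_elim N e y Hy) as (j & z & Hj & Hz & ->).
      assert (j = i) as -> by eauto.
      unfold x in Hd |- *. rewrite (dJ_same N e HJ) in Hd by (auto; lra). rewrite (dJ_same N e HJ) by (auto; lra).
      assert (As : Rabs (s - t) = t - s) by (rewrite Rabs_left1; lra).
      specialize (Htouch s (scal z (e i)) ltac:(lra) Hy ltac:(lra)).
      unfold x in Htouch. rewrite (dJ_same N e HJ) in Htouch by (auto; lra). specialize (Htouch ltac:(lra)).
      specialize (H1 s z ltac:(lra) Hz ltac:(lra) ltac:(lra)). apply Rabs_le_both in H1.
      unfold Phi. rewrite Hrho. rewrite As in H1. fold x. lra.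
    - intros j r1 r2 s1 s2 q Hj Hr1 Hr2 Hs1 Hs2 D1 D2 Hq.
      assert (j = i) as -> by eauto.
      unfold Phi. rewrite !Hrho. specialize (Hmarg q).
      assert (Rabs (r1 - r) <= Rabs (r2 - r) + Rabs q * (s2 - s1)).
      { rewrite <- (Rabs_pos_eq (s2 - s1)) at 1 by lra. rewrite <- Rabs_mult, <- Hq.
        replace (r1 - r) with ((r2 - r) + - (r2 - r1)) by ring. eapply Rle_trans; [apply Rabs_triang|].
        rewrite Rabs_Ropp; lra. }
      assert (eps * Rabs (r1 - r) <= eps * (Rabs (r2 - r) + Rabs q * (s2 - s1))) by (apply Rmult_le_compat_l; lra).
      assert ((s2 - s1) * (A + eps + p * q + eps * Rabs q) <= (s2 - s1) * L i q) by (apply Rmult_le_compat_l; lra).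
      assert (p * (r2 - r1) = p * (q * (s2 - s1))) by (rewrite Hq; ring). lra. }
  unfold Phi, x in Hlt. rewrite Hrho in Hlt. fold x in Hlt. rewrite !Rminus_diag, Rabs_R0 in Hlt. lra.
Qed.

(* On a branch where the slope of the test function lies on the increasing part of H_i,
   it is lowered to the minimizer of H_i; afterwards H_i^- and H_i agree. *)
Lemma value_super_vertex (phi : R -> pt -> R) (Dt Dx : nat -> R -> R -> R) (t : R) :
  C1star N e T phi Dt Dx -> 0 < t < T ->
  touch_below N e T W phi t origin -> Dt O t 0 + Hvertex N L (fun i => Dx i t 0) >= 0.
Proof.
  intros HC1 Ht [E (rad & Hrad & Htouch)].
  apply Rnot_lt_ge; intro Hneg.
  set (A := Dt O t 0) in *. set (eta := - (A + Hvertex N L (fun i => Dx i t 0))).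
  assert (Hslope : forall i, exists sl, (i < N)%nat -> sl <= Dx i t 0 /\ forall q, A + sl * q <= L i q - eta).
  { intro i. destruct (Nat.lt_ge_cases i N) as [Hi|Hi]; [|exists 0; intro; lia].
    destruct (L_tangent_at_0 N L gamma HA1 i Hi) as [b Hb].
    pose proof (Hvertex_ge (fun i => Dx i t 0) i Hi) as HV. cbv beta in HV.
    pose proof (proj1 (Hminus_lub N L gamma HA1 i (Dx i t 0) Hi)) as Hm.
    (* b is a subgradient of L_i at 0, so H_i(b) = - L_i(0), which is at most H_i^- of any slope, as
       q = 0 is allowed there. *)
    exists (Rmin (Dx i t 0) b); intros _; split; [apply Rmin_l|]. intro q.
    assert (Rmin (Dx i t 0) b * q - L i q <= Hminus (L i) (Dx i t 0)); [|unfold eta; lra].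
    pose proof (Hm 0 ltac:(lra)) as Hm0. rewrite Rmult_0_r in Hm0. specialize (Hb q).
    unfold Rmin; destruct (Rle_dec (Dx i t 0) b); [|lra].
    destruct (Rle_dec q 0) as [Hq|Hq]; [now apply Hm|].
    assert (Dx i t 0 * q <= b * q) by (apply Rmult_le_compat_r; lra). lra. }
  destruct (choice _ Hslope) as [ps Hps].
  destruct (finite_pos_bound (fun i c => (i < N)%nat -> forall eps, 0 < eps -> eps <= c ->
     forall q, A + eps + ps i * q + eps * Rabs q <= L i q) N) as (eps & He & Hmarg).
  { intros i Hi. destruct (Hps i Hi) as [_ H].
    destruct (strict_margin i A (ps i) eta Hi ltac:(unfold eta; lra) H) as (c & Hc & Hc'); eauto. }
  { intros i c c' Hc Hle H Hi eps He He'. apply H; auto; lra. }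
  assert (Hm' : forall i, (i < N)%nat -> forall q, A + eps + ps i * q + eps * Rabs q <= L i q).
  { intros i Hi; apply Hmarg; auto; lra. }
  clear Hmarg.
  destruct (finite_pos_bound (fun i c => forall s z, 0 < s < T -> 0 <= z -> Rabs (s - t) < c -> z < c ->
     phi t origin + A * (s - t) + Dx i t 0 * z - eps / 2 * (Rabs (s - t) + z) <= phi s (scal z (e i))) N) as (d1 & Hd1 & H1).
  { intros i Hi. destruct (proj1 (HC1 i Hi) t 0 Ht ltac:(lra) (eps / 2) ltac:(lra)) as (c & Hc & H).
    exists c; split; auto. intros s z Hs Hz Hsc Hzc.
    assert (Az : Rabs (z - 0) = z) by (rewrite Rminus_0_r, Rabs_pos_eq; auto).
    specialize (H s z Hs Hz Hsc ltac:(lra)). rewrite Az, scal_zero in H. apply Rabs_le_both in H.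
    rewrite (C1_vertex_time_derivative N e T phi Dt Dx t i O HC1 Hi (branch0 N e HJ) Ht) in H. fold A in H. lra. }
  { intros i c c' Hc Hle H s z Hs Hz Hsc Hzc. apply H; auto; lra. }
  set (Phi := fun s y => phi t origin + (A + eps) * (s - t) + lift N e (fun k z => (ps k - eps) * z) y).
  assert (HPhi : forall i s z, (i < N)%nat -> 0 <= z ->
     Phi s (scal z (e i)) = phi t origin + (A + eps) * (s - t) + (ps i - eps) * z).
  { intros i s z Hi Hz. unfold Phi. rewrite lift_scal; auto. intros; ring. }
  set (m := Rmin (Rmin rad d1) (t / 2)).
  assert (Hm : 0 < m) by (repeat apply Rmin_glb_lt; lra).
  assert (m <= rad /\ m <= d1 /\ m <= t / 2) as (M1 & M2 & M3).
  { unfold m. Rmin_bounds. lra. }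
  assert (Hlt : Phi t origin < W t origin).
  { apply (barrier_strict t origin m (eps / 2)); auto; try lra.
    - apply (inJ_origin N e HJ).
    - intros s y Hs Hy Hd. destruct (inJ_elim N e y Hy) as (j & z & Hj & Hz & ->).
      rewrite (dJ_origin N e HJ) in Hd |- * by auto.
      assert (As : Rabs (s - t) = t - s) by (rewrite Rabs_left1; lra).
      specialize (Htouch s (scal z (e j)) ltac:(lra) Hy ltac:(lra)).
      rewrite (dJ_origin N e HJ) in Htouch by auto. specialize (Htouch ltac:(lra)).
      specialize (H1 j Hj s z ltac:(lra) Hz ltac:(lra) ltac:(lra)). rewrite As in H1.
      rewrite HPhi by auto. destruct (Hps j Hj) as [Hle _].
      assert (ps j * z <= Dx j t 0 * z) by (apply Rmult_le_compat_r; lra). lra.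
    - intros j r1 r2 s1 s2 q Hj Hr1 Hr2 Hs1 Hs2 D1 D2 Hq.
      rewrite !HPhi by auto. specialize (Hm' j Hj q). pose proof (Rabs_ge_opp q) as Hq'.
      assert (eps * - q <= eps * Rabs q) by (apply Rmult_le_compat_l; lra).
      assert ((s2 - s1) * (A + eps + ps j * q + eps * - q) <= (s2 - s1) * L j q) by (apply Rmult_le_compat_l; lra).
      assert ((ps j - eps) * (r2 - r1) = (ps j - eps) * (q * (s2 - s1))) by (rewrite Hq; ring). lra. }
  pose proof (branch0 N e HJ) as HN. rewrite <- (scal_zero (e O)), HPhi in Hlt; auto; [|lra].
  rewrite scal_zero, Rminus_diag in Hlt. lra.
Qed.

Lemma value_supersolution (g : R -> pt -> R) : 0 < T ->
  (forall t x, dom N e T t x -> g t x = W t x) -> supersolution N e L u0 T g.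
Proof.
  intros HT Hg. split; [|split].
  - intros t x [Ht Hx] eps He.
    destruct (value_continuous t x eps ltac:(lra) Hx He) as (r & Hr & H). exists r; split; auto.
    intros s y Hsy H1 H2. rewrite !Hg by (auto; split; auto). destruct Hsy as [Hs Hy].
    specialize (H s y ltac:(lra) Hy H1 H2). apply Rabs_def2 in H; lra.
  - intros phi Dt Dx t x HC1 Ht Hx Htouch. apply touch_below_ext in Htouch; auto. split.
    + intros i r Hi Hr ->. now apply value_super_interior with phi.
    + intros ->. now apply value_super_vertex with phi.
  - intros x Hx. rewrite Hg, (value_zero N e L u0 K C HJ HB) by (auto; split; auto; lra). lra.
Qed.

End Viscosity.

(** * Test functions *)

(** A global form of differentiability with Lipschitz gradient. The single constant makes sums and
    multiples immediate, with no choice of radii. *)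
Definition C11 (g gt gx : R -> R -> R) : Prop :=
  exists C, 0 <= C /\ forall t r t' r',
    Rabs (g t' r' - g t r - gt t r * (t' - t) - gx t r * (r' - r))
      <= C * ((Rabs (t' - t) + Rabs (r' - r)) * (Rabs (t' - t) + Rabs (r' - r))) /\
    Rabs (gt t' r' - gt t r) <= C * (Rabs (t' - t) + Rabs (r' - r)) /\
    Rabs (gx t' r' - gx t r) <= C * (Rabs (t' - t) + Rabs (r' - r)).

Lemma C11_C1_half (T : R) (g gt gx h : R -> R -> R) : C11 g gt gx ->
  (forall t r, 0 <= r -> h t r = g t r) -> C1_half T h gt gx.
Proof.
  intros (C & HC & H) Hh.
  assert (Hbase : forall eps, 0 < eps -> exists d, 0 < d /\ forall x y, 0 <= x < d -> 0 <= y < d -> C * (x + y) < eps).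
  { intros eps He. exists (eps / (2 * (C + 1))); split; [apply Rdiv_lt_0_compat; lra|].
    intros x y Hx Hy. apply Rle_lt_trans with ((C + 1) * (x + y)); [apply Rmult_le_compat_r; lra|].
    replace eps with ((C + 1) * (eps / (2 * (C + 1)) + eps / (2 * (C + 1)))) by (field; lra).
    apply Rmult_lt_compat_l; lra. }
  split; intros t r Ht Hr eps He; destruct (Hbase eps He) as (d & Hd & Hd'); exists d; split; auto;
    intros t' r' Ht' Hr' H1 H2; destruct (H t r t' r') as (A1 & A2 & A3);
    pose proof (Rabs_pos (t' - t)); pose proof (Rabs_pos (r' - r));
    specialize (Hd' (Rabs (t' - t)) (Rabs (r' - r)) ltac:(lra) ltac:(lra)).
  - rewrite !Hh by auto. eapply Rle_trans; [apply A1|]. rewrite <- Rmult_assoc.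
    apply Rmult_le_compat_r; lra.
  - lra.
Qed.

Lemma C11_ext (g gt gx h ht hx : R -> R -> R) : C11 g gt gx ->
  (forall t r, h t r = g t r) -> (forall t r, ht t r = gt t r) -> (forall t r, hx t r = gx t r) -> C11 h ht hx.
Proof.
  intros (C & HC & H) E1 E2 E3. exists C; split; auto. intros. rewrite !E1, !E2, !E3. apply H.
Qed.

Lemma C11_plus (g gt gx h ht hx : R -> R -> R) : C11 g gt gx -> C11 h ht hx ->
  C11 (fun t r => g t r + h t r) (fun t r => gt t r + ht t r) (fun t r => gx t r + hx t r).
Proof.
  intros (C1 & HC1 & H1) (C2 & HC2 & H2). exists (C1 + C2); split; [lra|]. intros t r t' r'.
  destruct (H1 t r t' r') as (A1 & A2 & A3), (H2 t r t' r') as (B1 & B2 & B3).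
  rewrite !Rmult_plus_distr_r. repeat split.
  - match goal with |- Rabs ?X <= _ => replace X with
      ((g t' r' - g t r - gt t r * (t' - t) - gx t r * (r' - r)) + (h t' r' - h t r - ht t r * (t' - t) - hx t r * (r' - r))) by ring end.
    eapply Rle_trans; [apply Rabs_triang|lra].
  - replace (gt t' r' + ht t' r' - (gt t r + ht t r)) with ((gt t' r' - gt t r) + (ht t' r' - ht t r)) by ring.
    eapply Rle_trans; [apply Rabs_triang|lra].
  - replace (gx t' r' + hx t' r' - (gx t r + hx t r)) with ((gx t' r' - gx t r) + (hx t' r' - hx t r)) by ring.
    eapply Rle_trans; [apply Rabs_triang|lra].
Qed.

Lemma C11_mult_const (a : R) (g gt gx : R -> R -> R) : C11 g gt gx ->
  C11 (fun t r => a * g t r) (fun t r => a * gt t r) (fun t r => a * gx t r).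
Proof.
  intros (C & HC & H). pose proof (Rabs_pos a). exists (Rabs a * C); split; [now apply Rmult_le_pos|].
  intros t r t' r'. destruct (H t r t' r') as (A1 & A2 & A3). rewrite !Rmult_assoc. repeat split.
  - match goal with |- Rabs ?X <= _ => replace X with
      (a * (g t' r' - g t r - gt t r * (t' - t) - gx t r * (r' - r))) by ring end.
    rewrite Rabs_mult. now apply Rmult_le_compat_l.
  - rewrite <- Rmult_minus_distr_l, Rabs_mult. now apply Rmult_le_compat_l.
  - rewrite <- Rmult_minus_distr_l, Rabs_mult. now apply Rmult_le_compat_l.
Qed.

Lemma C11_affine (a b c : R) : C11 (fun t r => a + b * t + c * r) (fun _ _ => b) (fun _ _ => c).
Proof.
  exists 0; split; [lra|]. intros t r t' r'. rewrite !Rmult_0_l, !Rminus_diag, Rabs_R0.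
  match goal with |- Rabs ?X <= _ /\ _ => replace X with 0 by ring end. rewrite Rabs_R0; lra.
Qed.

Lemma C11_square (a b c : R) : C11 (fun t r => (a + b * t + c * r) * (a + b * t + c * r))
  (fun t r => 2 * b * (a + b * t + c * r)) (fun t r => 2 * c * (a + b * t + c * r)).
Proof.
  set (m := Rabs b + Rabs c). pose proof (Rabs_pos b); pose proof (Rabs_pos c).
  assert (Hm : 0 <= m) by (unfold m; lra).
  exists (2 * (m * m)); split; [nra|]. intros t r t' r'.
  set (x := Rabs (t' - t)). set (y := Rabs (r' - r)).
  assert (Hx : 0 <= x) by apply Rabs_pos. assert (Hy : 0 <= y) by apply Rabs_pos.
  assert (Hz : Rabs (b * (t' - t) + c * (r' - r)) <= m * (x + y)).
  { eapply Rle_trans; [apply Rabs_triang|]. rewrite !Rabs_mult. fold x y. unfold m.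
    assert (0 <= Rabs b * y) by now apply Rmult_le_pos. assert (0 <= Rabs c * x) by now apply Rmult_le_pos. lra. }
  assert (Hlip : forall k, Rabs k <= m -> Rabs (2 * k * (b * (t' - t) + c * (r' - r))) <= 2 * (m * m) * (x + y)).
  { intros k Hk. rewrite !Rabs_mult, (Rabs_pos_eq 2) by lra. rewrite !Rmult_assoc.
    apply Rmult_le_compat_l; [lra|]. apply Rmult_le_compat; auto using Rabs_pos. }
  repeat split.
  - match goal with |- Rabs ?X <= _ => replace X with
      ((b * (t' - t) + c * (r' - r)) * (b * (t' - t) + c * (r' - r))) by ring end.
    rewrite Rabs_mult. set (z := Rabs (b * (t' - t) + c * (r' - r))) in *.
    assert (0 <= z) by apply Rabs_pos.
    apply Rle_trans with ((m * (x + y)) * (m * (x + y))); [apply Rmult_le_compat; auto|].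
    assert (0 <= (m * (x + y)) * (m * (x + y))) by apply Rle_0_sqr. lra.
  - match goal with |- Rabs ?X <= _ => replace X with (2 * b * (b * (t' - t) + c * (r' - r))) by ring end.
    apply Hlip; unfold m; lra.
  - match goal with |- Rabs ?X <= _ => replace X with (2 * c * (b * (t' - t) + c * (r' - r))) by ring end.
    apply Hlip; unfold m; lra.
Qed.

(** A penalty that vanishes up to time a; it keeps an extremum away from a later final time without
    altering anything before a. *)
Lemma C11_square_pos (a : R) : C11 (fun t _ => Rmax (t - a) 0 * Rmax (t - a) 0)
  (fun t _ => 2 * Rmax (t - a) 0) (fun _ _ => 0).
Proof.
  exists 2; split; [lra|]. intros t r t' r'. rewrite Rminus_diag, Rabs_R0.
  set (y := Rabs (r' - r)). assert (Hy : 0 <= y) by apply Rabs_pos.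
  assert (Hx : 0 <= Rabs (t' - t)) by apply Rabs_pos.
  assert (Hlip : Rabs (Rmax (t' - a) 0 - Rmax (t - a) 0) <= Rabs (t' - t)).
  { unfold Rmax; destruct (Rle_dec (t' - a) 0), (Rle_dec (t - a) 0);
      unfold Rabs; repeat destruct (Rcase_abs _); lra. }
  repeat split.
  - rewrite Rmult_0_l, Rminus_0_r.
    assert (Rabs (Rmax (t' - a) 0 * Rmax (t' - a) 0 - Rmax (t - a) 0 * Rmax (t - a) 0 - 2 * Rmax (t - a) 0 * (t' - t))
       <= Rabs (t' - t) * Rabs (t' - t)).
    { rewrite <- Rabs_mult, (Rabs_pos_eq ((t' - t) * (t' - t))) by apply Rle_0_sqr.
      replace (t' - a) with ((t - a) + (t' - t)) by ring.
      set (p := t - a). set (w := t' - t).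
      assert (0 <= (p + w) * (p + w)) by apply Rle_0_sqr. assert (0 <= w * w) by apply Rle_0_sqr.
      unfold Rmax; destruct (Rle_dec (p + w) 0), (Rle_dec p 0); apply Rabs_le; split; try lra.
      - assert (0 <= p * (- (p + w))) by (apply Rmult_le_pos; lra).
        assert (0 <= p * p) by apply Rle_0_sqr. lra.
      - assert (0 <= (- p) * (p + w)) by (apply Rmult_le_pos; lra).
        assert (0 <= p * p) by apply Rle_0_sqr. lra. }
    set (x := Rabs (t' - t)) in *. eapply Rle_trans; [eassumption|].
    assert (0 <= x * y) by now apply Rmult_le_pos. assert (0 <= y * y) by now apply Rmult_le_pos.
    assert (0 <= x * x) by now apply Rmult_le_pos. lra.
  - rewrite <- Rmult_minus_distr_l, Rabs_mult, (Rabs_pos_eq 2) by lra. apply Rmult_le_compat_l; lra.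
  - lra.
Qed.

(** Carries the trace at the vertex to another branch as a function of time alone. *)
Lemma C11_at_zero (g gt gx : R -> R -> R) : C11 g gt gx ->
  C11 (fun t _ => g t 0) (fun t _ => gt t 0) (fun _ _ => 0).
Proof.
  intros (C & HC & H). exists C; split; auto. intros t r t' r'.
  destruct (H t 0 t' 0) as (A1 & A2 & _). rewrite !Rminus_diag, Rabs_R0, Rmult_0_r, Rplus_0_r in *.
  pose proof (Rabs_pos (t' - t)). pose proof (Rabs_pos (r' - r)).
  assert (HP : C * Rabs (t' - t) <= C * (Rabs (t' - t) + Rabs (r' - r))) by (apply Rmult_le_compat_l; lra).
  rewrite Rmult_0_l. repeat split; try lra.
  - eapply Rle_trans; [apply A1|]. apply Rmult_le_compat_l; auto. apply Rmult_le_compat; lra.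
  - apply Rmult_le_pos; lra.
Qed.

Lemma usc2_minus_C11 (a b c d : R) (f g gt gx : R -> R -> R) :
  usc2 a b c d f -> C11 g gt gx -> usc2 a b c d (fun t x => f t x - g t x).
Proof.
  intros Hf (C & HC & Hg) t x Ht Hx eps He.
  destruct (Hf t x Ht Hx (eps / 2) ltac:(lra)) as (r & Hr & Hr').
  set (M := Rabs (gt t x) + Rabs (gx t x) + 4 * C + 1).
  pose proof (Rabs_pos (gt t x)). pose proof (Rabs_pos (gx t x)).
  assert (HM : 0 < M) by (unfold M; lra).
  set (m := Rmin r (Rmin 1 (eps / (2 * M)))).
  assert (Hm : 0 < m) by (repeat apply Rmin_glb_lt; auto; [lra|apply Rdiv_lt_0_compat; lra]).
  assert (m <= r /\ m <= 1 /\ m <= eps / (2 * M)) as (M1 & M2 & M3).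
  { unfold m. Rmin_bounds. lra. }
  exists m; split; auto. intros s y Hs Hy H1 H2.
  specialize (Hr' s y Hs Hy ltac:(lra) ltac:(lra)).
  destruct (Hg t x s y) as (A & _ & _). apply Rabs_le_both in A.
  assert (B1 : Rabs (gt t x * (s - t)) <= Rabs (gt t x) * m) by (rewrite Rabs_mult; apply Rmult_le_compat_l; lra).
  assert (B2 : Rabs (gx t x * (y - x)) <= Rabs (gx t x) * m) by (rewrite Rabs_mult; apply Rmult_le_compat_l; lra).
  apply Rabs_le_both in B1, B2.
  pose proof (Rabs_pos (s - t)). pose proof (Rabs_pos (y - x)).
  assert (B3 : C * ((Rabs (s - t) + Rabs (y - x)) * (Rabs (s - t) + Rabs (y - x))) <= C * (4 * m)).
  { apply Rmult_le_compat_l; auto. apply Rle_trans with ((2 * m) * 2); [|lra]. apply Rmult_le_compat; lra. }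
  assert (M * m <= eps / 2).
  { apply Rle_trans with (M * (eps / (2 * M))); [apply Rmult_le_compat_l; lra|right; field; lra]. }
  unfold M in *. lra.
Qed.

Lemma usc_max_branches (N : nat) (a b R0 : R) (F : nat -> R -> R -> R) : (0 < N)%nat -> a <= b -> 0 <= R0 ->
  (forall i, (i < N)%nat -> usc2 a b 0 R0 (F i)) ->
  exists i t r, (i < N)%nat /\ a <= t <= b /\ 0 <= r <= R0 /\
    forall j s z, (j < N)%nat -> a <= s <= b -> 0 <= z <= R0 -> F j s z <= F i t r.
Proof.
  intros HN Hab HR HF.
  assert (H : forall i, exists p : R * R, (i < N)%nat -> a <= fst p <= b /\ 0 <= snd p <= R0 /\
     forall s z, a <= s <= b -> 0 <= z <= R0 -> F i s z <= F i (fst p) (snd p)).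
  { intro i. destruct (Nat.lt_ge_cases i N) as [Hi|Hi]; [|exists (0, 0); intro; lia].
    destruct (usc2_max a b 0 R0 (F i) Hab HR (HF i Hi)) as (t & r & Ht & Hr & Hm).
    exists (t, r); auto. }
  destruct (choice _ H) as [P HP].
  destruct (maxUpTo_attained (fun i => F i (fst (P i)) (snd (P i))) (N - 1)) as (i & Hi & E).
  assert (Hi' : (i < N)%nat) by lia. destruct (HP i Hi') as (Ht & Hr & _).
  exists i, (fst (P i)), (snd (P i)). repeat split; try tauto; try lra.
  intros j s z Hj Hs Hz. destruct (HP j Hj) as (_ & _ & Hm).
  eapply Rle_trans; [apply (Hm s z Hs Hz)|]. rewrite <- E.
  apply (maxUpTo_ge (fun i => F i (fst (P i)) (snd (P i)))). lia.
Qed.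

Section Test.
Context (N : nat) (e : nat -> pt) (HJ : junction N e).
Local Notation d := (dJ N e).

Definition test_fun (g : nat -> R -> R -> R) (t : R) (x : pt) : R := lift N e (fun i r => g i t r) x.

Lemma test_fun_scal (g : nat -> R -> R -> R) (t r : R) (i : nat) :
  (forall t i j, (i < N)%nat -> (j < N)%nat -> g i t 0 = g j t 0) -> (i < N)%nat -> 0 <= r ->
  test_fun g t (scal r (e i)) = g i t r.
Proof. intros Hg Hi Hr. unfold test_fun. now rewrite lift_scal by auto. Qed.

Lemma test_fun_C1star (T : R) (g gt gx : nat -> R -> R -> R) :
  (forall t i j, (i < N)%nat -> (j < N)%nat -> g i t 0 = g j t 0) ->
  (forall i, (i < N)%nat -> C11 (g i) (gt i) (gx i)) -> C1star N e T (test_fun g) gt gx.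
Proof.
  intros Hg HC i Hi. apply C11_C1_half with (g := g i); auto. intros t r Hr. now apply test_fun_scal.
Qed.

Lemma dJ_ball_radius (i j : nat) (r z rho : R) : (i < N)%nat -> (j < N)%nat -> 0 <= r -> 0 <= z ->
  d (scal z (e j)) (scal r (e i)) < rho - r -> z < rho.
Proof.
  intros Hi Hj Hr Hz H. destruct (Nat.eq_dec j i) as [->|Hne].
  - rewrite (dJ_same N e HJ) in H by auto. apply Rabs_def2 in H; lra.
  - rewrite (dJ_diff N e HJ) in H by auto. lra.
Qed.

(** The condition r < R0 excludes only the outer boundary; r = 0 is allowed, and the maximum runs
    over all branches because a ball around the vertex meets them all. *)
Lemma box_touch_above (T a b R0 : R) (u : R -> pt -> R) (g : nat -> R -> R -> R) (i : nat) (t r : R) :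
  (forall t i j, (i < N)%nat -> (j < N)%nat -> g i t 0 = g j t 0) ->
  (i < N)%nat -> a < t < b -> 0 <= r < R0 ->
  (forall j s z, (j < N)%nat -> a <= s <= b -> 0 <= z <= R0 ->
     u s (scal z (e j)) - g j s z <= u t (scal r (e i)) - g i t r) ->
  touch_above N e T u (test_fun (fun j s z => g j s z + (u t (scal r (e i)) - g i t r))) t (scal r (e i)).
Proof.
  intros Hg Hi Ht Hr Hmax. set (m := u t (scal r (e i)) - g i t r) in *.
  assert (Hg' : forall t i j, (i < N)%nat -> (j < N)%nat -> g i t 0 + m = g j t 0 + m)
    by (intros; f_equal; auto).
  split; [rewrite test_fun_scal by (auto; lra); unfold m; ring|].
  exists (Rmin (Rmin (t - a) (b - t)) (R0 - r)); split; [repeat apply Rmin_glb_lt; lra|].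
  intros s y Hs Hy H1 H2. destruct (inJ_elim N e y Hy) as (j & z & Hj & Hz & ->).
  Rmin_bounds.
  rewrite test_fun_scal by auto. apply Rabs_def2 in H1.
  assert (z < R0) by (apply (dJ_ball_radius i j r); auto; lra).
  specialize (Hmax j s z Hj ltac:(lra) ltac:(lra)). lra.
Qed.

Lemma box_touch_below (T a b R0 : R) (u : R -> pt -> R) (g : nat -> R -> R -> R) (i : nat) (t r : R) :
  (forall t i j, (i < N)%nat -> (j < N)%nat -> g i t 0 = g j t 0) ->
  (i < N)%nat -> a < t < b -> 0 <= r < R0 ->
  (forall j s z, (j < N)%nat -> a <= s <= b -> 0 <= z <= R0 ->
     u t (scal r (e i)) - g i t r <= u s (scal z (e j)) - g j s z) ->
  touch_below N e T u (test_fun (fun j s z => g j s z + (u t (scal r (e i)) - g i t r))) t (scal r (e i)).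
Proof.
  intros Hg Hi Ht Hr Hmin. set (m := u t (scal r (e i)) - g i t r) in *.
  assert (Hg' : forall t i j, (i < N)%nat -> (j < N)%nat -> g i t 0 + m = g j t 0 + m)
    by (intros; f_equal; auto).
  split; [rewrite test_fun_scal by (auto; lra); unfold m; ring|].
  exists (Rmin (Rmin (t - a) (b - t)) (R0 - r)); split; [repeat apply Rmin_glb_lt; lra|].
  intros s y Hs Hy H1 H2. destruct (inJ_elim N e y Hy) as (j & z & Hj & Hz & ->).
  Rmin_bounds.
  rewrite test_fun_scal by auto. apply Rabs_def2 in H1.
  assert (z < R0) by (apply (dJ_ball_radius i j r); auto; lra).
  specialize (Hmin j s z Hj ltac:(lra) ltac:(lra)). lra.
Qed.

Lemma C11_plus_const (g gt gx : R -> R -> R) (m : R) : C11 g gt gx -> C11 (fun t r => g t r + m) gt gx.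
Proof.
  intro H. apply (C11_ext _ _ _ _ _ _ (C11_plus _ _ _ _ _ _ H (C11_affine m 0 0))); intros; ring.
Qed.

Lemma usc_on_branch (T a b R0 : R) (u : R -> pt -> R) (i : nat) : usc_on N e T u -> 0 <= a -> b < T ->
  (i < N)%nat -> usc2 a b 0 R0 (fun t r => u t (scal r (e i))).
Proof.
  intros Hu Ha Hb Hi t r Ht Hr eps He.
  destruct (Hu t (scal r (e i))) with (eps := eps) as (rho & Hrho & H); auto.
  { split; [lra|]. apply (inJ_scal N e); auto; lra. }
  exists rho; split; auto. intros s y Hs Hy H1 H2. apply H; auto.
  - split; [lra|]. apply (inJ_scal N e); auto; lra.
  - rewrite (dJ_same N e HJ); auto; lra.
Qed.

Lemma lsc_on_opp (T : R) (u : R -> pt -> R) : lsc_on N e T u -> usc_on N e T (fun t x => - u t x).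
Proof.
  intros Hu t x Hx eps He. destruct (Hu t x Hx eps He) as (r & Hr & H); exists r; split; auto.
  intros s y Hs H1 H2. specialize (H s y Hs H1 H2). lra.
Qed.

End Test.

(** * Subsolutions lie below the value function *)

Section Subsolution.
Context (N : nat) (e : nat -> pt) (L : nat -> R -> R) (gamma : R) (u0 : pt -> R) (K C T : R).
Context (HJ : junction N e) (HA1 : hypA1 N L gamma) (HB : plan_bounds N e L u0 K C).
Context (v : R -> pt -> R) (Hv : subsolution N e L u0 T v).

Local Notation reach := (reach N e L u0).
Local Notation W := (value N e L u0).
Local Notation d := (dJ N e).

(* Maximize v minus a function penalizing the distance to the segment. A move reaching the
   vertex has q <= 0 and is seen by H_i^-; the steep slope M keeps the maximum off the other
   branches by coercivity of H_j. *)
Lemma sub_segment_core (i : nat) (r1 r2 t1 h q : R) : (i < N)%nat -> 0 <= r1 -> 0 <= r2 -> 0 <= t1 ->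
  0 < h -> t1 + h < T -> r2 - r1 = q * h -> (q <= 0 \/ 0 < r1) ->
  v (t1 + h) (scal r2 (e i)) <= v t1 (scal r1 (e i)) + h * L i q.
Proof.
  intros Hi Hr1 Hr2 Ht1 Hh HT Hq Hcase. apply Rnot_lt_le; intro Hlt.
  destruct Hv as (Husc & Htest & _).
  set (v1 := v t1 (scal r1 (e i))) in *. set (v2 := v (t1 + h) (scal r2 (e i))) in *.
  set (Del := v2 - v1 - h * L i q). assert (HDel : 0 < Del) by (unfold Del; lra).
  (* The box extends past t2, so that t2 is interior in time. *)
  set (t2 := t1 + h) in *. set (T' := (t2 + T) / 2).
  assert (HT' : t2 < T' < T) by (unfold T'; lra).
  set (al := Del / (4 * h)). assert (Hal : 0 < al) by (apply Rdiv_lt_0_compat; lra).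
  assert (Halh : al * h = Del / 4) by (unfold al; field; lra).
  pose proof (Rabs_pos q) as Hq0.
  set (Y := r1 + Rabs q * (T' - t1)).
  assert (HY : r1 <= Y).
  { unfold Y. assert (0 <= Rabs q * (T' - t1)) by (apply Rmult_le_pos; unfold t2 in *; lra). lra. }
  assert (Hline : forall t, t1 <= t <= T' -> r1 + q * (t - t1) <= Y).
  { intros t Ht. unfold Y. assert (q * (t - t1) <= Rabs q * (T' - t1)); [|lra].
    apply Rle_trans with (Rabs q * (t - t1)).
    - apply Rmult_le_compat_r; [lra|apply Rle_abs].
    - apply Rmult_le_compat_l; lra. }
  set (Rd := Y + 1).
  destruct (usc_max_branches N t1 T' Rd (fun k t r => v t (scal r (e k)))) as (iS & tS & rS & _ & _ & _ & HS).
  { apply (branch0 N e HJ). }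
  { unfold t2 in *; lra. }
  { unfold Rd; lra. }
  { intros k Hk. apply (usc_on_branch N e HJ T); auto; lra. }
  set (S := v tS (scal rS (e iS))) in *.
  assert (Hdom1 : dom N e T t1 (scal r1 (e i))).
  { split; [unfold t2 in *; lra|]. apply (inJ_scal N e); auto. }
  destruct (Husc t1 (scal r1 (e i)) Hdom1 (Del / 2) ltac:(lra)) as (del & Hdel & Hnear). fold v1 in Hnear.
  set (lead := L i q + al). set (E := Rabs lead * (T' - t1)).
  assert (HE : 0 <= E) by (apply Rmult_le_pos; [apply Rabs_pos|unfold t2 in *; lra]).
  (* m0 separates the two ends: v is below m0 near the start, while at (t2, r2) the penalized value
     is v1 + (3/4) Del. Q exceeds what v - lead (t - t1) can gain over m0 anywhere on the box, so a
     penalty reaching Q rules a point out. *)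
  set (m0 := v1 + Del / 2). set (Q := Rabs S + E + Rabs m0 + 1).
  assert (HQ : 0 < Q /\ S + E - m0 < Q /\ S - m0 < Q).
  { unfold Q. pose proof (Rle_abs S). pose proof (Rabs_ge_opp m0) as Hm.
    pose proof (Rabs_pos S). pose proof (Rabs_pos m0). lra. }
  destruct HQ as (HQ & HQ1 & HQ2).
  (* The three lower bounds on B exclude the outer radius, points at time t1 away from the start,
     and the vertex when q > 0 and r1 > 0. *)
  assert (HexB : exists B, Q <= B /\ Q <= B * (del / 2 * (del / 2)) /\ (0 < r1 -> Q <= B * (r1 * r1))).
  { assert (Hgen : forall z, 0 < z -> exists B, 0 <= B /\ Q <= B * (z * z)).
    { intros z Hz. exists (Q / (z * z)); split; [|right; field; lra].
      apply Rlt_le, Rdiv_lt_0_compat; auto. now apply Rmult_lt_0_compat. }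
    destruct (Hgen (del / 2) ltac:(lra)) as (B1 & B1p & HB1).
    assert (0 <= del / 2 * (del / 2)) by apply Rle_0_sqr.
    assert (0 <= r1 * r1) by apply Rle_0_sqr.
    destruct (Rlt_dec 0 r1) as [Hp|Hp].
    - destruct (Hgen r1 Hp) as (B2 & B2p & HB2). exists (Q + B1 + B2).
      assert (0 <= (Q + B2) * (del / 2 * (del / 2))) by (apply Rmult_le_pos; lra).
      assert (0 <= (Q + B1) * (r1 * r1)) by (apply Rmult_le_pos; lra).
      split; [lra|split; [lra|intros _; lra]].
    - exists (Q + B1). assert (0 <= Q * (del / 2 * (del / 2))) by (apply Rmult_le_pos; lra).
      split; [lra|split; [lra|tauto]]. }
  destruct HexB as (B & HB0 & HB1 & HB2).
  set (Kt := Q / ((T' - t2) * (T' - t2))).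
  assert (HKt : 0 < Kt) by (apply Rdiv_lt_0_compat; auto; apply Rmult_lt_0_compat; lra).
  assert (HKQ : Kt * ((T' - t2) * (T' - t2)) = Q) by (unfold Kt; field; lra).
  destruct HB as (_ & HC0 & _ & _ & HL1).
  set (slow := Rabs lead + 2 * B * Y * Rabs q).
  assert (Hslow : 0 <= slow).
  { unfold slow. pose proof (Rabs_pos lead). assert (0 <= 2 * B * Y * Rabs q); [|lra].
    repeat apply Rmult_le_pos; lra. }
  (* Q excludes the outer radius on the other branches and Q/(del/2) their points at time t1 away
     from the start. The rest contradicts the equation there, since H_k(M) >= M - L_k(1) >= M - C
     exceeds [slow], a bound for minus the time derivative. *)
  set (M := Q + Q / (del / 2) + C + slow + 1).
  assert (HQd : Q / (del / 2) * (del / 2) = Q) by (field; lra).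
  assert (HQd0 : 0 < Q / (del / 2)) by (apply Rdiv_lt_0_compat; lra).
  set (P := fun t x => lead * (t - t1) + B * ((- (r1 - q * t1) + - q * t + 1 * x) * (- (r1 - q * t1) + - q * t + 1 * x))
    + Kt * (Rmax (t - t2) 0 * Rmax (t - t2) 0)).
  set (Pt := fun t x => lead + B * (2 * - q * (- (r1 - q * t1) + - q * t + 1 * x)) + Kt * (2 * Rmax (t - t2) 0)).
  set (Px := fun t x => B * (2 * 1 * (- (r1 - q * t1) + - q * t + 1 * x))).
  assert (HPC : C11 P Pt Px).
  { apply (C11_ext _ _ _ _ _ _ (C11_plus _ _ _ _ _ _ (C11_plus _ _ _ _ _ _ (C11_affine (- lead * t1) lead 0)
      (C11_mult_const B _ _ _ (C11_square (- (r1 - q * t1)) (- q) 1))) (C11_mult_const Kt _ _ _ (C11_square_pos t2))));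
      intros; unfold P, Pt, Px; ring. }
  set (g := fun (k : nat) t x => if Nat.eq_dec k i then P t x else P t 0 + M * x).
  set (gt := fun (k : nat) t x => if Nat.eq_dec k i then Pt t x else Pt t 0).
  set (gx := fun (k : nat) t x => if Nat.eq_dec k i then Px t x else M).
  assert (Hg0 : forall t k l, (k < N)%nat -> (l < N)%nat -> g k t 0 = g l t 0).
  { intros t k l _ _. unfold g. destruct (Nat.eq_dec k i), (Nat.eq_dec l i); ring. }
  assert (HgC : forall k, (k < N)%nat -> C11 (g k) (gt k) (gx k)).
  { intros k _. unfold g, gt, gx. destruct (Nat.eq_dec k i); auto.
    apply (C11_ext _ _ _ _ _ _ (C11_plus _ _ _ _ _ _ (C11_at_zero _ _ _ HPC) (C11_affine 0 0 M))); intros; ring. }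
  assert (HP0 : forall t x, t1 <= t <= T' ->
     - E + B * ((x - r1 - q * (t - t1)) * (x - r1 - q * (t - t1))) + Kt * (Rmax (t - t2) 0 * Rmax (t - t2) 0) <= P t x).
  { intros t x Ht. unfold P.
    replace (- (r1 - q * t1) + - q * t + 1 * x) with (x - r1 - q * (t - t1)) by ring.
    assert (- E <= lead * (t - t1)); [|lra].
    assert (Rabs lead * (t - t1) <= E) by (apply Rmult_le_compat_l; [apply Rabs_pos|lra]).
    assert (- Rabs lead * (t - t1) <= lead * (t - t1)).
    { apply Rmult_le_compat_r; [lra|]. pose proof (Rabs_ge_opp lead) as Hx. lra. }
    lra. }
  assert (Hsq : forall z, 0 <= z * z) by (intro; apply Rle_0_sqr).
  destruct (usc_max_branches N t1 T' Rd (fun k t r => v t (scal r (e k)) - g k t r))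
    as (k0 & t0 & x0 & Hk0 & Ht0 & Hx0 & Hmax).
  { apply (branch0 N e HJ). }
  { unfold t2 in *; lra. }
  { unfold Rd; lra. }
  { intros k Hk. apply (usc2_minus_C11 t1 T' 0 Rd _ (g k) (gt k) (gx k)); auto.
    apply (usc_on_branch N e HJ T); auto; lra. }
  assert (Hbig : m0 < v t0 (scal x0 (e k0)) - g k0 t0 x0).
  { assert (Hr2Y : r2 <= Y) by (replace r2 with (r1 + q * (t2 - t1)) by (unfold t2; lra); apply Hline; unfold t2 in *; lra).
    pose proof (Hmax i t2 r2 Hi ltac:(unfold t2 in *; lra) ltac:(unfold Rd; lra)) as Hm. fold v2 in Hm.
    eapply Rlt_le_trans; [|apply Hm]. unfold g. destruct (Nat.eq_dec i i); [|tauto].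
    unfold P. rewrite Rminus_diag, Rmax_left by lra.
    replace (- (r1 - q * t1) + - q * t2 + 1 * r2) with 0 by (unfold t2; lra).
    replace (t2 - t1) with h by (unfold t2; ring). unfold m0, lead. unfold Del in *. lra. }
  pose proof (HS k0 t0 x0 Hk0 Ht0 Hx0) as HvS. cbv beta in HvS.
  set (w0 := v t0 (scal x0 (e k0))) in *.
  assert (HMx : 0 <= x0 -> 0 <= M * x0) by (intro; apply Rmult_le_pos; unfold M; lra).
  specialize (HMx ltac:(lra)).
  assert (Hgk : k0 = i /\ g k0 t0 x0 = P t0 x0 /\ gt k0 t0 x0 = Pt t0 x0 /\ gx k0 t0 x0 = Px t0 x0 \/
    k0 <> i /\ g k0 t0 x0 = P t0 0 + M * x0 /\ gt k0 t0 x0 = Pt t0 0 /\ gx k0 t0 x0 = M).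
  { unfold g, gt, gx. destruct (Nat.eq_dec k0 i); [left|right]; auto. }
  pose proof (HP0 t0 x0 Ht0) as HPx. pose proof (HP0 t0 0 Ht0) as HPz.
  assert (HB3 : 0 <= B) by lra.
  pose proof (Rmult_le_pos _ _ HB3 (Hsq (x0 - r1 - q * (t0 - t1)))) as Sx.
  pose proof (Rmult_le_pos _ _ HB3 (Hsq (0 - r1 - q * (t0 - t1)))) as Sz.
  pose proof (Rmult_le_pos _ _ (Rlt_le _ _ HKt) (Hsq (Rmax (t0 - t2) 0))) as Sk.
  assert (Hnt1 : t0 <> t1).
  { intro Et.
    assert (Hc : d (scal x0 (e k0)) (scal r1 (e i)) < del -> w0 < m0).
    { intro Hd. unfold m0, w0. apply Hnear; auto.
      - split; [unfold t2 in *; lra|]. apply (inJ_scal N e); auto; lra.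
      - rewrite Et, Rminus_diag, Rabs_R0; auto. }
    assert (HPE : forall x, B * ((x - r1) * (x - r1)) <= P t0 x).
    { intro x. unfold P. rewrite Et, Rminus_diag, Rmult_0_r.
      replace (- (r1 - q * t1) + - q * t1 + 1 * x) with (x - r1) by ring.
      pose proof (Rmult_le_pos _ _ (Rlt_le _ _ HKt) (Hsq (Rmax (t1 - t2) 0))). lra. }
    assert (Hfar : forall z, del / 2 <= Rabs z -> Q <= B * (z * z)).
    { intros z Hz. eapply Rle_trans; [apply HB1|]. apply Rmult_le_compat_l; auto.
      replace (z * z) with (Rabs z * Rabs z) by (rewrite <- Rabs_mult; now apply Rabs_pos_eq).
      apply Rmult_le_compat; lra. }
    destruct Hgk as [(Ek & Eg & _)|(Ek & Eg & _)]; rewrite Eg in Hbig.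
    - subst k0. rewrite (dJ_same N e HJ) in Hc by (auto; lra).
      pose proof (HPE x0) as Hx. pose proof (Rmult_le_pos _ _ HB3 (Hsq (x0 - r1))).
      destruct (Rlt_dec (Rabs (x0 - r1)) del) as [Hl|Hl]; [specialize (Hc Hl); lra|].
      pose proof (Hfar (x0 - r1) ltac:(lra)). lra.
    - rewrite (dJ_diff N e HJ) in Hc by (auto; lra).
      pose proof (HPE 0) as Hx. pose proof (Rmult_le_pos _ _ HB3 (Hsq (0 - r1))).
      destruct (Rlt_dec (x0 + r1) del) as [Hl|Hl]; [specialize (Hc Hl); lra|].
      destruct (Rle_dec (del / 2) r1) as [Hr|Hr].
      + pose proof (Hfar (0 - r1)) as Hf. rewrite Rminus_0_l, Rabs_Ropp, Rabs_pos_eq in Hf by auto.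
        specialize (Hf Hr). rewrite Rminus_0_l in Hx. lra.
      + assert (Q / (del / 2) * (del / 2) <= M * x0); [|lra].
        apply Rmult_le_compat; unfold M; lra. }
  assert (HntT : t0 <> T').
  { intro Et. assert (HR : Rmax (t0 - t2) 0 = T' - t2) by (rewrite Et; apply Rmax_left; lra).
    rewrite HR, HKQ in HPx. rewrite HR, HKQ in HPz.
    destruct Hgk as [(Ek & Eg & _)|(Ek & Eg & _)]; rewrite Eg in Hbig; lra. }
  assert (HnR : x0 <> Rd).
  { intro Ex. destruct Hgk as [(Ek & Eg & _)|(Ek & Eg & _)]; rewrite Eg in Hbig.
    - pose proof (Hline t0 Ht0).
      assert (1 <= (x0 - r1 - q * (t0 - t1)) * (x0 - r1 - q * (t0 - t1))).
      { replace 1 with (1 * 1) by ring. apply Rmult_le_compat; unfold Rd in Ex; lra. }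
      assert (B * 1 <= B * ((x0 - r1 - q * (t0 - t1)) * (x0 - r1 - q * (t0 - t1)))) by (apply Rmult_le_compat_l; auto).
      lra.
    - assert (Q * 1 <= M * x0) by (apply Rmult_le_compat; unfold M, Rd in *; lra). lra. }
  (* If q > 0 then r1 > 0, and the moving point stays at distance at least r1 from the vertex. *)
  assert (Hzero : x0 = 0 -> q <= 0).
  { intro Ex. destruct Hcase as [|Hp]; auto. apply Rnot_lt_le; intro Hqp.
    specialize (HB2 Hp).
    assert (HPm : - E + Q <= P t0 0).
    { assert (0 <= q * (t0 - t1)) by (apply Rmult_le_pos; lra).
      assert (r1 * r1 <= (0 - r1 - q * (t0 - t1)) * (0 - r1 - q * (t0 - t1))).
      { replace ((0 - r1 - q * (t0 - t1)) * (0 - r1 - q * (t0 - t1)))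
          with ((r1 + q * (t0 - t1)) * (r1 + q * (t0 - t1))) by ring. apply Rmult_le_compat; lra. }
      assert (B * (r1 * r1) <= B * ((0 - r1 - q * (t0 - t1)) * (0 - r1 - q * (t0 - t1)))) by (apply Rmult_le_compat_l; auto).
      lra. }
    destruct Hgk as [(Ek & Eg & _)|(Ek & Eg & _)]; rewrite Eg in Hbig; rewrite ?Ex in Hbig; lra. }
  assert (Htouch := box_touch_above N e HJ T t1 T' Rd v g k0 t0 x0 Hg0 Hk0 ltac:(lra) ltac:(lra) Hmax).
  fold w0 in Htouch.
  destruct (Htest _ gt gx t0 (scal x0 (e k0))
    (test_fun_C1star N e HJ T (fun j s z => g j s z + (w0 - g k0 t0 x0)) gt gx
      (fun t i j Hi Hj => f_equal (fun z => z + _) (Hg0 t i j Hi Hj))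
      (fun k Hk => C11_plus_const _ _ _ _ (HgC k Hk)))
    ltac:(lra) (inJ_scal N e k0 x0 Hk0 ltac:(lra)) Htouch) as [Hint Hver].
  (* The squared distance to the moving point is constant in the direction (1, q), so only the slope
     [lead] and the nonnegative time penalty contribute. *)
  assert (HPpos : forall x, al <= Pt t0 x + q * Px t0 x - L i q).
  { intro x. unfold Pt, Px, lead. pose proof (Rmax_r (t0 - t2) 0).
    assert (0 <= Kt * (2 * Rmax (t0 - t2) 0)) by (apply Rmult_le_pos; lra). lra. }
  destruct (Req_dec x0 0) as [Ex|Ex].
  - specialize (Hzero Ex). rewrite Ex, scal_zero in Hver. specialize (Hver eq_refl).
    pose proof (Hvertex_ge N L (fun i => gx i t0 0) i Hi) as Hge. cbv beta in Hge.
    pose proof (proj1 (Hminus_lub N L gamma HA1 i (gx i t0 0) Hi) q Hzero) as Hm.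
    assert (gt O t0 0 = Pt t0 0) as E1 by (unfold gt; destruct (Nat.eq_dec O i); auto).
    assert (gx i t0 0 = Px t0 0) as E2 by (unfold gx; destruct (Nat.eq_dec i i); tauto).
    rewrite E1 in Hver. rewrite E2 in Hm, Hge. specialize (HPpos 0). lra.
  - assert (Hx : 0 < x0) by lra. specialize (Hint k0 x0 Hk0 Hx eq_refl).
    destruct Hgk as [(Ek & _ & E1 & E2)|(Ek & _ & E1 & E2)]; rewrite E1, E2 in Hint.
    + subst k0. pose proof (proj1 (Hfun_lub N L gamma HA1 i (Px t0 x0) Hi) q). specialize (HPpos x0). lra.
    + pose proof (proj1 (Hfun_lub N L gamma HA1 k0 M Hk0) 1). destruct (HL1 k0 Hk0) as (_ & HLk & _).
      assert (- slow <= Pt t0 0).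
      { unfold Pt, slow. pose proof (Rmax_r (t0 - t2) 0).
        assert (0 <= Kt * (2 * Rmax (t0 - t2) 0)) by (apply Rmult_le_pos; lra).
        replace (- (r1 - q * t1) + - q * t0 + 1 * 0) with (- (r1 + q * (t0 - t1))) by ring.
        assert (- Rabs lead <= lead).
        { pose proof (Rabs_ge_opp lead) as Hz. lra. }
        assert (Rabs (q * (r1 + q * (t0 - t1))) <= Rabs q * Y).
        { rewrite Rabs_mult. apply Rmult_le_compat_l; auto.
          eapply Rle_trans; [apply Rabs_triang|]. rewrite Rabs_mult, (Rabs_pos_eq r1), (Rabs_pos_eq (t0 - t1)) by lra.
          unfold Y. assert (Rabs q * (t0 - t1) <= Rabs q * (T' - t1)) by (apply Rmult_le_compat_l; lra). lra. }
        assert (Hb := Rabs_le_both _ _ H3).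
        assert (B * (q * (r1 + q * (t0 - t1))) >= - (B * (Rabs q * Y))).
        { assert (B * (- (Rabs q * Y)) <= B * (q * (r1 + q * (t0 - t1)))) by (apply Rmult_le_compat_l; lra). lra. }
        lra. }
      unfold M in *. lra.
Qed.

(** What [sub_segment_core] omits is leaving the vertex with q > 0. Start a little later, at an
    interior point of the segment, and use the upper semicontinuity of v at the start. *)
Lemma sub_segment (i : nat) (r1 r2 t1 h q : R) : (i < N)%nat -> 0 <= r1 -> 0 <= r2 -> 0 <= t1 ->
  0 < h -> t1 + h < T -> r2 - r1 = q * h ->
  v (t1 + h) (scal r2 (e i)) <= v t1 (scal r1 (e i)) + h * L i q.
Proof.
  intros Hi Hr1 Hr2 Ht1 Hh HT Hq.
  destruct (Rle_dec q 0) as [Hq0|Hq0]; [apply sub_segment_core; auto|].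
  apply Rnot_le_lt in Hq0.
  apply le_epsilon. intros eps He.
  destruct Hv as (Husc & _ & _).
  assert (Hdom : dom N e T t1 (scal r1 (e i))) by (split; [lra|apply (inJ_scal N e); auto]).
  destruct (Husc t1 _ Hdom (eps / 2) ltac:(lra)) as (del & Hdel & Hnear).
  set (m := Rmin h (Rmin del (Rmin (del / q) (eps / (Rabs (L i q) + 1))))).
  pose proof (Rabs_pos (L i q)).
  assert (Hm : 0 < m) by (repeat apply Rmin_glb_lt; auto; apply Rdiv_lt_0_compat; lra).
  assert (m <= h /\ m <= del /\ m <= del / q /\ m <= eps / (Rabs (L i q) + 1)) as (M1 & M2 & M3 & M4).
  { unfold m. Rmin_bounds. lra. }
  set (s := m / 2). assert (Hs : 0 < s < m) by (unfold s; lra).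
  assert (Hqs : 0 < q * s) by (apply Rmult_lt_0_compat; lra).
  assert (Hqs' : q * s < del).
  { replace del with (q * (del / q)) by (field; lra). apply Rmult_lt_compat_l; lra. }
  pose proof (sub_segment_core i (r1 + q * s) r2 (t1 + s) (h - s) q Hi ltac:(lra) Hr2 ltac:(lra) ltac:(lra)
    ltac:(lra) ltac:(lra) ltac:(right; lra)) as Hc.
  replace (t1 + s + (h - s)) with (t1 + h) in Hc by ring.
  assert (Hn : v (t1 + s) (scal (r1 + q * s) (e i)) < v t1 (scal r1 (e i)) + eps / 2).
  { apply Hnear.
    - split; [lra|]. apply (inJ_scal N e); auto; lra.
    - apply Rabs_def1; lra.
    - rewrite (dJ_same N e HJ) by (auto; lra). apply Rabs_def1; lra. }
  assert (Hsl : - s * L i q <= eps / 2).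
  { apply Rle_trans with (s * (Rabs (L i q) + 1)).
    - pose proof (Rabs_ge_opp (L i q)) as Hz.
      assert (s * - L i q <= s * (Rabs (L i q) + 1)) by (apply Rmult_le_compat_l; lra). lra.
    - replace (eps / 2) with (eps / (Rabs (L i q) + 1) / 2 * (Rabs (L i q) + 1)) by (field; lra).
      apply Rmult_le_compat_r; unfold s; lra. }
  lra.
Qed.

Lemma subsolution_le_reach (t : R) (x : pt) (c : R) : reach t x c -> t < T -> v t x <= c.
Proof.
  intro H; induction H as [x Hx|t c i r1 r2 h Hi H1 H2 Hh H IH]; intro HT.
  - now apply Hv.
  - destruct (reach_dom N e L u0 _ _ _ H) as [Ht _]. specialize (IH ltac:(lra)).
    pose proof (sub_segment i r1 r2 t h ((r2 - r1) / h) Hi H1 H2 Ht Hh HT ltac:(field; lra)). lra.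
Qed.

Lemma subsolution_le_value (t : R) (x : pt) : 0 <= t < T -> inJ N e x -> v t x <= W t x.
Proof.
  intros Ht Hx. apply (value_spec N e L u0 K C HJ HB); auto; [lra|].
  intros c Hc. apply subsolution_le_reach; auto; lra.
Qed.

End Subsolution.

(** * Steklov averages *)

Section Mean.
Import Hierarchy Continuity RInt.

Definition mean (rho : R) (f : R -> R) : R := RInt f 0 rho / rho.

Definition lipschitz (K : R) (f : R -> R) : Prop := forall x y, Rabs (f x - f y) <= K * Rabs (x - y).

Lemma lipschitz_ex_RInt (K : R) (f : R -> R) (a b : R) : lipschitz K f -> ex_RInt f a b.
Proof.
  intro H. apply (ex_RInt_continuous (V := R_CompleteNormedModule)). intros z _.
  apply continuity_pt_filterlim. intros eps He.
  exists (eps / (Rabs K + 1)). pose proof (Rabs_pos K).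
  split; [apply Rdiv_lt_0_compat; lra|]. intros x [_ Hx]. simpl in *. unfold R_dist in *.
  eapply Rle_lt_trans; [apply H|]. apply Rle_lt_trans with ((Rabs K + 1) * Rabs (x - z)).
  - apply Rmult_le_compat_r; [apply Rabs_pos|]. pose proof (Rle_abs K); lra.
  - replace eps with ((Rabs K + 1) * (eps / (Rabs K + 1))) by (field; lra).
    apply Rmult_lt_compat_l; lra.
Qed.

Lemma mean_const (rho c : R) : 0 < rho -> mean rho (fun _ => c) = c.
Proof.
  intro H. unfold mean. rewrite RInt_const. unfold scal; simpl.
  unfold mult; simpl. field; lra.
Qed.

Lemma mean_minus (rho K1 K2 : R) (f g : R -> R) : lipschitz K1 f -> lipschitz K2 g ->
  mean rho (fun x => f x - g x) = mean rho f - mean rho g.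
Proof.
  intros Hf Hg. unfold mean.
  pose proof (RInt_minus f g 0 rho (lipschitz_ex_RInt K1 f 0 rho Hf) (lipschitz_ex_RInt K2 g 0 rho Hg)) as H.
  unfold minus, plus, opp in H; simpl in H.
  unfold Rminus in *. rewrite H. unfold Rdiv; ring.
Qed.

Lemma mean_le (rho K1 K2 : R) (f g : R -> R) : 0 < rho -> lipschitz K1 f -> lipschitz K2 g ->
  (forall x, 0 <= x <= rho -> f x <= g x) -> mean rho f <= mean rho g.
Proof.
  intros Hr Hf Hg H. unfold mean. apply Rmult_le_compat_r; [now apply Rinv_nonneg|].
  apply RInt_le; [lra|eapply lipschitz_ex_RInt; eauto|eapply lipschitz_ex_RInt; eauto|].
  intros x Hx; apply H; lra.
Qed.

Lemma lipschitz_const (c : R) : lipschitz 0 (fun _ => c).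
Proof. intros x y. rewrite Rminus_diag, Rabs_R0; lra. Qed.

Lemma lipschitz_minus (K1 K2 : R) (f g : R -> R) : lipschitz K1 f -> lipschitz K2 g ->
  lipschitz (K1 + K2) (fun x => f x - g x).
Proof.
  intros Hf Hg x y. replace (f x - g x - (f y - g y)) with ((f x - f y) - (g x - g y)) by ring.
  eapply Rle_trans; [apply Rabs_minus_le|].
  specialize (Hf x y); specialize (Hg x y); lra.
Qed.

Lemma lipschitz_mult_const (a K : R) (f : R -> R) : lipschitz K f -> lipschitz (Rabs a * K) (fun x => a * f x).
Proof.
  intros Hf x y. rewrite <- Rmult_minus_distr_l, Rabs_mult, Rmult_assoc.
  apply Rmult_le_compat_l; [apply Rabs_pos|apply Hf].
Qed.

Lemma lipschitz_shift (K a : R) (f : R -> R) : lipschitz K f -> lipschitz K (fun x => f (a + x)).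
Proof. intros Hf x y. replace (x - y) with (a + x - (a + y)) by ring. apply Hf. Qed.

Lemma mean_bound (rho K c : R) (f : R -> R) : 0 < rho -> lipschitz K f ->
  (forall x, 0 <= x <= rho -> Rabs (f x) <= c) -> Rabs (mean rho f) <= c.
Proof.
  intros Hr Hf H. apply Rabs_le; split.
  - rewrite <- (mean_const rho (- c)) by auto. apply mean_le with 0 K; auto using lipschitz_const.
    intros x Hx. specialize (H x Hx). apply Rabs_le_both in H; lra.
  - rewrite <- (mean_const rho c) by auto. apply mean_le with K 0; auto using lipschitz_const.
    intros x Hx. specialize (H x Hx). apply Rabs_le_both in H; lra.
Qed.

Lemma mean_close (rho K1 K2 c : R) (f g : R -> R) : 0 < rho -> lipschitz K1 f -> lipschitz K2 g ->
  (forall x, 0 <= x <= rho -> Rabs (f x - g x) <= c) -> Rabs (mean rho f - mean rho g) <= c.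
Proof.
  intros Hr Hf Hg H. rewrite <- (mean_minus rho K1 K2) by auto.
  apply mean_bound with (K1 + K2); auto using lipschitz_minus.
Qed.

Lemma RInt_lipschitz_increment (K a b : R) (f : R -> R) : lipschitz K f ->
  Rabs (RInt f a b - f a * (b - a)) <= K * ((b - a) * (b - a)).
Proof.
  intro Hf.
  assert (HK : 0 <= K).
  { specialize (Hf 1 0). rewrite Rminus_0_r, Rabs_R1 in Hf. pose proof (Rabs_pos (f 1 - f 0)); lra. }
  assert (Hgen : forall a b c, a <= b -> a <= c <= b -> Rabs (RInt f a b - f c * (b - a)) <= K * ((b - a) * (b - a))).
  { clear a b. intros a b c Hab Hc.
    assert (Hcst : forall z, RInt (fun _ => z) a b = z * (b - a)).
    { intro z. rewrite RInt_const. unfold scal; simpl. unfold mult; simpl. ring. }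
    assert (Hx : forall x, a < x < b -> Rabs (f x - f c) <= K * (b - a)).
    { intros x Hx. eapply Rle_trans; [apply Hf|]. apply Rmult_le_compat_l; auto. apply Rabs_le; lra. }
    apply Rabs_le; split.
    - assert (RInt (fun _ => f c - K * (b - a)) a b <= RInt f a b); [|rewrite Hcst in *; lra].
      apply RInt_le; auto; [apply lipschitz_ex_RInt with 0, lipschitz_const|now apply lipschitz_ex_RInt with K|].
      intros x Hx'; pose proof (Rabs_le_both _ _ (Hx x Hx')); lra.
    - assert (RInt f a b <= RInt (fun _ => f c + K * (b - a)) a b); [|rewrite Hcst in *; lra].
      apply RInt_le; auto; [now apply lipschitz_ex_RInt with K|apply lipschitz_ex_RInt with 0, lipschitz_const|].
      intros x Hx'; pose proof (Rabs_le_both _ _ (Hx x Hx')); lra. }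
  destruct (Rle_dec a b) as [Hab|Hab]; [apply Hgen; lra|].
  pose proof (Hgen b a a ltac:(lra) ltac:(lra)) as H.
  rewrite <- opp_RInt_swap by now apply lipschitz_ex_RInt with K.
  unfold opp; simpl.
  replace (- RInt f b a - f a * (b - a)) with (- (RInt f b a - f a * (a - b))) by ring.
  rewrite Rabs_Ropp. replace ((b - a) * (b - a)) with ((a - b) * (a - b)) by ring. exact H.
Qed.

(** The two windows differ only by the end strips from x to x' and from x + rho to x' + rho, and
    each strip integral is its width times an endpoint value, up to a quadratic error. *)
Lemma mean_increment (rho K : R) (f : R -> R) (x x' : R) : 0 < rho -> lipschitz K f ->
  Rabs (mean rho (fun y => f (x' + y)) - mean rho (fun y => f (x + y)) - (f (x + rho) - f x) / rho * (x' - x))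
    <= 2 * K / rho * ((x' - x) * (x' - x)).
Proof.
  intros Hr Hf. unfold mean.
  assert (Hint : forall a b, ex_RInt f a b) by (intros; now apply lipschitz_ex_RInt with K).
  assert (Hsh : forall z, RInt (fun y => f (z + y)) 0 rho = RInt f z (z + rho)).
  { intro z. pose proof (RInt_comp_lin f 1 z 0 rho (Hint _ _)) as H.
    replace (1 * 0 + z) with z in H by ring. replace (1 * rho + z) with (z + rho) in H by ring.
    rewrite <- H. apply RInt_ext. intros y _. unfold scal; simpl. unfold mult; simpl.
    rewrite Rmult_1_l. f_equal; ring. }
  rewrite !Hsh.
  pose proof (RInt_Chasles f x x' (x' + rho) (Hint _ _) (Hint _ _)) as E1.
  pose proof (RInt_Chasles f x (x + rho) (x' + rho) (Hint _ _) (Hint _ _)) as E2.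
  unfold plus in E1, E2; simpl in E1, E2.
  pose proof (RInt_lipschitz_increment K x x' f Hf) as I1.
  pose proof (RInt_lipschitz_increment K (x + rho) (x' + rho) f Hf) as I2.
  replace (x' + rho - (x + rho)) with (x' - x) in I2 by ring.
  set (D1 := RInt f x x' - f x * (x' - x)) in *.
  set (D2 := RInt f (x + rho) (x' + rho) - f (x + rho) * (x' - x)) in *.
  replace (_ - _ - _) with ((D2 - D1) * / rho).
  - rewrite Rabs_mult, (Rabs_pos_eq (/ rho)) by now apply Rinv_nonneg.
    replace (2 * K / rho * ((x' - x) * (x' - x))) with (2 * (K * ((x' - x) * (x' - x))) * / rho) by (unfold Rdiv; ring).
    apply Rmult_le_compat_r; [now apply Rinv_nonneg|].
    eapply Rle_trans; [apply Rabs_minus_le|]. lra.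
  - replace (D2 - D1) with (RInt f x' (x' + rho) - RInt f x (x + rho) - (f (x + rho) - f x) * (x' - x)).
    + field; lra.
    + unfold D1, D2. lra.
Qed.

Lemma mean_mult_const (rho a K : R) (f : R -> R) : lipschitz K f -> mean rho (fun x => a * f x) = a * mean rho f.
Proof.
  intro Hf. unfold mean. pose proof (RInt_scal f 0 rho a (lipschitz_ex_RInt K f 0 rho Hf)) as E.
  unfold scal in E; simpl in E. unfold mult in E; simpl in E. rewrite E. unfold Rdiv; ring.
Qed.

End Mean.

Section Steklov.
Context (K eta rho : R) (HK : 0 <= K) (Heta : 0 < eta) (Hrho : 0 < rho) (g : R -> R -> R).
Context (Hg : forall t x s y, Rabs (g t x - g s y) <= K * (Rabs (t - s) + Rabs (x - y))).

Definition mean_x (t x : R) : R := mean rho (fun y => g t (x + y)).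
(** Both windows look forward, so at t >= 0 and x >= 0 only values in that quadrant are used, even
    at the vertex. *)
Definition steklov (t x : R) : R := mean eta (fun s => mean_x (t + s) x).
Definition steklov_t (t x : R) : R := (mean_x (t + eta) x - mean_x t x) / eta.
Definition steklov_x (t x : R) : R := mean eta (fun s => / rho * (g (t + s) (x + rho) - g (t + s) x)).

Lemma g_lip_x (t : R) : lipschitz K (fun x => g t x).
Proof. intros x y. eapply Rle_trans; [apply Hg|]. rewrite Rminus_diag, Rabs_R0; lra. Qed.

Lemma g_lip_t (x : R) : lipschitz K (fun t => g t x).
Proof. intros t s. eapply Rle_trans; [apply Hg|]. rewrite Rminus_diag, Rabs_R0; lra. Qed.

Lemma mean_x_lipschitz (t x s y : R) : Rabs (mean_x t x - mean_x s y) <= K * (Rabs (t - s) + Rabs (x - y)).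
Proof.
  unfold mean_x. apply mean_close with K K; auto.
  - apply (lipschitz_shift K x (g t)), g_lip_x.
  - apply (lipschitz_shift K y (g s)), g_lip_x.
  - intros z _. replace (x - y) with (x + z - (y + z)) by ring. apply Hg.
Qed.

Lemma mean_x_lip_t (x : R) : lipschitz K (fun t => mean_x t x).
Proof. intros t s. eapply Rle_trans; [apply mean_x_lipschitz|]. rewrite Rminus_diag, Rabs_R0; lra. Qed.

Lemma mean_x_shift_lip (t x : R) : lipschitz K (fun s => mean_x (t + s) x).
Proof. apply (lipschitz_shift K t (fun t => mean_x t x)), mean_x_lip_t. Qed.

Lemma slope_lip (x : R) : lipschitz (Rabs (/ rho) * (K + K)) (fun t => / rho * (g t (x + rho) - g t x)).
Proof.
  apply (lipschitz_mult_const (/ rho) (K + K) (fun t => g t (x + rho) - g t x)).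
  apply (lipschitz_minus K K (fun t => g t (x + rho)) (fun t => g t x)); apply g_lip_t.
Qed.

Lemma slope_shift_lip (t x : R) :
  lipschitz (Rabs (/ rho) * (K + K)) (fun s => / rho * (g (t + s) (x + rho) - g (t + s) x)).
Proof. apply (lipschitz_shift _ t (fun t => / rho * (g t (x + rho) - g t x))), slope_lip. Qed.

Lemma steklov_t_lipschitz (t x s y : R) :
  Rabs (steklov_t t x - steklov_t s y) <= 2 * K / eta * (Rabs (t - s) + Rabs (x - y)).
Proof.
  unfold steklov_t.
  replace (_ - _) with (((mean_x (t + eta) x - mean_x (s + eta) y) - (mean_x t x - mean_x s y)) * / eta)
    by (field; lra).
  rewrite Rabs_mult, (Rabs_pos_eq (/ eta)) by now apply Rinv_nonneg.
  replace (2 * K / eta * (Rabs (t - s) + Rabs (x - y))) with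
    (2 * (K * (Rabs (t - s) + Rabs (x - y))) * / eta) by (unfold Rdiv; ring).
  apply Rmult_le_compat_r; [now apply Rinv_nonneg|].
  eapply Rle_trans; [apply Rabs_minus_le|].
  pose proof (mean_x_lipschitz (t + eta) x (s + eta) y) as H1. pose proof (mean_x_lipschitz t x s y) as H2.
  replace (t + eta - (s + eta)) with (t - s) in H1 by ring. lra.
Qed.

Lemma steklov_x_lipschitz (t x s y : R) :
  Rabs (steklov_x t x - steklov_x s y) <= 2 * K / rho * (Rabs (t - s) + Rabs (x - y)).
Proof.
  unfold steklov_x. eapply mean_close; auto using slope_shift_lip.
  intros z _.
  replace (_ - _) with (/ rho * ((g (t + z) (x + rho) - g (s + z) (y + rho)) - (g (t + z) x - g (s + z) y))) by ring.
  rewrite Rabs_mult, (Rabs_pos_eq (/ rho)) by now apply Rinv_nonneg.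
  replace (2 * K / rho * (Rabs (t - s) + Rabs (x - y))) with
    (/ rho * (2 * (K * (Rabs (t - s) + Rabs (x - y))))) by (unfold Rdiv; ring).
  apply Rmult_le_compat_l; [now apply Rinv_nonneg|].
  eapply Rle_trans; [apply Rabs_minus_le|].
  pose proof (Hg (t + z) (x + rho) (s + z) (y + rho)) as H1. pose proof (Hg (t + z) x (s + z) y) as H2.
  replace (t + z - (s + z)) with (t - s) in H1, H2 by ring. replace (x + rho - (y + rho)) with (x - y) in H1 by ring. lra.
Qed.

(** The increment splits at (t', x) into a pure time step, a pure space step and the change of the
    space derivative between t and t'. *)
Lemma steklov_C11 : C11 steklov steklov_t steklov_x.
Proof.
  set (k := 2 * K / rho). set (l := 2 * K / eta).
  assert (Hk : 0 <= k) by (apply Rmult_le_pos; [lra|now apply Rinv_nonneg]).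
  assert (Hl : 0 <= l) by (apply Rmult_le_pos; [lra|now apply Rinv_nonneg]).
  exists (k + l); split; [lra|]. intros t x t' x'.
  set (dt := Rabs (t' - t)). set (dx := Rabs (x' - x)).
  assert (Hdt : 0 <= dt) by apply Rabs_pos. assert (Hdx : 0 <= dx) by apply Rabs_pos.
  assert (0 <= k * (dt + dx)) by (apply Rmult_le_pos; lra).
  assert (0 <= l * (dt + dx)) by (apply Rmult_le_pos; lra).
  split; [|split].
  - assert (H1 : Rabs (steklov t' x - steklov t x - steklov_t t x * (t' - t)) <= l * (dt * dt)).
    { unfold dt. rewrite <- Rabs_mult, (Rabs_pos_eq ((t' - t) * (t' - t))) by apply Rle_0_sqr.
      apply (mean_increment eta K (fun t => mean_x t x)); auto. apply mean_x_lip_t. }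
    assert (H2 : Rabs (steklov t' x' - steklov t' x - steklov_x t' x * (x' - x)) <= k * (dx * dx)).
    { unfold steklov, steklov_x.
      set (f := fun s => mean_x (t' + s) x' - mean_x (t' + s) x).
      set (h := fun s => (x' - x) * (/ rho * (g (t' + s) (x + rho) - g (t' + s) x))).
      assert (Hf : lipschitz (K + K) f) by (apply lipschitz_minus; apply mean_x_shift_lip).
      assert (Hh : lipschitz (Rabs (x' - x) * (Rabs (/ rho) * (K + K))) h).
      { apply (lipschitz_mult_const (x' - x) _ (fun s => / rho * (g (t' + s) (x + rho) - g (t' + s) x))).
        apply slope_shift_lip. }
      rewrite <- (mean_minus eta K K) by apply mean_x_shift_lip. fold f.
      assert (Eh : mean eta (fun s => / rho * (g (t' + s) (x + rho) - g (t' + s) x)) * (x' - x) = mean eta h).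
      { rewrite Rmult_comm. symmetry. eapply mean_mult_const. apply slope_shift_lip. }
      rewrite Eh. apply mean_close with (K + K) (Rabs (x' - x) * (Rabs (/ rho) * (K + K))); auto.
      intros s _. unfold f, h.
      unfold dx. rewrite <- Rabs_mult, (Rabs_pos_eq ((x' - x) * (x' - x))) by apply Rle_0_sqr.
      pose proof (mean_increment rho K (g (t' + s)) x x' Hrho (g_lip_x (t' + s))) as Hi.
      replace ((x' - x) * (/ rho * (g (t' + s) (x + rho) - g (t' + s) x))) with
        ((g (t' + s) (x + rho) - g (t' + s) x) / rho * (x' - x)) by (unfold Rdiv; ring). exact Hi. }
    assert (H3 : Rabs ((steklov_x t' x - steklov_x t x) * (x' - x)) <= k * dt * dx).
    { rewrite Rabs_mult. apply Rmult_le_compat_r; auto. pose proof (steklov_x_lipschitz t' x t x) as Hs.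
      rewrite Rminus_diag, Rabs_R0, Rplus_0_r in Hs. exact Hs. }
    match goal with |- Rabs ?X <= _ => replace X with
      ((steklov t' x - steklov t x - steklov_t t x * (t' - t)) + ((steklov t' x' - steklov t' x - steklov_x t' x * (x' - x))
       + (steklov_x t' x - steklov_x t x) * (x' - x))) by ring end.
    eapply Rle_trans; [apply Rabs_triang|]. 
    apply Rle_trans with (l * (dt * dt) + (k * (dx * dx) + k * dt * dx)).
    + apply Rplus_le_compat; auto. eapply Rle_trans; [apply Rabs_triang|]. lra.
    + assert (0 <= l * (dt * dx)) by (apply Rmult_le_pos; auto; now apply Rmult_le_pos).
      assert (0 <= l * (dx * dx)) by (apply Rmult_le_pos; auto; now apply Rmult_le_pos).
      assert (0 <= k * (dt * dx)) by (apply Rmult_le_pos; auto; now apply Rmult_le_pos).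
      assert (0 <= k * (dt * dt)) by (apply Rmult_le_pos; auto; now apply Rmult_le_pos). lra.
  - pose proof (steklov_t_lipschitz t' x' t x) as H1. fold l dt dx in H1. lra.
  - pose proof (steklov_x_lipschitz t' x' t x) as H1. fold k dt dx in H1. lra.
Qed.

Lemma mean_x_close (t x : R) : Rabs (mean_x t x - g t x) <= K * rho.
Proof.
  unfold mean_x. rewrite <- (mean_const rho (g t x)) by auto.
  apply mean_close with K 0; auto using lipschitz_const.
  - apply (lipschitz_shift K x (g t)), g_lip_x.
  - intros y Hy. eapply Rle_trans; [apply (g_lip_x t)|]. apply Rmult_le_compat_l; auto. apply Rabs_le; lra.
Qed.

Lemma steklov_close (t x : R) : Rabs (steklov t x - g t x) <= K * (eta + rho).
Proof.
  unfold steklov. rewrite <- (mean_const eta (g t x)) by auto.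
  apply mean_close with K 0; auto using lipschitz_const, mean_x_shift_lip.
  intros s Hs. replace (mean_x (t + s) x - g t x) with ((mean_x (t + s) x - g (t + s) x) + (g (t + s) x - g t x)) by ring.
  eapply Rle_trans; [apply Rabs_triang|]. pose proof (mean_x_close (t + s) x).
  assert (Rabs (g (t + s) x - g t x) <= K * eta); [|lra].
  eapply Rle_trans; [apply (g_lip_t x)|]. apply Rmult_le_compat_l; auto. apply Rabs_le; lra.
Qed.

Lemma steklov_segment (t x t' x' c : R) :
  (forall s y, 0 <= s -> 0 <= y -> g (t' + s) (x' + y) <= g (t + s) (x + y) + c) ->
  steklov t' x' <= steklov t x + c.
Proof.
  intro H. assert (steklov t' x' - steklov t x <= c); [|lra].
  unfold steklov. rewrite <- (mean_minus eta K K) by apply mean_x_shift_lip.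
  rewrite <- (mean_const eta c) by auto.
  apply mean_le with (K + K) 0; auto using lipschitz_const.
  { apply lipschitz_minus; apply mean_x_shift_lip. }
  intros s Hs. unfold mean_x.
  rewrite <- (mean_minus rho K K); try (apply (lipschitz_shift K _ (g _)), g_lip_x).
  rewrite <- (mean_const rho c) by auto. apply mean_le with (K + K) 0; auto using lipschitz_const.
  { apply (lipschitz_minus K K (fun y => g (t' + s) (x' + y)) (fun y => g (t + s) (x + y)));
      apply (lipschitz_shift K _ (g _)), g_lip_x. }
  intros y Hy. specialize (H s y ltac:(lra) ltac:(lra)). lra.
Qed.

(** Translated segments obey the same inequality, so it passes to the average and then to the
    derivative. Stepping forward for q >= 0 and backward for q < 0 keeps x nonnegative, so x = 0 is
    included for every q. *)
Lemma steklov_subsolution (l q t x : R) :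
  (forall t x h, 0 <= t -> 0 <= x -> 0 < h -> 0 <= x + q * h -> g (t + h) (x + q * h) <= g t x + h * l) ->
  0 < t -> 0 <= x -> steklov_t t x + q * steklov_x t x <= l.
Proof.
  intros H Ht Hx. destruct steklov_C11 as (C & HC & HA).
  set (Q := C * ((1 + Rabs q) * (1 + Rabs q))).
  assert (HQ : 0 <= Q) by (apply Rmult_le_pos; auto; apply Rle_0_sqr).
  apply le_epsilon. intros eps He.
  set (h := Rmin t (eps / (Q + 1))).
  assert (Hh : 0 < h) by (apply Rmin_glb_lt; auto; apply Rdiv_lt_0_compat; lra).
  assert (Hht : h <= t) by apply Rmin_l.
  assert (HhQ : Q * h <= eps).
  { apply Rle_trans with ((Q + 1) * h); [apply Rmult_le_compat_r; lra|].
    apply Rle_trans with ((Q + 1) * (eps / (Q + 1))); [apply Rmult_le_compat_l; [lra|apply Rmin_r]|right; field; lra]. }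
  assert (HQh : C * ((Rabs h + Rabs (q * h)) * (Rabs h + Rabs (q * h))) = Q * h * h).
  { rewrite Rabs_mult, (Rabs_pos_eq h) by lra. unfold Q; ring. }
  assert (Q * h * h <= eps * h) by (apply Rmult_le_compat_r; lra).
  apply Rmult_le_reg_l with h; auto.
  destruct (Rle_dec 0 q) as [Hq|Hq].
  - assert (0 <= q * h) by (apply Rmult_le_pos; lra).
    assert (Hs : steklov (t + h) (x + q * h) <= steklov t x + h * l).
    { apply steklov_segment. intros s y Hs Hy.
      replace (t + h + s) with (t + s + h) by ring. replace (x + q * h + y) with (x + y + q * h) by ring.
      apply H; lra. }
    destruct (HA t x (t + h) (x + q * h)) as (A & _).
    replace (t + h - t) with h in A by ring. replace (x + q * h - x) with (q * h) in A by ring.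
    rewrite HQh in A. apply Rabs_le_both in A. lra.
  - assert (0 <= - q * h) by (apply Rmult_le_pos; lra).
    assert (Hs : steklov t x <= steklov (t - h) (x - q * h) + h * l).
    { apply steklov_segment. intros s y Hs Hy.
      pose proof (H (t - h + s) (x - q * h + y) h ltac:(lra) ltac:(lra) Hh ltac:(lra)) as Hd.
      replace (t - h + s + h) with (t + s) in Hd by ring.
      replace (x - q * h + y + q * h) with (x + y) in Hd by ring. exact Hd. }
    destruct (HA t x (t - h) (x - q * h)) as (A & _).
    replace (t - h - t) with (- h) in A by ring. replace (x - q * h - x) with (- (q * h)) in A by ring.
    rewrite !Rabs_Ropp, HQh in A. apply Rabs_le_both in A. lra.
Qed.

(** Each space average is within K rho of the vertex value, and the quotient divides by eta: the
    branches can be matched cheaply only if rho is small compared with eta. *)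
Lemma steklov_t_vertex_close (t : R) :
  Rabs ((g (t + eta) 0 - g t 0) / eta - steklov_t t 0) <= 2 * K * rho / eta.
Proof.
  unfold steklov_t. replace (_ - _) with
    ((- (mean_x (t + eta) 0 - g (t + eta) 0) + (mean_x t 0 - g t 0)) * / eta) by (field; lra).
  rewrite Rabs_mult, (Rabs_pos_eq (/ eta)) by now apply Rinv_nonneg.
  apply Rmult_le_compat_r; [now apply Rinv_nonneg|].
  eapply Rle_trans; [apply Rabs_triang|]. rewrite Rabs_Ropp.
  pose proof (mean_x_close (t + eta) 0). pose proof (mean_x_close t 0). lra.
Qed.

Lemma mean_t_C11 : C11 (fun t _ => mean eta (fun s => g (t + s) 0)) (fun t _ => (g (t + eta) 0 - g t 0) / eta)
  (fun _ _ => 0).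
Proof.
  set (l := 2 * K / eta).
  assert (Hl : 0 <= l) by (apply Rmult_le_pos; [lra|now apply Rinv_nonneg]).
  exists l; split; auto. intros t x t' x'.
  pose proof (mean_increment eta K (fun t => g t 0) t t' Heta (g_lip_t 0)) as H1. fold l in H1. cbv beta in H1.
  set (dt := Rabs (t' - t)). set (dx := Rabs (x' - x)).
  assert (Hdt : 0 <= dt) by apply Rabs_pos. assert (Hdx : 0 <= dx) by apply Rabs_pos.
  assert (0 <= l * dx) by now apply Rmult_le_pos. assert (0 <= l * dt) by now apply Rmult_le_pos.
  rewrite Rmult_0_l, Rminus_0_r, Rminus_diag, Rabs_R0. split; [|split; [|lra]].
  - eapply Rle_trans; [apply H1|]. apply Rmult_le_compat_l; auto.
    rewrite <- (Rabs_pos_eq ((t' - t) * (t' - t))) by apply Rle_0_sqr. rewrite Rabs_mult. fold dt.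
    apply Rmult_le_compat; lra.
  - replace (_ - _) with (((g (t' + eta) 0 - g (t + eta) 0) - (g t' 0 - g t 0)) * / eta) by (field; lra).
    rewrite Rabs_mult, (Rabs_pos_eq (/ eta)) by now apply Rinv_nonneg.
    apply Rle_trans with (2 * (K * dt) * / eta); [|unfold l, Rdiv in *; lra].
    apply Rmult_le_compat_r; [now apply Rinv_nonneg|].
    eapply Rle_trans; [apply Rabs_minus_le|].
    pose proof (g_lip_t 0 (t' + eta) (t + eta)) as A. pose proof (g_lip_t 0 t' t) as B. cbv beta in A, B.
    replace (t' + eta - (t + eta)) with (t' - t) in A by ring. unfold dt. lra.
Qed.

Lemma mean_t_close (t : R) : Rabs (mean eta (fun s => g (t + s) 0) - g t 0) <= K * eta.
Proof.
  rewrite <- (mean_const eta (g t 0)) by auto.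
  apply mean_close with K 0; auto using lipschitz_const.
  - apply (lipschitz_shift K t (fun t => g t 0)), g_lip_t.
  - intros s Hs. eapply Rle_trans; [apply (g_lip_t 0)|]. apply Rmult_le_compat_l; auto. apply Rabs_le; lra.
Qed.

End Steklov.

(** * Supersolutions lie above the value function *)

Section Supersolution.
Context (N : nat) (e : nat -> pt) (L : nat -> R -> R) (gamma : R) (u0 : pt -> R) (K C T : R).
Context (HJ : junction N e) (HA1 : hypA1 N L gamma) (HB : plan_bounds N e L u0 K C).

Local Notation W := (value N e L u0).
Local Notation d := (dJ N e).

(** Extends W by projection onto t >= 0, r >= 0, so that the Lipschitz bound holds on the whole
    plane, as the averages require. *)
Definition value_branch (i : nat) (t r : R) : R := W (Rmax t 0) (scal (Rmax r 0) (e i)).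

Lemma Rmax_0_lipschitz (x y : R) : Rabs (Rmax x 0 - Rmax y 0) <= Rabs (x - y).
Proof.
  unfold Rmax; destruct (Rle_dec x 0), (Rle_dec y 0); unfold Rabs; repeat destruct (Rcase_abs _); lra.
Qed.

Lemma value_branch_lipschitz (i : nat) (t x s y : R) : (i < N)%nat ->
  Rabs (value_branch i t x - value_branch i s y) <= (2 * C + K) * (Rabs (t - s) + Rabs (x - y)).
Proof.
  intro Hi. unfold value_branch.
  pose proof (Rmax_r t 0). pose proof (Rmax_r s 0). pose proof (Rmax_r x 0). pose proof (Rmax_r y 0).
  eapply Rle_trans; [apply (value_lipschitz N e L u0 K C HJ HB); auto; apply (inJ_scal N e); auto|].
  destruct HB as (HK & HC & _). apply Rmult_le_compat_l; [lra|].
  rewrite (dJ_same N e HJ) by auto. apply Rplus_le_compat; apply Rmax_0_lipschitz.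
Qed.

Lemma value_branch_eq (i : nat) (t r : R) : 0 <= t -> 0 <= r -> value_branch i t r = W t (scal r (e i)).
Proof. intros Ht Hr. unfold value_branch. now rewrite !Rmax_left by auto. Qed.

Lemma value_branch_vertex (i j : nat) (t : R) : value_branch i t 0 = value_branch j t 0.
Proof. unfold value_branch. rewrite (Rmax_left 0 0) by lra. now rewrite !scal_zero. Qed.

(* Steklov average of the value function on each branch, corrected by a function of time
   so that the branches match at the vertex. *)
Definition smoothed (eta rho : R) (i : nat) (t r : R) : R :=
  mean eta (fun s => value_branch i (t + s) 0) +
    (steklov eta rho (value_branch i) t r - steklov eta rho (value_branch i) t 0).
Definition smoothed_t (eta rho : R) (i : nat) (t r : R) : R :=
  (value_branch i (t + eta) 0 - value_branch i t 0) / eta +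
    (steklov_t eta rho (value_branch i) t r - steklov_t eta rho (value_branch i) t 0).
Definition smoothed_x (eta rho : R) (i : nat) (t r : R) : R := steklov_x eta rho (value_branch i) t r.

Lemma smoothed_vertex (eta rho : R) (i j : nat) (t : R) : smoothed eta rho i t 0 = smoothed eta rho j t 0.
Proof.
  unfold smoothed. rewrite !Rminus_diag. f_equal. unfold mean. f_equal.
  f_equal. apply functional_extensionality. intro s. apply value_branch_vertex.
Qed.

Lemma smoothed_t_vertex (eta rho : R) (i j : nat) (t : R) : smoothed_t eta rho i t 0 = smoothed_t eta rho j t 0.
Proof.
  unfold smoothed_t. now rewrite !Rminus_diag, (value_branch_vertex i j t), (value_branch_vertex i j (t + eta)).
Qed.

Lemma smoothed_C11 (eta rho : R) (i : nat) : 0 < eta -> 0 < rho -> (i < N)%nat ->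
  C11 (smoothed eta rho i) (smoothed_t eta rho i) (smoothed_x eta rho i).
Proof.
  intros He Hr Hi. destruct HB as (HK & HC & _).
  assert (Hl := fun t x s y => value_branch_lipschitz i t x s y Hi).
  assert (HM : 0 <= 2 * C + K) by lra.
  pose proof (mean_t_C11 _ eta HM He _ Hl) as C1.
  pose proof (steklov_C11 _ eta rho HM He Hr _ Hl) as C2.
  pose proof (C11_mult_const (-1) _ _ _ (C11_at_zero _ _ _ C2)) as C3.
  apply (C11_ext _ _ _ _ _ _ (C11_plus _ _ _ _ _ _ C1 (C11_plus _ _ _ _ _ _ C2 C3)));
    intros; unfold smoothed, smoothed_t, smoothed_x; ring.
Qed.

(** The time mean contributes one eta and each of the two Steklov averages at most two, since rho <=
    eta. *)
Lemma smoothed_close (eta rho : R) (i : nat) (t r : R) : 0 < eta -> 0 < rho -> rho <= eta -> (i < N)%nat ->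
  0 <= t -> 0 <= r -> Rabs (smoothed eta rho i t r - W t (scal r (e i))) <= 5 * (2 * C + K) * eta.
Proof.
  intros He Hr Hre Hi Ht Hr0. destruct HB as (HK & HC & _).
  assert (Hl := fun t x s y => value_branch_lipschitz i t x s y Hi).
  assert (HM : 0 <= 2 * C + K) by lra.
  pose proof (mean_t_close _ eta HM He _ Hl t) as C1.
  pose proof (steklov_close _ eta rho HM He Hr _ Hl t r) as C2.
  pose proof (steklov_close _ eta rho HM He Hr _ Hl t 0) as C3.
  rewrite <- value_branch_eq by auto. unfold smoothed.
  apply Rabs_le_both in C1, C2, C3.
  assert ((2 * C + K) * rho <= (2 * C + K) * eta) by (apply Rmult_le_compat_l; lra).
  apply Rabs_le; lra.
Qed.

Lemma smoothed_subsolution (eta rho : R) (i : nat) (t r q : R) : 0 < eta -> 0 < rho -> (i < N)%nat ->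
  0 < t -> 0 <= r -> smoothed_t eta rho i t r + q * smoothed_x eta rho i t r <= L i q + 2 * (2 * C + K) * rho / eta.
Proof.
  intros He Hr Hi Ht Hr0. pose proof HB as (HK & HC & _).
  assert (Hl := fun t x s y => value_branch_lipschitz i t x s y Hi).
  assert (HM : 0 <= 2 * C + K) by lra.
  pose proof (Rabs_le_both _ _ (steklov_t_vertex_close _ eta rho HM He Hr _ Hl t)) as C1.
  assert (steklov_t eta rho (value_branch i) t r + q * steklov_x eta rho (value_branch i) t r <= L i q).
  { apply (steklov_subsolution _ eta rho HM He Hr _ Hl); auto.
    intros s x h Hs Hx Hh Hxh. rewrite !value_branch_eq by lra.
    pose proof (value_dpp' N e L u0 K C HJ HB s (s + h) i x (x + q * h) q Hs ltac:(lra) Hi Hx Hxh ltac:(ring)) as Hd.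
    replace (s + h - s) with h in Hd by ring. exact Hd. }
  unfold smoothed_t, smoothed_x. lra.
Qed.

Context (v : R -> pt -> R) (Hv : supersolution N e L u0 T v).
Context (C1 : R) (Hlow : forall t x, 0 < t < T -> inJ N e x -> u0 x - C1 <= v t x).

(* Minimize v minus the smoothed value function, made a strict subsolution and coercive by
   a small convex combination with the strict subsolution - (K + 1) x - K' t. *)
Lemma supersolution_ge_value (ts : R) (xs : pt) : 0 < ts < T -> inJ N e xs -> W ts xs <= v ts xs.
Proof.
  intros Hts Hxs. apply Rnot_lt_le; intro Hlt.
  destruct Hv as (Hlsc & Htest & Hini).
  destruct (inJ_elim N e xs Hxs) as (is & rs & His & Hrs & Exs).
  set (Th := W ts xs - v ts xs). assert (HTh : 0 < Th) by (unfold Th; lra).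
  pose proof HB as (HK & HC & Hu0 & _).
  set (Kw := 2 * C + K + 1). assert (HKw : 0 < Kw) by (unfold Kw; lra).
  destruct (L_superlinear N L gamma HA1 (K + 1)) as (C2 & HC2 & HL).
  set (K' := C2 + 1).
  (* Collects what the weight [lam] multiplies at the target point, and the value of [u0] at the
     vertex, so that lam S0 <= Th/8. *)
  set (S0 := Rabs (W ts xs) + (K + 1) * rs + K' * ts + Rabs (u0 origin) + 1).
  assert (HS0 : 1 <= S0).
  { unfold S0. pose proof (Rabs_pos (W ts xs)). pose proof (Rabs_pos (u0 origin)).
    assert (0 <= (K + 1) * rs) by (apply Rmult_le_pos; lra).
    assert (0 <= K' * ts) by (apply Rmult_le_pos; unfold K'; lra). lra. }
  set (lam := Rmin (1 / 2) (Th / (8 * S0))).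
  assert (Hlam : 0 < lam) by (apply Rmin_glb_lt; [lra|apply Rdiv_lt_0_compat; lra]).
  assert (Hlam1 : lam <= 1 / 2) by apply Rmin_l.
  assert (HlamS : lam * S0 <= Th / 8).
  { apply Rle_trans with (Th / (8 * S0) * S0); [apply Rmult_le_compat_r; [lra|apply Rmin_r]|right; field; lra]. }
  (* eta makes the smoothing error 5 Kw eta equal to Th/8; rho then makes the loss 2 Kw rho / eta
     from matching the branches equal to lam/2. *)
  set (eta := Th / (40 * Kw)).
  assert (Heta : 0 < eta) by (apply Rdiv_lt_0_compat; lra).
  set (rho := lam * eta / (4 * Kw)).
  assert (HKw1 : 1 <= Kw) by (unfold Kw; lra).
  assert (Hrho : 0 < rho) by (apply Rdiv_lt_0_compat; [now apply Rmult_lt_0_compat|lra]).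
  assert (Hre : rho <= eta).
  { apply Rmult_le_reg_l with (4 * Kw); [lra|].
    replace (4 * Kw * rho) with (lam * eta) by (unfold rho; field; lra).
    apply Rmult_le_compat_r; lra. }
  assert (Herr : 5 * (2 * C + K) * eta <= Th / 8).
  { apply Rle_trans with (5 * Kw * eta); [apply Rmult_le_compat_r; unfold Kw; lra|].
    right; unfold eta; field; lra. }
  assert (Hslack : 2 * (2 * C + K) * rho / eta <= lam / 2).
  { apply Rle_trans with (2 * Kw * rho / eta).
    - apply Rmult_le_compat_r; [now apply Rinv_nonneg|]. apply Rmult_le_compat_r; unfold Kw; lra.
    - right; unfold rho; field; lra. }
  assert (HT2 : exists T', ts < T' < T) by (exists ((ts + T) / 2); lra).
  destruct HT2 as (T' & HT').
  (* v - g is at least -D plus lam x plus the time penalty: C1 bounds u0 - v, C T bounds W - u0, and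
     Th/4 covers the smoothing and the value of [u0] at the vertex. B and [Rd] then make v - g
     nonnegative at T' and at the outer radius. *)
  set (D := Rabs C1 + C * T + Th / 4).
  assert (HD : 0 < D).
  { unfold D. pose proof (Rabs_pos C1). assert (0 <= C * T) by (apply Rmult_le_pos; lra). lra. }
  set (B := D / ((T' - ts) * (T' - ts))).
  assert (HB0 : 0 < B) by (apply Rdiv_lt_0_compat; auto; apply Rmult_lt_0_compat; lra).
  assert (HBD : B * ((T' - ts) * (T' - ts)) = D) by (unfold B; field; lra).
  set (Rd := D / lam + rs + 1).
  assert (HDl : 0 < D / lam) by (now apply Rdiv_lt_0_compat).
  set (pp := fun t => Rmax (t - ts) 0 * Rmax (t - ts) 0).
  set (g := fun (k : nat) t x => (1 - lam) * smoothed eta rho k t x + lam * (0 + - K' * t + - (K + 1) * x) + - B * pp t).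
  set (gt := fun (k : nat) t x => (1 - lam) * smoothed_t eta rho k t x + lam * - K' + - B * (2 * Rmax (t - ts) 0)).
  set (gx := fun (k : nat) t x => (1 - lam) * smoothed_x eta rho k t x + lam * - (K + 1) + - B * 0).
  assert (Hg0 : forall t k l, (k < N)%nat -> (l < N)%nat -> g k t 0 = g l t 0).
  { intros t k l _ _. unfold g. now rewrite (smoothed_vertex eta rho k l). }
  assert (HgC : forall k, (k < N)%nat -> C11 (g k) (gt k) (gx k)).
  { intros k Hk. unfold g, gt, gx, pp. apply C11_plus; [apply C11_plus|]; apply C11_mult_const.
    - now apply smoothed_C11.
    - apply C11_affine.
    - apply C11_square_pos. }
  (* Smoothing loses at most lam/2, the affine function gains lam, and the penalty, nonincreasing in
     time, only helps: lam/2 is left. *)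
  assert (Hstrict : forall k t x q, (k < N)%nat -> 0 < t -> 0 <= x -> gt k t x + q * gx k t x <= L k q - lam / 2).
  { intros k t x q Hk Ht Hx. unfold gt, gx.
    pose proof (smoothed_subsolution eta rho k t x q Heta Hrho Hk Ht Hx) as Hs.
    assert (A1 : (1 - lam) * (smoothed_t eta rho k t x + q * smoothed_x eta rho k t x) <= (1 - lam) * (L k q + lam / 2))
      by (apply Rmult_le_compat_l; lra).
    assert (A2 : lam * (- K' - (K + 1) * q) <= lam * (L k q - 1)).
    { apply Rmult_le_compat_l; [lra|]. specialize (HL k Hk q). pose proof (Rabs_ge_opp q) as Hq.
      assert ((K + 1) * - q <= (K + 1) * Rabs q) by (apply Rmult_le_compat_l; lra). unfold K'; lra. }
    assert (0 <= B * (2 * Rmax (t - ts) 0)) by (apply Rmult_le_pos; [lra|]; pose proof (Rmax_r (t - ts) 0); lra).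
    assert (0 <= lam * lam) by apply Rle_0_sqr. lra. }
  assert (Hpp : forall t, 0 <= pp t) by (intro; apply Rle_0_sqr).
  assert (Hnear : forall k t x, (k < N)%nat -> 0 <= t -> 0 <= x ->
     Rabs (smoothed eta rho k t x - W t (scal x (e k))) <= Th / 8).
  { intros k t x Hk Ht Hx. eapply Rle_trans; [apply smoothed_close; auto|exact Herr]. }
  assert (Hu0x : forall k x, (k < N)%nat -> 0 <= x -> - Rabs (u0 origin) + x <= u0 (scal x (e k)) + (K + 1) * x).
  { intros k x Hk Hx. pose proof (Hu0 (scal x (e k)) origin (inJ_scal N e k x Hk Hx) (inJ_origin N e HJ)) as Hu.
    rewrite (dJ_origin N e HJ) in Hu by auto. apply Rabs_le_both in Hu.
    pose proof (Rabs_ge_opp (u0 origin)) as Hz. lra. }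
  assert (HlamU : lam * Rabs (u0 origin) <= Th / 8).
  { eapply Rle_trans; [|apply HlamS]. apply Rmult_le_compat_l; [lra|]. unfold S0.
    pose proof (Rabs_pos (W ts xs)). assert (0 <= (K + 1) * rs) by (apply Rmult_le_pos; lra).
    assert (0 <= K' * ts) by (apply Rmult_le_pos; unfold K'; lra). lra. }
  assert (Hvalue_target : v ts (scal rs (e is)) - g is ts rs <= - (3 / 4) * Th).
  { rewrite <- Exs. pose proof (Hnear is ts rs His ltac:(lra) Hrs) as Hn. rewrite <- Exs in Hn.
    unfold g, pp. rewrite Rminus_diag, Rmax_left, Rmult_0_l, Rmult_0_r by lra.
    apply Rabs_le_both in Hn.
    assert ((1 - lam) * (smoothed eta rho is ts rs - W ts xs) >= - (Th / 8)).
    { assert ((1 - lam) * - (Th / 8) <= (1 - lam) * (smoothed eta rho is ts rs - W ts xs)) by (apply Rmult_le_compat_l; lra).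
      assert (0 <= lam * (Th / 8)) by (apply Rmult_le_pos; lra). lra. }
    assert (lam * W ts xs <= lam * Rabs (W ts xs)) by (apply Rmult_le_compat_l; [lra|apply Rle_abs]).
    assert (lam * (Rabs (W ts xs) + (K + 1) * rs + K' * ts) <= Th / 8).
    { eapply Rle_trans; [|apply HlamS]. apply Rmult_le_compat_l; [lra|]. unfold S0.
      pose proof (Rabs_pos (u0 origin)). lra. }
    unfold Th in *. lra. }
  assert (Hvalue_0 : forall k x, (k < N)%nat -> 0 <= x -> - (Th / 4) <= v 0 (scal x (e k)) - g k 0 x).
  { intros k x Hk Hx. pose proof (inJ_scal N e k x Hk Hx) as Hin.
    pose proof (Hini _ Hin) as Hi. pose proof (Rabs_le_both _ _ (Hnear k 0 x Hk ltac:(lra) Hx)) as Hn.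
    rewrite (value_zero N e L u0 K C HJ HB) in Hn by auto.
    unfold g, pp. rewrite (Rmax_right (0 - ts) 0), Rmult_0_l, !Rmult_0_r by lra.
    assert ((1 - lam) * (smoothed eta rho k 0 x - u0 (scal x (e k))) <= (1 - lam) * (Th / 8)) by (apply Rmult_le_compat_l; lra).
    assert (0 <= lam * (Th / 8)) by (apply Rmult_le_pos; lra).
    pose proof (Rmult_le_compat_l lam _ _ (Rlt_le _ _ Hlam) (Hu0x k x Hk Hx)).
    assert (0 <= lam * x) by (apply Rmult_le_pos; lra). lra. }
  assert (Hvalue_far : forall k t x, (k < N)%nat -> 0 < t <= T' -> 0 <= x ->
     lam * x - D + B * pp t <= v t (scal x (e k)) - g k t x).
  { intros k t x Hk Ht Hx. pose proof (inJ_scal N e k x Hk Hx) as Hin.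
    pose proof (Hlow t _ ltac:(lra) Hin) as Hl. pose proof (Rabs_le_both _ _ (Hnear k t x Hk ltac:(lra) Hx)) as Hn.
    pose proof (Rabs_le_both _ _ (value_bounds N e L u0 K C HJ HB t (scal x (e k)) ltac:(lra) Hin)) as Hw.
    assert (HCT : C * t <= C * T) by (apply Rmult_le_compat_l; lra).
    assert (A : (1 - lam) * (smoothed eta rho k t x - u0 (scal x (e k))) <= (1 - lam) * (Th / 8 + C * T)) by (apply Rmult_le_compat_l; lra).
    assert (0 <= lam * (Th / 8 + C * T)) by (apply Rmult_le_pos; [lra|]; assert (0 <= C * T) by (apply Rmult_le_pos; lra); lra).
    pose proof (Rmult_le_compat_l lam _ _ (Rlt_le _ _ Hlam) (Hu0x k x Hk Hx)).
    assert (0 <= lam * (K' * t)) by (apply Rmult_le_pos; [lra|]; apply Rmult_le_pos; unfold K'; lra).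
    pose proof (Rle_abs C1). unfold g, D. lra. }
  destruct (usc_max_branches N 0 T' Rd (fun k t r => - v t (scal r (e k)) - - g k t r))
    as (k0 & t0 & x0 & Hk0 & Ht0 & Hx0 & Hmax).
  { apply (branch0 N e HJ). }
  { lra. }
  { unfold Rd; lra. }
  { intros k Hk. apply (usc2_minus_C11 0 T' 0 Rd _ (fun t r => - g k t r) (fun t r => - gt k t r) (fun t r => - gx k t r)).
    - apply (usc_on_branch N e HJ T 0 T' Rd (fun t x => - v t x)); auto; try lra. now apply lsc_on_opp.
    - apply (C11_ext _ _ _ _ _ _ (C11_mult_const (-1) _ _ _ (HgC k Hk))); intros; ring. }
  assert (Hmin : forall j s z, (j < N)%nat -> 0 <= s <= T' -> 0 <= z <= Rd ->
     v t0 (scal x0 (e k0)) - g k0 t0 x0 <= v s (scal z (e j)) - g j s z).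
  { intros j s z Hj Hs Hz. specialize (Hmax j s z Hj Hs Hz). cbv beta in Hmax. lra. }
  clear Hmax.
  assert (Hneg : v t0 (scal x0 (e k0)) - g k0 t0 x0 <= - (3 / 4) * Th).
  { eapply Rle_trans; [apply (Hmin is ts rs His)|exact Hvalue_target]; [lra|unfold Rd; lra]. }
  assert (Hnt0 : t0 <> 0).
  { intro E. rewrite E in Hneg. pose proof (Hvalue_0 k0 x0 Hk0 ltac:(lra)). lra. }
  pose proof (Hvalue_far k0 t0 x0 Hk0 ltac:(lra) ltac:(lra)) as Hfar.
  assert (Hlx : 0 <= lam * x0) by (apply Rmult_le_pos; lra).
  assert (HntT : t0 <> T').
  { intro E. assert (pp t0 = (T' - ts) * (T' - ts)) as Ep by (unfold pp; rewrite E, Rmax_left by lra; auto).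
    rewrite Ep, HBD in Hfar. lra. }
  assert (HnR : x0 <> Rd).
  { intro E. assert (0 <= B * pp t0) by (apply Rmult_le_pos; auto; lra).
    assert (lam * Rd = D + lam * (rs + 1)) by (unfold Rd; field; lra).
    assert (0 <= lam * (rs + 1)) by (apply Rmult_le_pos; lra).
    rewrite E in Hfar. rewrite E in Hneg. lra. }
  assert (Htouch := box_touch_below N e HJ T 0 T' Rd v g k0 t0 x0 Hg0 Hk0 ltac:(lra) ltac:(lra) Hmin).
  set (m := v t0 (scal x0 (e k0)) - g k0 t0 x0) in *.
  destruct (Htest _ gt gx t0 (scal x0 (e k0))
    (test_fun_C1star N e HJ T (fun j s z => g j s z + m) gt gx
      (fun t i j Hi Hj => f_equal (fun z => z + _) (Hg0 t i j Hi Hj))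
      (fun k Hk => C11_plus_const _ _ _ _ (HgC k Hk)))
    ltac:(lra) (inJ_scal N e k0 x0 Hk0 ltac:(lra)) Htouch) as [Hint Hver].
  destruct (Req_dec x0 0) as [Ex|Ex].
  - rewrite Ex, scal_zero in Hver. specialize (Hver eq_refl).
    assert (Hvertex N L (fun i => gx i t0 0) <= - gt O t0 0 - lam / 2); [|lra].
    apply (Hvertex_le N e L HJ). intros i Hi. apply (Hminus_lub N L gamma HA1 i); auto. intros q _.
    pose proof (Hstrict i t0 0 q Hi ltac:(lra) ltac:(lra)).
    assert (gt O t0 0 = gt i t0 0) by (unfold gt; now rewrite (smoothed_t_vertex eta rho O i)). lra.
  - specialize (Hint k0 x0 Hk0 ltac:(lra) eq_refl).
    assert (Hfun (L k0) (gx k0 t0 x0) <= - gt k0 t0 x0 - lam / 2); [|lra].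
    apply (Hfun_lub N L gamma HA1 k0); auto. intro q.
    pose proof (Hstrict k0 t0 x0 q Hk0 ltac:(lra) ltac:(lra)). lra.
Qed.

End Supersolution.

(** * Envelopes of an arbitrary solution, and the conclusion *)

Section EnvelopeBounds.
Context (N : nat) (e : nat -> pt) (T : R) (v : R -> pt -> R) (HJ : junction N e).

Lemma ustar_ge (t : R) (x : pt) (a : R) : dom N e T t x -> ustar N e T v t x = Fin a -> v t x <= a.
Proof.
  intros Hd E. destruct (ERInf_spec (fun w => exists r, 0 < r /\
    w = ERSup (fun w => exists s y, dom N e T s y /\ Rabs (s - t) < r /\ dJ N e y x < r /\ w = Fin (v s y)))) as [_ H].
  unfold ustar in E. rewrite E in H. apply (H (Fin (v t x))). intros w (r & Hr & ->).
  match goal with |- context [ERSup ?S] => destruct (ERSup_spec S) as [H' _] end.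
  apply H'. exists t, x. rewrite Rminus_diag, Rabs_R0, (dJ_refl N e HJ) by apply Hd. auto.
Qed.

Lemma lstar_le (t : R) (x : pt) (a : R) : dom N e T t x -> lstar N e T v t x = Fin a -> a <= v t x.
Proof.
  intros Hd E. destruct (ERSup_spec (fun w => exists r, 0 < r /\
    w = ERInf (fun w => exists s y, dom N e T s y /\ Rabs (s - t) < r /\ dJ N e y x < r /\ w = Fin (v s y)))) as [_ H].
  unfold lstar in E. rewrite E in H. apply (H (Fin (v t x))). intros w (r & Hr & ->).
  match goal with |- context [ERInf ?S] => destruct (ERInf_spec S) as [H' _] end.
  apply H'. exists t, x. rewrite Rminus_diag, Rabs_R0, (dJ_refl N e HJ) by apply Hd. auto.
Qed.

Lemma lstar_lower_bound (t : R) (x : pt) (a r b : R) : 0 < r -> lstar N e T v t x = Fin a ->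
  (forall s y, dom N e T s y -> Rabs (s - t) < r -> dJ N e y x < r -> b <= v s y) -> b <= a.
Proof.
  intros Hr E Hb. destruct (ERSup_spec (fun w => exists r, 0 < r /\
    w = ERInf (fun w => exists s y, dom N e T s y /\ Rabs (s - t) < r /\ dJ N e y x < r /\ w = Fin (v s y)))) as [H _].
  unfold lstar in E. rewrite E in H.
  apply (ERle_trans (Fin b) (ERInf (fun w => exists s y, dom N e T s y /\ Rabs (s - t) < r /\ dJ N e y x < r /\ w = Fin (v s y))) (Fin a)).
  - match goal with |- context [ERInf ?S] => destruct (ERInf_spec S) as [_ H'] end.
    apply H'. intros w (s & y & H1 & H2 & H3 & ->); simpl. auto.
  - apply H. exists r; auto.
Qed.

End EnvelopeBounds.

Theorem mainTheorem3 (N : nat) (e : nat -> pt) (L : nat -> R -> R) (gamma : R)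
  (u0 : pt -> R) (T : R) :
  junction N e -> hypA0 N e u0 -> hypA1 N L gamma -> 0 < T ->
  let u := fun t x => ERreal (uoc N e L u0 t x) in
  (* u_oc is finite on [0,T) x J *)
  (forall t x, 0 <= t < T -> inJ N e x -> uoc N e L u0 t x = Fin (u t x)) /\
  (* u_oc is a viscosity solution with u(0,.) = u0 and |u_oc - u0| <= C_T *)
  solution N e L u0 T u /\
  (exists C, forall t x, 0 < t < T -> inJ N e x -> Rabs (u t x - u0 x) <= C) /\
  (* uniqueness among solutions with |v - u0| <= C_T *)
  (forall v : R -> pt -> R, solution N e L u0 T v ->
     (exists C, forall t x, 0 < t < T -> inJ N e x -> Rabs (v t x - u0 x) <= C) ->
     forall t x, 0 < t < T -> inJ N e x -> v t x = u t x) /\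
  (* Hopf-Lax type formula *)
  (forall t x, 0 < t < T -> inJ N e x ->
     uoc N e L u0 t x =
     ERInf (fun w => exists y, inJ N e y /\ w = ERplusR (u0 y) (Dact N e L 0 y t x))).
Proof.
  intros HJ HA0 HA1 HT u.
  destruct (plan_bounds_ex N e L gamma u0 HJ HA0 HA1) as (K & C & HB).
  assert (Huoc : forall t x, 0 <= t -> inJ N e x -> uoc N e L u0 t x = Fin (value N e L u0 t x))
    by (intros; now apply (uoc_eq_value N e L gamma u0 K C)).
  assert (Hu : forall t x, 0 <= t -> inJ N e x -> u t x = value N e L u0 t x)
    by (intros t x Ht Hx; unfold u; now rewrite Huoc).
  assert (Hcont : forall t x, dom N e T t x -> forall eps, 0 < eps -> exists r, 0 < r /\
     forall s y, dom N e T s y -> Rabs (s - t) < r -> dJ N e y x < r -> Rabs (u s y - u t x) < eps).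
  { intros t x [Ht Hx] eps He.
    destruct (value_continuous N e L u0 K C HJ HB t x eps ltac:(lra) Hx He) as (r & Hr & H).
    exists r; split; auto. intros s y [Hs Hy] H1 H2. rewrite !Hu by (auto; lra). apply H; auto; lra. }
  assert (Hus : forall t x, dom N e T t x -> ustar N e T u t x = Fin (u t x))
    by (intros t x Hd; apply ustar_of_continuous; auto; apply (dJ_refl N e HJ); apply Hd).
  assert (Hls : forall t x, dom N e T t x -> lstar N e T u t x = Fin (u t x))
    by (intros t x Hd; apply lstar_of_continuous; auto; apply (dJ_refl N e HJ); apply Hd).
  split; [|split; [|split; [|split]]].
  - intros t x Ht Hx. rewrite Hu, Huoc by (auto; lra). reflexivity.
  - split; [|split].
    + intros t x Hd; split; eauto.
    + apply (value_subsolution N e L gamma u0 K C T HJ HA1 HB); auto.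
      intros t x Hd. rewrite Hus by auto. apply Hu; apply Hd.
    + apply (value_supersolution N e L gamma u0 K C T HJ HA1 HB); auto.
      intros t x Hd. rewrite Hls by auto. apply Hu; apply Hd.
  - exists (C * T). intros t x Ht Hx. rewrite Hu by (auto; lra).
    eapply Rle_trans; [apply (value_bounds N e L u0 K C HJ HB); auto; lra|].
    apply Rmult_le_compat_l; [apply HB|lra].
  - intros v (Hfin & Hsub & Hsup) (Cv & HCv) t x Ht Hx. rewrite Hu by (auto; lra).
    assert (Hd : dom N e T t x) by (split; auto; lra).
    destruct (Hfin t x Hd) as ((a & Ea) & (b & Eb)).
    (* Uniqueness is the chain W <= v_* <= v <= v^* <= W, with each comparison applied to an
       envelope. *)
    pose proof (ustar_ge N e T v HJ t x a Hd Ea) as Hva.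
    pose proof (lstar_le N e T v HJ t x b Hd Eb) as Hvb.
    pose proof (subsolution_le_value N e L gamma u0 K C T HJ HA1 HB _ Hsub t x ltac:(lra) Hx) as H1.
    cbv beta in H1. rewrite Ea in H1. simpl in H1.
    (* The growth bound concerns v at positive times only. The ball of radius min(s, 1) stays there,
       and [u0] varies by at most K on it. *)
    assert (Hlow : forall s y, 0 < s < T -> inJ N e y -> u0 y - (Cv + K) <= ERreal (lstar N e T v s y)).
    { intros s y Hs Hy. destruct (Hfin s y ltac:(split; auto; lra)) as (_ & (b' & Eb')). rewrite Eb'; simpl.
      apply (lstar_lower_bound N e T v s y b' (Rmin s 1)); auto; [apply Rmin_glb_lt; lra|].
      intros s' y' [Hs' Hy'] D1 D2. Rmin_bounds. apply Rabs_def2 in D1.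
      pose proof (Rabs_le_both _ _ (HCv s' y' ltac:(lra) Hy')).
      destruct HB as (HK & _ & Hu0 & _). pose proof (Rabs_le_both _ _ (Hu0 y' y Hy' Hy)).
      assert (K * dJ N e y' y <= K * 1) by (apply Rmult_le_compat_l; lra). lra. }
    pose proof (supersolution_ge_value N e L gamma u0 K C T HJ HA1 HB _ Hsup (Cv + K) Hlow t x Ht Hx) as H2.
    cbv beta in H2. rewrite Eb in H2. simpl in H2. lra.
  - intros t x Ht Hx. rewrite (hopf_lax N e L gamma u0 K C HJ HA1 HB) by (auto; lra). apply Huoc; auto; lra.
Qed.
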